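(* Let $-3<\gamma<0$ and $\beta>6$. There are constants $C_1=C_1(\beta,\gamma)>0$ independent of $\rho$, and $C_{*\rho}>0$ depending continuously on $\rho\in(0,\infty)$, such that the following holds for every $0\le\delta\le1$ and $\rho>0$. Assume $F_0(x,v)=\mu_{\delta,\rho}(v)+\sqrt{\bar\mu_{\delta,\rho}}(v)f_0(x,v)$ with $0\le F_0\le 1/\delta$ and $\|w_\beta f_0\|_{L^\infty_{v,x}}<\infty$, and set $$T_1:=\frac{C_1}{C_{*\rho}\left(1+\|w_\beta f_0\|_{L^\infty_{v,x}}+\|w_\beta f_0\|_{L^\infty_{v,x}}^2\right)}.$$ Then the Cauchy problem for the modified quantum Boltzmann equation $\partial_tF+v\cdot\nabla_xF=\mathcal C_\delta(F)$, $F(0,x,v)=F_0(x,v)$, has a unique mild solution $F(t,x,v)=\mu_{\delta,\rho}(v)+\sqrt{\bar\mu_{\delta,\rho}}(v)f(t,x,v)$ for $(t,x,v)\in[0,T_1]\times\Omega\times\mathbb R^3$, satisfying $0\le F(t,x,v)\le 1/\delta$ and $$\|w_\beta f\|_{L^\infty_{T_1}L^\infty_{v,x}}\le 2\|w_\beta f_0\|_{L^\infty_{v,x}}.$$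
   Context: $\Omega=\mathbb R^3$ or $\mathbb T^3$. The quantum parameter is $\delta\in[0,1]$ (for $\delta=0$, $1/\delta$ is read as $+\infty$) and $\rho>0$. The collision kernel is $B(v-u,\theta)=|v-u|^\gamma b(\theta)$, with $-3<\gamma<0$, $\cos\theta=\frac{(v-u)\cdot\omega}{|v-u|}$, and a fixed $b$ with $0\le b(\theta)\le C|\cos\theta|$. Post-collision velocities for $\omega\in\mathbb S^2$: $v'=v-[(v-u)\cdot\omega]\omega$, $u'=u+[(v-u)\cdot\omega]\omega$. Collision operator: $\mathcal C_\delta(F)(v)=\int_{\mathbb R^3}\int_{\mathbb S^2}B(v-u,\theta)[F(u')F(v')(1-\delta F(u))(1-\delta F(v))-F(u)F(v)(1-\delta F(u'))(1-\delta F(v'))]\,d\omega\,du$. $\mu_{\delta,\rho}(v)=\frac1{\delta+\rho e^{|v|^2/2}}$, $\sqrt{\bar\mu_{\delta,\rho}}(v)=\sqrt{\mu_{\delta,\rho}(v)(1-\delta\mu_{\delta,\rho}(v))}=\frac{\sqrt\rho e^{|v|^2/4}}{\delta+\rho e^{|v|^2/2}}$, $w_\beta(v)=(1+|v|)^\beta$. Norms: $\|g\|_{L^\infty_{v,x}}=\sup_{v\in\mathbb R^3}\sup_{x\in\Omega}|g(x,v)|$, $\|f\|_{L^\infty_TL^\infty_{v,x}}=\sup_{t\in[0,T]}\sup_v\sup_x|f(t,x,v)|$. Mild solution: writing $\mu=\mu_{\delta,\rho}$, $\bar\mu=\bar\mu_{\delta,\rho}$ and $h=\sqrt{\bar\mu}\,f$,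 put $\nu_\delta(v)=\iint B(v-u,\theta)[\mu(u)-\delta\mu(u)\mu(u')-\delta\mu(u)\mu(v')+\delta\mu(u')\mu(v')]\,d\omega\,du$, $K_\delta f(v)=\iint B(v-u,\theta)\Big\{\frac{\sqrt{\bar\mu(u')}}{\sqrt{\bar\mu(v)}}[\mu(v')-\delta\mu(v')\mu(u)-\delta\mu(v')\mu(v)+\delta\mu(u)\mu(v)]f(u')+\frac{\sqrt{\bar\mu(v')}}{\sqrt{\bar\mu(v)}}[\mu(u')-\delta\mu(u')\mu(u)-\delta\mu(u')\mu(v)+\delta\mu(u)\mu(v)]f(v')-\frac{\sqrt{\bar\mu(u)}}{\sqrt{\bar\mu(v)}}[\mu(v)-\delta\mu(v)\mu(u')-\delta\mu(v)\mu(v')+\delta\mu(u')\mu(v')]f(u)\Big\}\,d\omega\,du$, $\Gamma_\delta(f)(v)=\frac1{\sqrt{\bar\mu(v)}}\iint B(v-u,\theta)\{h(u')h(v')(1-\delta\mu(v)-\delta\mu(u))-h(u)h(v)(1-\delta\mu(v')-\delta\mu(u'))+\delta h(v')h(u)(\mu(v)-\mu(u'))+\delta h(u')h(u)(\mu(v)-\mu(v'))+\delta h(v')h(v)(\mu(u)-\mu(u'))+\delta h(u')h(v)(\mu(u)-\mu(v'))+\delta h(u)h(v)h(u')+\delta h(u)h(v)h(v')-\delta h(u')h(v')h(u)-\delta h(u')h(v')h(v)\}\,d\omega\,du$. $F=\mu+\sqrt{\bar\mu}f$ is a mild solution with initial datum $F_0=\mu+\sqrt{\bar\mu}f_0$ if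 $f(t,x,v)=e^{-\nu_\delta(v)t}f_0(x-vt,v)+\int_0^te^{-\nu_\delta(v)(t-s)}(K_\delta f)(s,x-v(t-s),v)\,ds+\int_0^te^{-\nu_\delta(v)(t-s)}\Gamma_\delta(f)(s,x-v(t-s),v)\,ds$. *)

(* Defs.v *)
From HB Require Import structures.
From mathcomp Require Import all_boot all_order all_algebra.
From mathcomp Require Import all_classical all_reals all_analysis.
Import Order.TTheory GRing.Theory Num.Theory numFieldNormedType.Exports.

Set Implicit Arguments.
Unset Strict Implicit.
Unset Printing Implicit Defensive.

Local Open Scope classical_set_scope.
Local Open Scope ring_scope.

Notation R2 R := (measurableTypeR R * measurableTypeR R)%type.
Notation R3 R := (measurableTypeR R * measurableTypeR R * measurableTypeR R)%type.

Lemma sigma_finite_prod d1 d2 (T1 : measurableType d1) (T2 : measurableType d2)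
    (R : realType) (m1 : {sigma_finite_measure set T1 -> \bar R})
    (m2 : {sigma_finite_measure set T2 -> \bar R}) :
  sigma_finite setT (m1 \x m2)%E.
Proof.
have /sigma_finiteP[F [TF ndF Foo]] := sigma_finiteT m1.
have /sigma_finiteP[G [TG ndG Goo]] := sigma_finiteT m2.
exists (fun n => F n `*` G n).
  rewrite -setXTT TF TG predeqE => -[x y]; split.
    move=> [/= [n _ Fnx] [k _ Gky]]; exists (maxn n k) => //; split.
    - by move: x Fnx; exact/subsetPset/ndF/leq_maxl.
    - by move: y Gky; exact/subsetPset/ndG/leq_maxr.
  by move=> [n _ []/= ? ?]; split; exists n.
move=> k; have [? ?] := Foo k; have [? ?] := Goo k.
split; first exact: measurableX.
by rewrite product_measure1E// lte_mul_pinfty// ge0_fin_numE.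
Qed.

(* Named so that a sigma-finite structure can be attached: the library's one for
   product measures is not inferred, and it is needed to iterate products. *)
Definition leb2 (R : realType) : set (R2 R) -> \bar R :=
  (@lebesgue_measure R \x @lebesgue_measure R)%E.

HB.instance Definition _ (R : realType) := Measure.on (@leb2 R).
HB.instance Definition _ (R : realType) :=
  Measure_isSigmaFinite.Build _ _ _ (@leb2 R)
    (sigma_finite_prod (@lebesgue_measure R) (@lebesgue_measure R)).

Definition leb3 (R : realType) : set (R3 R) -> \bar R :=
  (@leb2 R \x @lebesgue_measure R)%E.

HB.instance Definition _ (R : realType) := Measure.on (@leb3 R).
HB.instance Definition _ (R : realType) :=
  Measure_isSigmaFinite.Build _ _ _ (@leb3 R)
    (sigma_finite_prod (@leb2 R) (@lebesgue_measure R)).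

(* The library norm on a product type is the sup norm, so the Euclidean norm
   is spelled out. *)
Definition dot {R : realType} (v w : R3 R) : R :=
  v.1.1 * w.1.1 + v.1.2 * w.1.2 + v.2 * w.2.

Definition enorm {R : realType} (v : R3 R) : R := Num.sqrt (dot v v).

(* Spherical coordinates p = (polar angle, azimuth); the surface measure of the
   unit sphere is sin p.1 dp on [0, pi] x [0, 2 pi]. *)
Definition sphere_point {R : realType} (p : R2 R) : R3 R :=
  (sin p.1 * cos p.2, sin p.1 * sin p.2, cos p.1).

Definition v_post {R : realType} (v u omega : R3 R) : R3 R :=
  v - dot (v - u) omega *: omega.

Definition u_post {R : realType} (v u omega : R3 R) : R3 R :=
  u + dot (v - u) omega *: omega.

(* theta is the angle in [0, pi] determined by its cosine.  On the null set
   v = u the total operations make this 0, as gamma <> 0. *)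
Definition kernelB {R : realType} (gamma : R) (b : R -> R) (v u omega : R3 R) : R :=
  enorm (v - u) `^ gamma * b (acos (dot (v - u) omega / enorm (v - u))).

Definition angular_kernel {R : realType} (b : R -> R) : Prop :=
  measurable_fun `[0, pi] b /\
  exists C : R, forall theta, 0 <= theta <= pi -> 0 <= b theta <= C * `|cos theta|.

(* The double integral over R^3 x S^2 of B(v - u, theta) Phi(u, u', v') with
   respect to d omega du. *)
Definition collision_integral {R : realType} (gamma : R) (b : R -> R) (v : R3 R)
    (Phi : R3 R -> R3 R -> R3 R -> R) : R :=
  \int[(@leb3 R \x @leb2 R)%E]_(z in setT `*` (`[0, pi] `*` `[0, 2 * pi]))
    (let u := z.1 in
     let omega := sphere_point z.2 in
     kernelB gamma b v u omega * Phi u (u_post v u omega) (v_post v u omega)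
       * sin z.2.1).

Definition mu {R : realType} (delta rho : R) (v : R3 R) : R :=
  (delta + rho * expR (enorm v ^+ 2 / 2))^-1.

Definition sqrt_mubar {R : realType} (delta rho : R) (v : R3 R) : R :=
  Num.sqrt (mu delta rho v * (1 - delta * mu delta rho v)).

Definition weight {R : realType} (beta : R) (v : R3 R) : R := (1 + enorm v) `^ beta.

(* mu + sqrt(mubar) g *)
Definition perturb {R : realType} (delta rho : R) (g : R3 R -> R3 R -> R)
    (x v : R3 R) : R :=
  mu delta rho v + sqrt_mubar delta rho v * g x v.

(* nu, Kop and Gamma come from the pointwise expansion, with h = sqrt(mubar) f
   and C_delta the collision operator,
   C_delta(mu + h) = sqrt(mubar) (- nu f + Kop f + Gamma f). *)
Definition nu {R : realType} (gamma : R) (b : R -> R) (delta rho : R) (v : R3 R) : R :=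
  let m := mu delta rho in
  collision_integral gamma b v (fun u u' v' =>
    m u - delta * m u * m u' - delta * m u * m v' + delta * m u' * m v').

Definition Kop {R : realType} (gamma : R) (b : R -> R) (delta rho : R)
    (f : R3 R -> R) (v : R3 R) : R :=
  let m := mu delta rho in
  let s := sqrt_mubar delta rho in
  collision_integral gamma b v (fun u u' v' =>
      s u' / s v *
        (m v' - delta * m v' * m u - delta * m v' * m v + delta * m u * m v) * f u'
    + s v' / s v *
        (m u' - delta * m u' * m u - delta * m u' * m v + delta * m u * m v) * f v'
    - s u / s v *
        (m v - delta * m v * m u' - delta * m v * m v' + delta * m u' * m v') * f u).

Definition Gamma {R : realType} (gamma : R) (b : R -> R) (delta rho : R)
    (f : R3 R -> R) (v : R3 R) : R :=
  let m := mu delta rho in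
  let s := sqrt_mubar delta rho in
  let h := fun w => s w * f w in
  (s v)^-1 * collision_integral gamma b v (fun u u' v' =>
      h u' * h v' * (1 - delta * m v - delta * m u)
    - h u * h v * (1 - delta * m v' - delta * m u')
    + delta * h v' * h u * (m v - m u')
    + delta * h u' * h u * (m v - m v')
    + delta * h v' * h v * (m u - m u')
    + delta * h u' * h v * (m u - m v')
    + delta * h u * h v * h u'
    + delta * h u * h v * h v'
    - delta * h u' * h v' * h u
    - delta * h u' * h v' * h v).

(* [torus L] is R^3 / (L Z)^3; functions on it are represented by their
   periodic lifts to R^3. *)
Inductive spatial_domain (R : realType) : Type :=
| whole_space
| torus of {posnum R}.
Arguments whole_space {R}.

Definition defined_on {R : realType} (Omega : spatial_domain R)
    (g : R3 R -> R3 R -> R) : Prop :=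
  match Omega with
  | whole_space => True
  | torus L => forall (x v : R3 R) (i j k : int),
      g (x + L%:num *: ((i%:~R, j%:~R, k%:~R) : R3 R)) v = g x v
  end.

(* For a periodic lift the supremum over R^3 is the supremum over the torus. *)
Definition Linfty_vx {R : realType} (g : R3 R -> R3 R -> R) : \bar R :=
  ereal_sup (range (fun v : R3 R =>
    ereal_sup (range (fun x : R3 R => `|g x v|%:E)))).

Definition Linfty_Tvx {R : realType} (T : R) (f : R -> R3 R -> R3 R -> R) : \bar R :=
  ereal_sup [set Linfty_vx (f t) | t in `[0, T]].

Definition weighted {R : realType} (beta : R) (g : R3 R -> R3 R -> R) : R3 R -> R3 R -> R :=
  fun x v => weight beta v * g x v.

Definition inv_delta {R : realType} (delta : R) : \bar R :=
  if delta == 0 then +oo%E else (delta^-1)%:E.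

Definition between_0_inv_delta {R : realType} (delta : R) (F : R3 R -> R3 R -> R) : Prop :=
  forall x v, 0 <= F x v /\ ((F x v)%:E <= inv_delta delta)%E.

Definition initial_class {R : realType} (Omega : spatial_domain R) (beta : R)
    (f0 : R3 R -> R3 R -> R) : Prop :=
  [/\ measurable_fun setT (fun z : R3 R * R3 R => f0 z.1 z.2),
      defined_on Omega f0 &
      (Linfty_vx (weighted beta f0) < +oo)%E].

Definition solution_class {R : realType} (Omega : spatial_domain R) (beta T : R)
    (f : R -> R3 R -> R3 R -> R) : Prop :=
  [/\ measurable_fun [set z : measurableTypeR R * R3 R * R3 R | 0 <= z.1.1 <= T]
        (fun z => f z.1.1 z.1.2 z.2),
      forall t, 0 <= t <= T -> defined_on Omega (f t) &
      (Linfty_Tvx T (fun t => weighted beta (f t)) < +oo)%E].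

(* The perturbation form of the equation: mu + sqrt(mubar) f is a mild solution
   on [0, T] with initial datum mu + sqrt(mubar) f0. *)
Definition mild_solution {R : realType} (gamma : R) (b : R -> R) (delta rho T : R)
    (f0 : R3 R -> R3 R -> R) (f : R -> R3 R -> R3 R -> R) : Prop :=
  let n := nu gamma b delta rho in
  forall (t : R) (x v : R3 R), 0 <= t <= T ->
    f t x v =
      expR (- n v * t) * f0 (x - t *: v) v
    + \int[lebesgue_measure]_(s in `[0, t])
        (expR (- n v * (t - s)) * Kop gamma b delta rho (f s (x - (t - s) *: v)) v)
    + \int[lebesgue_measure]_(s in `[0, t])
        (expR (- n v * (t - s)) * Gamma gamma b delta rho (f s (x - (t - s) *: v)) v).

(* Main.v *)
(** Everything is driven by the Gaussian factor g = exp(-|.|^2/4).  The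
    conservation of energy gives g(v) g(u) = g(v') g(u'), and mu = O(g^2),
    sqrt(mubar) ~ g uniformly in delta, so F = mu + sqrt(mubar) f factors as g k
    with w_beta k bounded.  Hence C_delta(F) / sqrt(mubar) is, pointwise, at most
    g(u) times a cubic expression in w_beta f, and |v - u|^gamma g(u) is
    integrable in u uniformly in v because it is dominated by a product of three
    one-dimensional singularities of order gamma/3 > -1: the collision operator
    is locally Lipschitz for the weighted sup norm, without loss of weight.

    The solution is the fixed point of the mild equation written with a constant
    damping rate L instead of nu_delta(v).  For L above the loss rate, the source
    C_delta(F) + L F lies between 0 and L / delta as soon as F lies between 0 and
    1 / delta, so Picard iteration preserves this interval.  Fubini's theorem on
    the triangle then exchanges the rate L for nu_delta(v), and a sup norm with
    exponential weight in time gives uniqueness. *)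
Require Import Defs.
From HB Require Import structures.
From mathcomp Require Import all_boot all_order all_algebra.
From mathcomp Require Import all_classical all_reals all_analysis.
From mathcomp Require Import measurable_realfun ring lra.
Import Order.TTheory GRing.Theory Num.Theory numFieldNormedType.Exports.
Local Open Scope classical_set_scope.
Local Open Scope ring_scope.

Set Implicit Arguments.
Unset Strict Implicit.
Unset Printing Implicit Defensive.

(** The form with rate nu_delta(v) hides positivity: the source K f + Gamma f has no visible
    relation to the bounds on F, so they cannot be read off from that iteration. The two estimates
    on C_delta behind the constant rate use its factored form, whereas the Lipschitz estimate uses
    the expanded one, in which the quartic terms of gain and loss cancel. The density is then cubic,
    its Lipschitz constant on a ball of radius N grows like (1 + N)^2, and this is the origin of 1 +
    M + M^2 in the lifespan.

    Integrals are total, with a default value when they diverge, so every splitting of an integral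
    needs a separate domination of its parts. The ten terms of Gamma are never estimated one by one:
    Gamma is the full operator minus K plus nu, and these three are dominated directly. Since mu is
    an equilibrium, the full operator vanishes at f = 0, and its bound follows from the Lipschitz
    estimate. *)

(** * Weakly singular integrals *)

Lemma integral_prod_mul d1 d2 (T1 : measurableType d1) (T2 : measurableType d2)
    (R : realType) (m1 : {sigma_finite_measure set T1 -> \bar R})
    (m2 : {sigma_finite_measure set T2 -> \bar R})
    (f : T1 -> \bar R) (g : T2 -> \bar R) :
  measurable_fun setT f -> measurable_fun setT g ->
  (forall x, 0 <= f x)%E -> (forall y, 0 <= g y)%E ->
  (\int[m1 \x m2]_z (f z.1 * g z.2) = \int[m1]_x f x * \int[m2]_y g y)%E.
Proof.
move=> mf mg f0 g0; rewrite fubini_tonelli1; last 2 first.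
- by apply: emeasurable_funM; apply: measurableT_comp.
- by move=> z; exact: mule_ge0.
rewrite -ge0_integralZr//; last exact: integral_ge0.
by apply: eq_integral => x _; rewrite /fubini_F/= ge0_integralZl.
Qed.

Lemma integral_FTC2 (R : realType) (f F : R -> R) (a b : R) : a <= b ->
  (forall x, a <= x <= b -> {for x, continuous f}) ->
  (forall x, a <= x <= b -> is_derive x 1 F (f x)) ->
  (\int[lebesgue_measure]_(x in `[a, b]) (f x)%:E = (F b - F a)%:E)%E.
Proof.
rewrite le_eqVlt => /predU1P[<-|ab] cf dF.
  by rewrite set_itv1 integral_set1 subrr.
have cF x : a <= x <= b -> {for x, continuous F}.
  by move=> /dF dFx; apply: differentiable_continuous; apply/derivable1_diffP; case: dFx.
rewrite (continuous_FTC2 (F := F)) ?EFinB//.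
- by apply: continuous_in_subspaceT => x; rewrite inE/= in_itv/=; exact: cf.
- split=> [x| |].
  + by rewrite in_itv/= => /andP[ax xb]; case: (dF x _) => //; rewrite !ltW.
  + by apply: cvg_at_right_filter; apply: cF; rewrite lexx ltW.
  + by apply: cvg_at_left_filter; apply: cF; rewrite lexx ltW.
- move=> x; rewrite in_itv/= => /andP[ax xb]; rewrite derive1E.
  by apply/derive_val; apply: dF; rewrite !ltW.
Qed.

(** The sign e selects the side of the singularity v. The fundamental theorem is applied on the
    truncations [S n], which stay away from v, and monotone convergence removes the cut-off; the
    boundary term at the cut-off is dropped because it has the right sign. *)
Lemma integral_powR_shift (R : realType) (a e v : R) : -1 < a -> e ^+ 2 = 1 ->
  (\int[lebesgue_measure]_(u in [set u | (0 < e * (u - v) <= 1)%R])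
     ((e * (u - v)) `^ a)%:E <= ((a + 1)^-1)%:E)%E.
Proof.
move=> a1 e2; pose S n : set R := [set u | (n.+1%:R^-1 <= e * (u - v) <= 1)%R].
have e1 : e = 1 \/ e = -1.
  by move/eqP: e2; rewrite sqrf_eq1 => /orP[] /eqP; [left|right].
(* For e = -1 the endpoints come in reverse order, hence the minimum and the maximum. *)
pose lo n := v + Num.min (e * n.+1%:R^-1) e.
pose hi n := v + Num.max (e * n.+1%:R^-1) e.
have n1 (n : nat) : n.+1%:R^-1 <= 1 :> R by rewrite invf_le1 ?ler1n ?ltr0Sn.
have n0 (n : nat) : 0 < n.+1%:R^-1 :> R by rewrite invr_gt0 ltr0Sn.
have SE n : S n = `[lo n, hi n]%classic.
  rewrite /S; apply/seteqP; split=> u /=; rewrite in_itv/= /lo /hi; have := n0 n; have := n1 n;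
    move: (n.+1%:R^-1) => q q1 q0;
    case: e1 => ->; rewrite ?mul1r ?mulN1r ?(min_l q1) ?(max_r q1);
    rewrite ?min_r ?max_l ?lerN2// => /andP[? ?]; apply/andP; split; lra.
have -> : [set u | 0 < e * (u - v) <= 1] = \bigcup_n S n.
  apply/seteqP; split=> u /=.
    move=> /andP[u0 u1]; have [n nu] : exists n : nat, n.+1%:R^-1 < e * (u - v).
      by have [N _ /(_ N)/(_ (leqnn _))] := near_infty_natSinv_lt (PosNum u0); exists N.
    by exists n => //=; rewrite /S/= u1 ltW.
  by move=> [n _ /andP[u0 ->]]; rewrite andbT; exact: lt_le_trans u0.
have mp : measurable_fun setT (fun u : R => ((e * (u - v)) `^ a)%:E).
  apply/measurable_EFinP.
  apply: (measurableT_comp (measurable_powR a)).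
  apply: (measurable_funM (f := cst e)) => //.
  exact: (measurable_funB (f := id)).
pose f (u : R) := ((e * (u - v)) `^ a)%:E.
have ndS : nondecreasing_seq (S : (set (measurableTypeR R))^nat).
  apply/nondecreasing_seqP => n; rewrite subsetEset => u/= /andP[u0 u1]; apply/andP; split=> //.
  by apply: le_trans u0; rewrite lef_pV2 ?posrE ?ltr0Sn// ler_nat.
have mS n : measurable (S n : set (measurableTypeR R)) by rewrite SE.
have mf n : measurable_fun (S n : set (measurableTypeR R)) f.
  exact: measurable_funTS.
have f0 n (u : measurableTypeR R) : S n u -> (0 <= f u)%E.
  by move=> _; rewrite lee_fin powR_ge0.
rewrite -(cvg_lim _ (ge0_nondecreasing_set_cvg_integral ndS mS mf f0))//.
apply: lime_le.
  apply: ereal_nondecreasing_is_cvgn.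
  exact: ge0_nondecreasing_set_nondecreasing_integral ndS mS mf f0.
near=> n.
have pos x : lo n <= x <= hi n -> 0 < e * (x - v).
  move=> h; have : S n x by rewrite SE/= in_itv.
  by move=> /andP[+ _]; exact: lt_le_trans.
have a10 : a + 1 != 0 by lra.
pose F (u : R) := e * ((a + 1)^-1 * (e * (u - v)) `^ (a + 1)).
rewrite SE; have -> : (\int[lebesgue_measure]_(x in `[lo n, hi n]) f x =
    (F (hi n) - F (lo n))%:E)%E.
  apply: (@integral_FTC2 _ (fun u : R => (e * (u - v)) `^ a) F).
  - by rewrite /lo /hi lerD2l ge_min !le_max lexx.
  - move=> x /pos x0.
    apply: (@continuous_comp _ _ _ (fun u : R => e * (u - v)) (fun z => z `^ a)).
      by apply: continuousM; [exact: cvg_cst|apply: continuousB; [exact: cvg_id|exact: cvg_cst]].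
    apply: differentiable_continuous; apply/derivable1_diffP.
    exact: (@ex_derive _ _ _ _ _ _ _ (is_derive1_powR a x0)).
  - move=> x /pos x0.
    have d1 := is_derive1_powR (a + 1) x0.
    have d2 : is_derive x 1 (fun u : R => e * (u - v)) e.
      by apply: is_derive_eq; rewrite /GRing.scale/= ?subr0 ?mulr1 ?addr0 ?mul0r ?add0r.
    have d3 := is_derive1_comp (f := (@powR R) ^~ (a + 1)) (g := fun u : R => e * (u - v)) d1 d2.
    rewrite /F; apply: is_derive_eq; rewrite /GRing.scale/= addrK.
    have -> : e * ((a + 1)^-1 * ((a + 1) * (e * (x - v)) `^ a * e)) =
      e ^+ 2 * ((a + 1)^-1 * (a + 1)) * (e * (x - v)) `^ a by ring.
    by rewrite e2 mulVf ?mul1r.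
rewrite lee_fin /F /hi /lo; have := n0 n; have := n1 n; move: (n.+1%:R^-1) => q q1 q0.
have p0 z : 0 <= (a + 1)^-1 * z `^ (a + 1).
  by apply: mulr_ge0; rewrite ?powR_ge0// invr_ge0; lra.
have [-> | ->] := e1.
  rewrite !mul1r (max_r q1) (min_l q1).
  by rewrite (addrC v 1) addrK powR1 mulr1 gerBl p0.
have E z : v + z - v = z by ring.
rewrite (mulN1r q) max_l ?min_r ?lerN2// !E !mulN1r !opprK.
by rewrite powR1 mulr1 addrC gerBl p0.
Unshelve. all: by end_near. Qed.

Lemma measurable_dist_powR (R : realType) (v a : R) :
  measurable_fun setT (fun u : R => `|v - u| `^ a).
Proof.
apply: (measurableT_comp (measurable_powR a)); apply: (measurableT_comp (@normr_measurable _ _)).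
exact: (measurable_funB (f := cst v)).
Qed.

(** The integrand is a multiple of the normal density of standard deviation sqrt 2, for which twice
    the variance is 4. *)
Lemma integral_gauss_lty (R : realType) :
  (\int[@lebesgue_measure R]_u (expR (- u ^+ 2 / 4))%:E < +oo)%E.
Proof.
pose s := Num.sqrt (2 : R).
have s0 : s != 0 by rewrite sqrtr_eq0 -ltNge.
have p0 := normal_peak_gt0 s0.
have E u : (expR (- u ^+ 2 / 4))%:E = ((normal_peak s)^-1%:E * (normal_pdf 0 s u)%:E)%E.
  rewrite -EFinM normal_pdfE//= mulrA mulVf ?gt_eqF// mul1r /normal_fun subr0 sqr_sqrtr//.
  by congr (expR (_ / _))%:E; lra.
under eq_integral do rewrite E.
rewrite ge0_integralZl//.
- by rewrite integral_normal_pdf mule1 ltry.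
- by apply/measurable_EFinP; exact: measurable_normal_pdf.
- by move=> u _; rewrite lee_fin normal_pdf_ge0.
- by rewrite lee_fin invr_ge0 ltW.
Qed.

(* The value +oo at [u = v] replaces the junk value [0 `^ a = 0], so that
   products of these functions dominate the kernel everywhere. *)
Definition sing1 {R : realType} (a v u : R) : \bar R :=
  if u == v then +oo%E else (`|v - u| `^ a * expR (- u ^+ 2 / 4))%:E.

Lemma sing1_ge0 (R : realType) (a v u : R) : (0 <= sing1 a v u)%E.
Proof. by rewrite /sing1; case: ifP => // _; rewrite lee_fin mulr_ge0 ?powR_ge0 ?expR_ge0. Qed.

Lemma measurable_gauss1 (R : realType) :
  measurable_fun setT (fun u : R => expR (- u ^+ 2 / 4)).
Proof.
apply: measurableT_comp => //.
apply: (measurable_funM (f := fun u : R => - u ^+ 2)) => //.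
by apply: measurableT_comp => //; exact: exprn_measurable.
Qed.

Lemma measurable_sing1 (R : realType) (a v : R) : measurable_fun setT (sing1 a v).
Proof.
apply: measurable_fun_ifT => //.
- exact: (measurable_fun_eqr (f := id) (g := cst v)).
- apply/measurable_EFinP; apply: measurable_funM; first exact: measurable_dist_powR.
  exact: measurable_gauss1.
Qed.

(** Where |v - u| <= 1 the Gaussian is at most 1 and each side of v contributes 1/(a + 1); where |v
    - u| > 1 the power is at most 1 and the Gaussian integral remains. Neither bound depends on
    v. *)
Lemma integral_sing1_bounded (R : realType) (a : R) : -1 < a <= 0 ->
  exists J : R, forall v, (\int[lebesgue_measure]_u sing1 a v u <= J%:E)%E.
Proof.
move=> /andP[a1 a0].
have [G GE] : exists G : R, (\int[@lebesgue_measure R]_u (expR (- u ^+ 2 / 4))%:E = G%:E)%E.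
  exists (fine (\int[@lebesgue_measure R]_u (expR (- u ^+ 2 / 4))%:E)%E); rewrite fineK//.
  rewrite ge0_fin_numE ?integral_gauss_lty//.
  by apply: integral_ge0 => u _; rewrite lee_fin expR_ge0.
exists ((a + 1)^-1 + (a + 1)^-1 + G) => v.
pose h (e u : R) := ((e * (u - v)) `^ a)%:E.
pose S (e : R) : set (measurableTypeR R) := [set u | 0 < e * (u - v) <= 1].
have mh e : measurable_fun setT (h e).
  apply/measurable_EFinP; apply: (measurableT_comp (measurable_powR a)).
  by apply: (measurable_funM (f := cst e)) => //; exact: (measurable_funB (f := id)).
have mS e : measurable (S e).
  have -> : S e = (fun u : R => e * (u - v)) @^-1` `]0, 1].
    by apply/seteqP; split=> u /=; rewrite in_itv.
  rewrite -[X in measurable X]setTI; apply: (_ : measurable_fun setT _) => //.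
  by apply: (measurable_funM (f := cst e)) => //; exact: (measurable_funB (f := id)).
have hb e : e ^+ 2 = 1 -> (\int[lebesgue_measure]_u ((h e) \_ (S e)) u <= ((a + 1)^-1)%:E)%E.
  by move=> e2; rewrite -integral_mkcond; exact: integral_powR_shift.
have h0 e u : (0 <= (h e \_ (S e)) u)%E.
  by rewrite patchE; case: ifP => // _; rewrite lee_fin powR_ge0.
have mhS e : measurable_fun setT (h e \_ (S e)).
  by apply: (measurable_restrictT (h e) (mS e)).1; exact: measurable_funTS.
have mg : measurable_fun setT (fun u : R => (expR (- u ^+ 2 / 4))%:E).
  by apply/measurable_EFinP; exact: measurable_gauss1.
(* At u = v, [sing1] is +oo and the majorant [H] below is finite: the comparison is made off this
   null point, which is put back afterwards. *)
rewrite -(@integral_setD1 _ _ v)//; last 2 first.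
- exact: measurableD.
- by apply: measurable_funTS; exact: measurable_sing1.
pose hp := h 1 \_ (S 1); pose hm := h (-1) \_ (S (-1)).
pose g (u : measurableTypeR R) : \bar R := (expR (- u ^+ 2 / 4))%:E.
pose H (u : measurableTypeR R) : \bar R := (hp u + hm u + g u)%E.
have mH : measurable_fun setT H.
  by apply: emeasurable_funD => //; apply: emeasurable_funD; exact: mhS.
have g0 u : (0 <= g u)%E by rewrite lee_fin expR_ge0.
apply: (@le_trans _ _ (\int[lebesgue_measure]_(u in setT `\ v) H u)%E).
  apply: ge0_le_integral => //.
  - exact: measurableD.
  - by move=> u _; exact: sing1_ge0.
  - by apply: measurable_funTS; exact: measurable_sing1.
  - exact: measurable_funTS.
  - move=> u [_ /= uv]; rewrite /sing1; case: eqP => // _.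
    have d0 : 0 < `|v - u| by rewrite normr_gt0 subr_eq0; apply/eqP => vu; exact: uv.
    have [d1|d1] := leP `|v - u| 1.
      have : (`|v - u| `^ a)%:E = h 1 u /\ S 1 u \/ (`|v - u| `^ a)%:E = h (-1) u /\ S (-1) u.
        have [vu|uv'] := ltP v u; [left|right]; rewrite /h /S/=.
          by rewrite mul1r ltr0_norm ?subr_lt0// opprB subr_gt0 vu in d0 d1 *.
        by rewrite mulN1r opprB ger0_norm ?subr_ge0// in d0 d1 *; rewrite d0.
      have le1 : ((`|v - u| `^ a * expR (- u ^+ 2 / 4))%:E <= (`|v - u| `^ a)%:E)%E.
        rewrite lee_fin ler_piMr ?powR_ge0// -[leRHS]expR0 ler_expR.
        by rewrite mulNr oppr_le0 divr_ge0 ?sqr_ge0.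
      have hp0 : (0 <= hp u)%E := h0 _ _; have hm0 : (0 <= hm u)%E := h0 _ _.
      move=> [[hE Su]|[hE Su]]; apply: (le_trans le1); rewrite hE /H.
        have -> : h 1 u = hp u by rewrite /hp patchE mem_set.
        by rewrite -addeA leeDl// adde_ge0.
      have -> : h (-1) u = hm u by rewrite /hm patchE mem_set.
      by rewrite -addeA addeCA leeDl// adde_ge0.
    apply: (@le_trans _ _ (g u)); last by rewrite /H leeDr// adde_ge0//; exact: h0.
    rewrite lee_fin ler_piMl ?expR_ge0//.
    by rewrite -[leRHS](powRr0 `|v - u|) ler_powR// ltW.
rewrite integral_setD1//; last 2 first.
- exact: measurableD.
- exact: measurable_funTS.
rewrite ge0_integralD//; last 2 first.
- by move=> u _; apply: adde_ge0; exact: h0.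
- by apply: emeasurable_funD; exact: mhS.
rewrite ge0_integralD//; last 4 first.
- by move=> u _; exact: h0.
- exact: mhS.
- by move=> u _; exact: h0.
- exact: mhS.
by rewrite /g GE 2!EFinD leeD// leeD// hb ?sqrrN ?expr1n.
Qed.

Lemma sing1_gt0 (R : realType) (a v u : R) : (0 < sing1 a v u)%E.
Proof.
rewrite /sing1; case: eqP => [//|uv].
rewrite lte_fin mulr_gt0 ?expR_gt0// powR_gt0// normr_gt0 subr_eq0.
by apply/eqP => vu; exact: uv.
Qed.

Lemma powR_le0_anti (R : realType) (a x y : R) : a <= 0 -> 0 < x -> x <= y ->
  y `^ a <= x `^ a.
Proof.
move=> a0 x0 xy; have y0 := lt_le_trans x0 xy.
rewrite -[a]opprK !(powRN _ (- a)) lef_pV2 ?posrE ?powR_gt0//.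
by apply: ge0_ler_powR; rewrite ?nnegrE ?oppr_ge0// ltW.
Qed.

Definition gauss {R : realType} (v : R3 R) : R := expR (- dot v v / 4).

Lemma dot_ge0 (R : realType) (v : R3 R) : 0 <= dot v v.
Proof. by rewrite /dot !addr_ge0// -expr2 sqr_ge0. Qed.

Lemma enorm_sqr (R : realType) (v : R3 R) : enorm v ^+ 2 = dot v v.
Proof. by rewrite sqr_sqrtr// dot_ge0. Qed.

Lemma enorm_ge0 (R : realType) (v : R3 R) : 0 <= enorm v.
Proof. exact: sqrtr_ge0. Qed.

Lemma gauss_gt0 (R : realType) (v : R3 R) : 0 < gauss v.
Proof. exact: expR_gt0. Qed.

Lemma gauss_le1 (R : realType) (v : R3 R) : gauss v <= 1.
Proof. by rewrite -[leRHS]expR0 ler_expR mulNr oppr_le0 divr_ge0 ?dot_ge0. Qed.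

(** Each coordinate difference is at most |v - u|, and a negative power reverses the comparison. If
    some coordinates of u and v agree, the right-hand side is +oo because all its factors are
    positive. *)
Lemma enorm_powR_gauss_le (R : realType) (gamma : R) (v u : R3 R) : gamma < 0 ->
  ((enorm (v - u) `^ gamma * gauss u)%:E <=
    sing1 (gamma / 3) v.1.1 u.1.1 * sing1 (gamma / 3) v.1.2 u.1.2
      * sing1 (gamma / 3) v.2 u.2)%E.
Proof.
move=> g0; set a := gamma / 3; have a0 : a <= 0 by rewrite /a; lra.
have [E|/eqP n1] := eqVneq u.1.1 v.1.1.
  by rewrite {1}/sing1 E eqxx !gt0_mulye ?sing1_gt0 ?leey.
have [E|/eqP n2] := eqVneq u.1.2 v.1.2.
  by rewrite {2}/sing1 E eqxx gt0_muley ?gt0_mulye ?sing1_gt0 ?leey.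
have [E|/eqP n3] := eqVneq u.2 v.2.
  by rewrite {3}/sing1 E eqxx gt0_muley ?mule_gt0 ?sing1_gt0 ?leey.
have d0 (x y : R) : y <> x -> 0 < `|x - y|.
  by move=> yx; rewrite normr_gt0 subr_eq0; apply/eqP => xy; exact: yx.
rewrite /sing1; do 3 case: eqP => // _.
rewrite -!EFinM lee_fin.
have le_n (x : R) : x ^+ 2 <= dot (v - u) (v - u) -> x != 0 ->
    enorm (v - u) `^ a <= `|x| `^ a.
  move=> xd x0; apply: powR_le0_anti => //; first by rewrite normr_gt0.
  by rewrite -sqrtr_sqr ler_sqrt// dot_ge0.
have -> : gauss u = expR (- u.1.1 ^+ 2 / 4) * expR (- u.1.2 ^+ 2 / 4) * expR (- u.2 ^+ 2 / 4).
  by rewrite /gauss -!expRD; congr expR; rewrite /dot; field.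
have e0 : 0 < enorm (v - u).
  rewrite sqrtr_gt0 /dot /=.
  have := d0 _ _ n1; rewrite normr_gt0 => h.
  have : 0 < (v.1.1 - u.1.1) ^+ 2 by rewrite exprn_even_gt0.
  by move: (sqr_ge0 (v.1.2 - u.1.2)) (sqr_ge0 (v.2 - u.2)); rewrite !expr2; lra.
have -> : enorm (v - u) `^ gamma = enorm (v - u) `^ a * enorm (v - u) `^ a * enorm (v - u) `^ a.
  by rewrite -!powRD ?(gt_eqF e0) ?implybT//; congr (_ `^ _); rewrite /a; field.
have N (x y : R) : y <> x -> x - y != 0.
  by move=> yx; rewrite subr_eq0; apply/eqP => xy; exact: yx.
have h1 : enorm (v - u) `^ a <= `|v.1.1 - u.1.1| `^ a.
  apply: le_n; last exact: N; rewrite /dot/=.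
  by move: (sqr_ge0 (v.1.2 - u.1.2)) (sqr_ge0 (v.2 - u.2)); rewrite !expr2; lra.
have h2 : enorm (v - u) `^ a <= `|v.1.2 - u.1.2| `^ a.
  apply: le_n; last exact: N; rewrite /dot/=.
  by move: (sqr_ge0 (v.1.1 - u.1.1)) (sqr_ge0 (v.2 - u.2)); rewrite !expr2; lra.
have h3 : enorm (v - u) `^ a <= `|v.2 - u.2| `^ a.
  apply: le_n; last exact: N; rewrite /dot/=.
  by move: (sqr_ge0 (v.1.1 - u.1.1)) (sqr_ge0 (v.1.2 - u.1.2)); rewrite !expr2; lra.
rewrite [leRHS](_ : _ = (`|v.1.1 - u.1.1| `^ a * `|v.1.2 - u.1.2| `^ a * `|v.2 - u.2| `^ a)
  * (expR (- u.1.1 ^+ 2 / 4) * expR (- u.1.2 ^+ 2 / 4) * expR (- u.2 ^+ 2 / 4))); last by ring.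
apply: ler_pM; rewrite ?mulr_ge0 ?powR_ge0 ?expR_ge0//.
by apply: ler_pM; rewrite ?mulr_ge0 ?powR_ge0//; apply: ler_pM; rewrite ?powR_ge0.
Qed.

(** * Measurability in R^3 and the uniform bound on the singular integral *)

Lemma measurable_dot d (T : measurableType d) (R : realType) (f g : T -> R3 R) :
  measurable_fun setT f -> measurable_fun setT g ->
  measurable_fun setT (fun z => dot (f z) (g z)).
Proof.
move=> mf mg.
have m1 (h : T -> R3 R) : measurable_fun setT h -> measurable_fun setT (fun z => (h z).1.1).
  by move=> mh; do 2 (apply: (measurableT_comp measurable_fst)).
have m2 (h : T -> R3 R) : measurable_fun setT h -> measurable_fun setT (fun z => (h z).1.2).
  by move=> mh; apply: (measurableT_comp measurable_snd); apply: (measurableT_comp measurable_fst).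
have m3 (h : T -> R3 R) : measurable_fun setT h -> measurable_fun setT (fun z => (h z).2).
  by move=> mh; apply: (measurableT_comp measurable_snd).
rewrite /dot; apply: measurable_funD; first apply: measurable_funD.
- by apply: measurable_funM; exact: m1.
- by apply: measurable_funM; exact: m2.
- by apply: measurable_funM; exact: m3.
Qed.

Lemma measurable_R3 d (T : measurableType d) (R : realType) (f1 f2 f3 : T -> R) :
  measurable_fun setT f1 -> measurable_fun setT f2 -> measurable_fun setT f3 ->
  measurable_fun setT (fun z => (f1 z, f2 z, f3 z) : R3 R).
Proof.
by move=> m1 m2 m3; apply: measurable_fun_pair => //; exact: measurable_fun_pair.
Qed.

Lemma measurable_R3_coord d (T : measurableType d) (R : realType) (f : T -> R3 R) :
  measurable_fun setT f ->
  [/\ measurable_fun setT (fun z => (f z).1.1 : R), measurable_fun setT (fun z => (f z).1.2 : R) &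
      measurable_fun setT (fun z => (f z).2 : R)].
Proof.
move=> mf; split.
- by do 2 (apply: (measurableT_comp measurable_fst)).
- by apply: (measurableT_comp measurable_snd); apply: (measurableT_comp measurable_fst).
- by apply: (measurableT_comp measurable_snd).
Qed.

Lemma measurable_R3D d (T : measurableType d) (R : realType) (f g : T -> R3 R) :
  measurable_fun setT f -> measurable_fun setT g ->
  measurable_fun setT (fun z => f z + g z : R3 R).
Proof.
move=> /measurable_R3_coord[f1 f2 f3] /measurable_R3_coord[g1 g2 g3].
by apply: (measurable_R3 (f1 := fun z => (f z).1.1 + (g z).1.1)
  (f2 := fun z => (f z).1.2 + (g z).1.2) (f3 := fun z => (f z).2 + (g z).2));
  exact: measurable_funD.
Qed.

Lemma measurable_R3Z d (T : measurableType d) (R : realType) (k : T -> R) (f : T -> R3 R) :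
  measurable_fun setT k -> measurable_fun setT f ->
  measurable_fun setT (fun z => k z *: f z : R3 R).
Proof.
move=> mk /measurable_R3_coord[f1 f2 f3].
by apply: (measurable_R3 (f1 := fun z => k z * (f z).1.1)
  (f2 := fun z => k z * (f z).1.2) (f3 := fun z => k z * (f z).2));
  exact: measurable_funM.
Qed.

Lemma measurable_R3B d (T : measurableType d) (R : realType) (f g : T -> R3 R) :
  measurable_fun setT f -> measurable_fun setT g ->
  measurable_fun setT (fun z => f z - g z : R3 R).
Proof.
move=> /measurable_R3_coord[f1 f2 f3] /measurable_R3_coord[g1 g2 g3].
by apply: (measurable_R3 (f1 := fun z => (f z).1.1 - (g z).1.1)
  (f2 := fun z => (f z).1.2 - (g z).1.2) (f3 := fun z => (f z).2 - (g z).2));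
  exact: measurable_funB.
Qed.

Lemma measurable_enorm d (T : measurableType d) (R : realType) (f : T -> R3 R) :
  measurable_fun setT f -> measurable_fun setT (fun z => enorm (f z)).
Proof.
move=> mf; apply: (measurableT_comp (f := @Num.sqrt R)); last exact: measurable_dot.
exact: continuous_measurable_fun (@sqrt_continuous R).
Qed.

Lemma measurable_gauss d (T : measurableType d) (R : realType) (f : T -> R3 R) :
  measurable_fun setT f -> measurable_fun setT (fun z => gauss (f z)).
Proof.
move=> mf; apply: (measurableT_comp (f := @expR R)) => //.
apply: (measurable_funM (f := fun z => - dot (f z) (f z))) => //.
by apply: (measurable_funN (f := fun z => dot (f z) (f z))); exact: measurable_dot.
Qed.

Lemma integral_enorm_powR_gauss_bounded (R : realType) (gamma : R) : -3 < gamma < 0 ->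
  exists J : R, forall v : R3 R,
    (\int[@leb3 R]_u (enorm (v - u) `^ gamma * gauss u)%:E <= J%:E)%E.
Proof.
move=> /andP[g3 g0]; have [|J JP] := @integral_sing1_bounded R (gamma / 3).
  by apply/andP; split; lra.
have J0 : 0 <= J.
  rewrite -lee_fin; apply: le_trans (JP 0).
  by apply: integral_ge0 => u _; exact: sing1_ge0.
pose s := sing1 (gamma / 3); have ms v : measurable_fun (setT : set (measurableTypeR R)) (s v) by exact: measurable_sing1.
have s0 v u : (0 <= s v u)%E by exact: sing1_ge0.
pose s2 (v : R3 R) (x : R2 R) := (s v.1.1 x.1 * s v.1.2 x.2)%E.
have ms2 v : measurable_fun setT (s2 v).
  by apply: emeasurable_funM; apply: (measurableT_comp (ms _)).
have s20 v x : (0 <= s2 v x)%E by rewrite mule_ge0.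
exists (J * J * J) => v.
apply: (@le_trans _ _ (\int[@leb3 R]_u (s2 v u.1 * s v.2 u.2))%E).
  apply: ge0_le_integral => //.
  - by move=> u _; rewrite lee_fin mulr_ge0 ?powR_ge0// ltW// gauss_gt0.
  - apply/measurable_EFinP; apply: measurable_funM; last exact: measurable_gauss.
    apply: (measurableT_comp (measurable_powR _)); apply: measurable_enorm.
    by apply: measurable_R3B => //; exact: measurable_cst.
  - apply: emeasurable_funM; first exact: (measurableT_comp (ms2 _)).
    exact: (measurableT_comp (ms _)).
  - by move=> u _; exact: enorm_powR_gauss_le.
rewrite integral_prod_mul// integral_prod_mul// !EFinM.
by apply: lee_pmul; rewrite ?mule_ge0 ?integral_ge0//; apply: lee_pmul;
  rewrite ?integral_ge0.
Qed.

(** This covers parameters at which the integral diverges: the integral is [fine] of a difference of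
    two extended integrals, each measurable in the parameter by Tonelli, and [fine] is measurable.
    Restriction to D is turned into extension by 0. *)
Lemma measurable_Rintegral_param d1 d2 (S : measurableType d1) (T : measurableType d2)
    (R : realType) (m : {sigma_finite_measure set T -> \bar R}) (D : set T)
    (h : S * T -> R) :
  measurable D -> measurable_fun setT h ->
  measurable_fun setT (fun y => \int[m]_(z in D) h (y, z)).
Proof.
move=> mD mh; pose k := (EFin \o h) \_ (setT `*` D).
have mk : measurable_fun setT k.
  apply: (measurable_restrictT (EFin \o h) _).1; first exact: measurableX.
  by apply: measurable_funTS; apply/measurable_EFinP.
have -> : (fun y => \int[m]_(z in D) h (y, z)) =
    fine \o (fun y => \int[m]_z k^\+ (y, z) - \int[m]_z k^\- (y, z))%E.
  apply/funext => y /=; rewrite /Rintegral integral_mkcond integralE; congr (fine (_ - _)%E).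
    apply: eq_integral => z _; rewrite !funeposE; congr maxe.
    by rewrite /k !patchE in_setX in_setT.
  apply: eq_integral => z _; rewrite !funenegE; congr (maxe (- _)%E _).
  by rewrite /k !patchE in_setX in_setT.
apply: measurableT_comp; first exact: fine_measurable.
by apply: emeasurable_funB; apply: measurable_fun_fubini_tonelli_F => //;
  [exact: measurable_funepos|exact: measurable_funeneg].
Qed.

(** Clamping the argument to [-1, 1] extends [acos] to a nonincreasing function on the whole
    line. *)
Lemma measurable_acos (R : realType) : measurable_fun `[(-1 : R), 1] (@acos R).
Proof.
pose c (x : R) := Num.max (-1) (Num.min x 1).
have cI x : -1 <= c x <= 1.
  by rewrite /c le_max lexx/= ge_max ge_min lexx orbT andbT; lra.
apply: (@eq_measurable_fun _ _ _ _ _ (@acos R \o c)).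
  by move=> x; rewrite inE/= in_itv/= => /andP[x0 x1]; rewrite /c min_l// max_r.
apply: nonincreasing_measurable => // x y xy /=.
have cxy : c x <= c y by rewrite /c ge_max !le_max lexx/= le_min !ge_min xy lexx !orbT.
rewrite leNgt; apply/negP => axy.
have : cos (acos (c y)) < cos (acos (c x)).
  by rewrite ltr_cos ?in_itv/= ?acos_ge0 ?acos_lepi ?cI.
by rewrite !acosK ?in_itv/= ?cI// ltNge cxy.
Qed.

(** Writing 1/f as f times the power -1 of f^2 reduces inversion to the measurable real power, and
    respects the default value 0 at the zeros of f. *)
Lemma measurable_funV d (T : measurableType d) (R : realType) (f : T -> R) :
  measurable_fun setT f -> measurable_fun setT (fun t => (f t)^-1).
Proof.
move=> mf; have -> : (fun t => (f t)^-1) = (fun t => f t * (f t ^+ 2) `^ (-1)).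
  apply/funext => t; rewrite powR_inv1 ?sqr_ge0// expr2.
  have [->|f0] := eqVneq (f t) 0; first by rewrite invr0 mul0r.
  by rewrite invfM mulrA divff// mul1r.
apply: measurable_funM => //; apply: (measurableT_comp (f := (@powR R) ^~ (-1))).
  exact: measurable_powR.
exact: measurable_funX.
Qed.

(** Lagrange's identity: the defect is the squared length of the cross product. *)
Lemma dot_CauchySchwarz (R : realType) (v w : R3 R) : dot v w ^+ 2 <= dot v v * dot w w.
Proof.
rewrite -subr_ge0 /dot [X in 0 <= X](_ : _ =
  (v.1.1 * w.1.2 - v.1.2 * w.1.1) ^+ 2 + (v.1.1 * w.2 - v.2 * w.1.1) ^+ 2
  + (v.1.2 * w.2 - v.2 * w.1.2) ^+ 2); last by ring.
by rewrite !addr_ge0 ?sqr_ge0.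
Qed.

Lemma dot_div_enorm (R : realType) (v w : R3 R) : dot w w = 1 ->
  -1 <= dot v w / enorm v <= 1.
Proof.
move=> w1; rewrite -ler_norml normrM normfV (ger0_norm (enorm_ge0 v)).
have [->|v0] := eqVneq (enorm v) 0; first by rewrite invr0 mulr0.
rewrite ler_pdivrMr ?lt_def ?v0 ?enorm_ge0// mul1r.
rewrite -[leLHS]sqrtr_sqr ler_sqrt ?dot_ge0//.
by have := dot_CauchySchwarz v w; rewrite w1 mulr1.
Qed.

Lemma dot_sphere_point (R : realType) (p : R2 R) : dot (sphere_point p) (sphere_point p) = 1.
Proof.
rewrite /dot /sphere_point/=.
rewrite (_ : _ + _ = (sin p.1) ^+ 2 * ((cos p.2) ^+ 2 + (sin p.2) ^+ 2) + (cos p.1) ^+ 2); last by ring.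
by rewrite cos2Dsin2 mulr1 addrC cos2Dsin2.
Qed.

(** * The collision integral as a bounded monotone linear functional *)

Definition leb5 {R : realType} : set (R3 R * R2 R) -> \bar R := (@leb3 R \x @leb2 R)%E.

HB.instance Definition _ (R : realType) := Measure.on (@leb5 R).
HB.instance Definition _ (R : realType) :=
  Measure_isSigmaFinite.Build _ _ _ (@leb5 R) (sigma_finite_prod (@leb3 R) (@leb2 R)).

Definition angles {R : realType} : set (R2 R) := `[0, pi] `*` `[0, 2 * pi].

Lemma measurable_angles (R : realType) : measurable (@angles R).
Proof. by apply: measurableX. Qed.

Lemma leb2_angles (R : realType) : (@leb2 R angles < +oo)%E.
Proof.
have -> : (@leb2 R angles = @lebesgue_measure R `[0%R, pi] * @lebesgue_measure R `[0%R, (2 * pi)%R])%E.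
  exact: product_measure1E.
rewrite !lebesgue_measure_itv/=.
by do 2 case: ifP => _; rewrite ?mule0 ?mul0e//= ?ltry.
Qed.

Lemma measurable_sphere_point d (T : measurableType d) (R : realType) (f : T -> R2 R) :
  measurable_fun setT f -> measurable_fun setT (fun t => sphere_point (f t)).
Proof.
move=> mf.
have m1 : measurable_fun setT (fun t => (f t).1 : R) by apply: (measurableT_comp measurable_fst).
have m2 : measurable_fun setT (fun t => (f t).2 : R) by apply: (measurableT_comp measurable_snd).
have ms (h : T -> R) : measurable_fun setT h -> measurable_fun setT (fun t => sin (h t)).
  by move=> mh; apply: (measurableT_comp (continuous_measurable_fun (@continuous_sin R))).
have mc (h : T -> R) : measurable_fun setT h -> measurable_fun setT (fun t => cos (h t)).
  by move=> mh; apply: (measurableT_comp (continuous_measurable_fun (@continuous_cos R))).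
by apply: measurable_R3; [apply: measurable_funM; [exact: ms|exact: mc]|
  apply: measurable_funM; exact: ms|exact: mc].
Qed.

Section collision.
Context {R : realType} (gamma : R) (b : R -> R).
Context (gammaP : -3 < gamma < 0) (bP : angular_kernel b).

Lemma measurable_kernelB d (T : measurableType d) (V U O : T -> R3 R) :
  measurable_fun setT V -> measurable_fun setT U -> measurable_fun setT O ->
  (forall t, dot (O t) (O t) = 1) ->
  measurable_fun setT (fun t => kernelB gamma b (V t) (U t) (O t)).
Proof.
move=> mV mU mO O1; have mVU := measurable_R3B mV mU.
apply: measurable_funM.
  apply: (measurableT_comp (f := (@powR R) ^~ gamma)); first exact: measurable_powR.
  exact: measurable_enorm.
apply: (measurable_comp (F := `[0, pi]%classic)) => //.
- move=> _ [t _ <-] /=; have h := dot_div_enorm (V t - U t) (O1 t).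
  by rewrite in_itv/= acos_ge0 ?acos_lepi.
- by case: bP.
apply: (measurable_comp (F := `[(-1 : R), 1]%classic) (f := @acos R)
  (g := fun t => dot (V t - U t) (O t) / enorm (V t - U t))) => //.
- by move=> _ [t _ <-] /=; rewrite in_itv/=; exact: dot_div_enorm.
- exact: measurable_acos.
apply: measurable_funM; first exact: measurable_dot.
by apply: measurable_funV; exact: measurable_enorm.
Qed.

(** This is [collision_integral] with a density depending on the integration variable z = (u,
    angles) rather than on (u, u', v'), so that linearity and domination concern a single
    function. *)
Definition cint (v : R3 R) (G : R3 R * R2 R -> R) : R :=
  \int[leb5]_(z in setT `*` angles)
    (kernelB gamma b v z.1 (sphere_point z.2) * G z * sin z.2.1).

Let D : set (R3 R * R2 R) := setT `*` angles.

Let mD : measurable D.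
Proof. by apply: measurableX => //; exact: measurable_angles. Qed.

Let weak (v : R3 R) (z : R3 R * R2 R) : R := enorm (v - z.1) `^ gamma * gauss z.1.

Let weak_ge0 v z : 0 <= weak v z.
Proof. by rewrite mulr_ge0 ?powR_ge0// ltW// gauss_gt0. Qed.

Let measurable_weak v : measurable_fun setT (weak v).
Proof.
apply: measurable_funM; last exact: measurable_gauss.
apply: (measurableT_comp (measurable_powR gamma)); apply: measurable_enorm.
by apply: measurable_R3B => //; exact: measurable_cst.
Qed.

Let integral_weak : exists J : R, forall v,
  (\int[leb5]_(z in D) (weak v z)%:E <= J%:E)%E.
Proof.
have [J JP] := integral_enorm_powR_gauss_bounded gammaP.
exists (J * fine (leb2 (@angles R))) => v.
have m0 : measurable_fun setT (fun u : R3 R => (enorm (v - u) `^ gamma * gauss u)%:E).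
  apply/measurable_EFinP; apply: measurable_funM; last exact: measurable_gauss.
  apply: (measurableT_comp (measurable_powR gamma)); apply: measurable_enorm.
  by apply: measurable_R3B => //; exact: measurable_cst.
have mi : measurable_fun setT (fun p : R2 R => (\1_(@angles R) p)%:E : \bar R).
  by apply/measurable_EFinP; apply: measurable_indic; exact: measurable_angles.
have f0 (u : R3 R) : (0 <= (enorm (v - u) `^ gamma * gauss u)%:E)%E.
  by rewrite lee_fin mulr_ge0 ?powR_ge0// ltW// gauss_gt0.
have i0 (p : R2 R) : (0 <= (\1_(@angles R) p)%:E :> \bar R)%E by rewrite lee_fin.
have -> : (\int[leb5]_(z in D) (weak v z)%:E =
    \int[@leb3 R]_u (enorm (v - u) `^ gamma * gauss u)%:E *
    \int[@leb2 R]_p (\1_(@angles R) p)%:E)%E.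
  rewrite integral_mkcond; refine (etrans _ (integral_prod_mul _ _ m0 mi f0 i0)).
  apply: eq_integral => z _.
  by rewrite patchE /D in_setX in_setT/= indicE; case: (_ \in _); rewrite ?mule1 ?mule0.
rewrite integral_indic//; last exact: measurable_angles.
rewrite setIT EFinM fineK; last by rewrite ge0_fin_numE ?leb2_angles.
by apply: lee_wpmul2r => //; exact: JP.
Qed.

(** The sign matters as much as the bound: it makes [cint] monotone in its density. *)
Let kern_bound : exists2 C : R, 0 <= C & forall v z, D z ->
  0 <= kernelB gamma b v z.1 (sphere_point z.2) * sin z.2.1
    <= C * enorm (v - z.1) `^ gamma.
Proof.
have [_ [C CP]] := bP; exists `|C| => // v [u p] [_ /= [p1 p2]].
have s0 : 0 <= sin p.1.
  by move: p1 => /=; rewrite in_itv/= => /andP[? ?]; apply: sin_ge0_pi; rewrite ?in_itv/=; apply/andP.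
have h := dot_div_enorm (v - u) (dot_sphere_point p).
have /CP/andP[b0 b1] : 0 <= acos (dot (v - u) (sphere_point p) / enorm (v - u)) <= pi.
  by rewrite acos_ge0 ?acos_lepi.
rewrite /kernelB !mulr_ge0 ?powR_ge0//= mulrAC [leRHS]mulrC -mulrA ler_wpM2l ?powR_ge0//.
have c1 (x : R) : `|cos x| <= 1 by rewrite ler_norml cos_geN1 cos_le1.
have bC : b (acos (dot (v - u) (sphere_point p) / enorm (v - u))) <= `|C|.
  by apply: (le_trans b1); apply: (le_trans (ler_wpM2r _ (ler_norm C))) => //; rewrite ler_piMr.
by rewrite -[leRHS]mul1r ler_pM// sin_le1.
Qed.

(** Decay is required in the velocity u alone. It tames |v - u|^gamma, and conservation of energy
    provides it for products of functions of u' and v'. *)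
Definition dominated (P : R) (G : R3 R * R2 R -> R) : Prop :=
  measurable_fun setT G /\ forall z, `|G z| <= P * gauss z.1.

Let integrand v (G : R3 R * R2 R -> R) z :=
  kernelB gamma b v z.1 (sphere_point z.2) * G z * sin z.2.1.

Let integrandE v G z : integrand v G z =
  kernelB gamma b v z.1 (sphere_point z.2) * sin z.2.1 * G z.
Proof. by rewrite /integrand mulrAC. Qed.

Lemma measurable_cint_integrand d (S : measurableType d) (V : S -> R3 R)
    (G : S -> R3 R * R2 R -> R) :
  measurable_fun setT V -> measurable_fun setT (fun y : S * (R3 R * R2 R) => G y.1 y.2) ->
  measurable_fun setT (fun y : S * (R3 R * R2 R) => integrand (V y.1) (G y.1) y.2).
Proof.
move=> mV mG; apply: measurable_funM; last first.
  apply: (measurableT_comp (continuous_measurable_fun (@continuous_sin R))).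
  apply: (measurableT_comp measurable_fst); apply: (measurableT_comp measurable_snd).
  exact: measurable_snd.
apply: measurable_funM => //; apply: measurable_kernelB.
- exact: (measurableT_comp mV).
- by apply: (measurableT_comp measurable_fst); exact: measurable_snd.
- apply: measurable_sphere_point; apply: (measurableT_comp measurable_snd).
  exact: measurable_snd.
- by move=> t; exact: dot_sphere_point.
Qed.

Lemma measurable_cint d (S : measurableType d) (V : S -> R3 R)
    (G : S -> R3 R * R2 R -> R) :
  measurable_fun setT V -> measurable_fun setT (fun y : S * (R3 R * R2 R) => G y.1 y.2) ->
  measurable_fun setT (fun y => cint (V y) (G y)).
Proof.
by move=> mV mG; exact: measurable_Rintegral_param mD (measurable_cint_integrand mV mG).
Qed.

Let measurable_integrand v G : measurable_fun setT G -> measurable_fun setT (integrand v G).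
Proof.
move=> mG; have h := @measurable_cint_integrand _ (R3 R) (cst v) (cst G) (measurable_cst _)
  (measurableT_comp mG measurable_snd).
exact: (measurableT_comp h (pair1_measurable v)).
Qed.

Let integrable_weak v : leb5.-integrable D (EFin \o weak v).
Proof.
apply/integrableP; split; first by apply/measurable_EFinP; exact: measurable_funTS.
have [J JP] := integral_weak; apply: le_lt_trans (ltry J); apply: le_trans (JP v).
by rewrite le_eqVlt; apply/orP; left; apply/eqP; apply: eq_integral => z _ /=;
  rewrite ger0_norm.
Qed.

Lemma cint_integrable v P G : dominated P G -> leb5.-integrable D (EFin \o integrand v G).
Proof.
move=> [mG GP]; have [C C0 CP] := kern_bound.
apply: (le_integrable mD (g := fun z => ((C * `|P|)%:E * (weak v z)%:E)%E)).
- by apply/measurable_EFinP; apply: measurable_funTS; exact: measurable_integrand.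
- move=> z Dz; have /andP[k0 k1] := CP v z Dz.
  rewrite -EFinM; suff : `|integrand v G z| <= `|C * `|P| * weak v z| by rewrite -lee_fin.
  rewrite integrandE (normrM _ (G z)) (ger0_norm k0).
  apply: (le_trans (ler_pM k0 (normr_ge0 _) k1 (GP z))).
  apply: le_trans (ler_norm _); rewrite /weak.
  rewrite [leRHS](_ : _ = (C * enorm (v - z.1) `^ gamma) * (`|P| * gauss z.1)); last by ring.
  by rewrite ler_wpM2l ?mulr_ge0 ?powR_ge0// ler_wpM2r ?ler_norm// ltW// gauss_gt0.
- by apply: integrableZl => //; exact: integrable_weak.
Qed.

(** J depends on gamma and b only. Being uniform in v, it lets a weight in v carried by P pass
    through the integral. *)
Lemma cint_bound : exists2 J : R, 0 <= J & forall v P G, dominated P G ->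
  `|cint v G| <= J * P.
Proof.
have [C C0 CP] := kern_bound; have [J JP] := integral_weak.
have J0 : 0 <= J.
  by rewrite -lee_fin; apply: le_trans (JP 0); apply: integral_ge0 => z _; rewrite lee_fin.
exists (C * J); first exact: mulr_ge0.
move=> v P G dG; have [mG GP] := dG.
have P0 : 0 <= P.
  have := le_trans (normr_ge0 _) (GP 0); rewrite pmulr_lge0//; exact: gauss_gt0.
have iW := integrable_weak v.
apply: (le_trans (le_normr_Rintegral mD (cint_integrable v dG))).
apply: (@le_trans _ _ (\int[leb5]_(z in D) (C * P * weak v z))).
  apply: le_Rintegral => //.
  - exact: integrable_norm (cint_integrable v dG).
  - exact: (integrableZl mD (C * P) iW).
  - move=> z Dz; have /andP[k0 k1] := CP v z Dz.
    rewrite integrandE normrM (ger0_norm k0).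
    apply: (le_trans (ler_pM k0 (normr_ge0 _) k1 (GP z))).
    by rewrite /weak le_eqVlt; apply/orP; left; apply/eqP; ring.
rewrite RintegralZl// mulrAC ler_wpM2r// ler_wpM2l//.
rewrite -lee_fin /Rintegral fineK//; exact: integrable_fin_num.
Qed.

Lemma cintD v P Q F G : dominated P F -> dominated Q G ->
  cint v (fun z => F z + G z) = cint v F + cint v G.
Proof.
move=> dF dG; rewrite /cint -RintegralD//; last 2 first.
- exact: cint_integrable dF.
- exact: cint_integrable dG.
by congr Rintegral; apply/funext => z; ring.
Qed.

Lemma cintZ v P k G : dominated P G -> cint v (fun z => k * G z) = k * cint v G.
Proof.
move=> dG; rewrite /cint -RintegralZl//; last exact: cint_integrable dG.
by congr Rintegral; apply/funext => z; ring.
Qed.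

Lemma cintB v P Q F G : dominated P F -> dominated Q G ->
  cint v (fun z => F z - G z) = cint v F - cint v G.
Proof.
move=> dF dG; rewrite /cint -RintegralB//; last 2 first.
- exact: cint_integrable dF.
- exact: cint_integrable dG.
by congr Rintegral; apply/funext => z; ring.
Qed.

Lemma le_cint v P Q F G : dominated P F -> dominated Q G ->
  (forall z, F z <= G z) -> cint v F <= cint v G.
Proof.
move=> dF dG FG; apply: le_Rintegral => //.
- exact: cint_integrable dF.
- exact: cint_integrable dG.
move=> z Dz; have [C C0 CP] := kern_bound; have /andP[k0 _] := CP v z Dz.
by move: (ler_wpM2l k0 (FG z)); rewrite -!integrandE.
Qed.
End collision.


(** * Pointwise estimates of the collision density *)

Lemma ler_normM2 (R : realFieldType) (x y X Y : R) : `|x| <= X -> `|y| <= Y -> `|x * y| <= X * Y.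
Proof. by move=> hx hy; rewrite normrM ler_pM. Qed.

Lemma ler_norm_add (R : realFieldType) (x y X Y : R) : `|x| <= X -> `|y| <= Y -> `|x + y| <= X + Y.
Proof. by move=> hx hy; apply: (le_trans (ler_normD _ _)); exact: lerD. Qed.

Lemma ler_norm_sub (R : realFieldType) (x y X Y : R) : `|x| <= X -> `|y| <= Y -> `|x - y| <= X + Y.
Proof. by move=> hx hy; apply: ler_norm_add; rewrite ?normrN. Qed.

Lemma weighted_mul (R : realFieldType) (w w1 w2 x y X Y : R) :
  0 <= w1 -> 0 <= w2 -> w <= w1 * w2 -> w1 * `|x| <= X -> w2 * `|y| <= Y ->
  w * `|x * y| <= X * Y.
Proof.
move=> w10 w20 ww hx hy; apply: (le_trans (ler_wpM2r (normr_ge0 _) ww)).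
by rewrite normrM mulrACA; apply: ler_pM => //; apply: mulr_ge0.
Qed.

Lemma weighted_mulB (R : realFieldType) (w w1 w2 k1 k2 l1 l2 H e : R) :
  0 <= w -> 0 <= w1 -> 0 <= w2 -> w <= w1 * w2 ->
  w1 * `|l1| <= H -> w2 * `|k2| <= H ->
  w1 * `|k1 - l1| <= e -> w2 * `|k2 - l2| <= e ->
  w * `|k1 * k2 - l1 * l2| <= 2 * H * e.
Proof.
move=> w0 w10 w20 ww hl hk e1 e2.
have -> : k1 * k2 - l1 * l2 = (k1 - l1) * k2 + l1 * (k2 - l2) by ring.
apply: (le_trans (ler_wpM2l w0 (ler_normD _ _))); rewrite mulrDr.
have h1 := weighted_mul w10 w20 ww e1 hk.
have h2 := weighted_mul w10 w20 ww hl e2.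
by apply: (le_trans (lerD h1 h2)); rewrite le_eqVlt; apply/orP; left; apply/eqP; ring.
Qed.

(** The integrand of C_delta with a, b, c, d the values of F at v, u, v', u'. The terms delta^2 a b
    c d of gain and loss cancel, which leaves a cubic polynomial; [collision_densityE] restores the
    factored form. *)
Definition collision_density {R : realType} (delta a b c d : R) : R :=
  c * d * (1 - delta * a - delta * b) - a * b * (1 - delta * c - delta * d).

Lemma norm_weight1 (R : realFieldType) (w x X : R) : 1 <= w -> w * `|x| <= X -> `|x| <= X.
Proof. by move=> w1; apply: le_trans; rewrite ler_peMl. Qed.

(** Gain and loss have the same shape, so one estimate serves both. The weight is shared between the
    two quadratic factors, and the statistical bracket needs plain bounds only. The constant is 8 =
    2 * 3 + 2: the variation of the product times the bound 3 H of the bracket, plus the variation 2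
    e of the bracket. *)
Lemma half_density_lip (R : realFieldType) (delta w w1 w2 k1 k2 l1 l2 H e F3 F4 G3 G4 : R) :
  0 <= delta <= 1 -> 0 <= w -> 0 <= w1 -> 0 <= w2 -> w <= w1 * w2 -> 1 <= H -> 0 <= e ->
  w1 * `|l1| <= H -> w2 * `|k2| <= H -> w2 * `|l2| <= H ->
  w1 * `|k1 - l1| <= e -> w2 * `|k2 - l2| <= e ->
  `|F3| <= H -> `|F4| <= H -> `|F3 - G3| <= e -> `|F4 - G4| <= e ->
  w * `|k1 * k2 * (1 - delta * F3 - delta * F4)
      - l1 * l2 * (1 - delta * G3 - delta * G4)| <= 8 * H ^+ 2 * e.
Proof.
move=> /andP[d0 d1] w0 w10 w20 ww H1 e0 hl1 hk2 hl2 e1 e2 hF3 hF4 e3 e4.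
have nd (x X : R) : `|x| <= X -> `|delta * x| <= X.
  by move=> hx; rewrite normrM ger0_norm//; apply: le_trans hx; rewrite ler_piMl.
have Z : `|1 - delta * F3 - delta * F4| <= 3 * H.
  have h : `|1 - delta * F3 - delta * F4| <= 1 + H + H.
    by apply: ler_norm_sub; [apply: ler_norm_sub; [rewrite normr1|exact: nd]|exact: nd].
  by apply: (le_trans h); lra.
have ZB : `|(1 - delta * F3 - delta * F4) - (1 - delta * G3 - delta * G4)| <= 2 * e.
  have -> : (1 - delta * F3 - delta * F4) - (1 - delta * G3 - delta * G4) =
    - (delta * (F3 - G3)) - delta * (F4 - G4) by ring.
  rewrite [2 * e](_ : _ = e + e); last by ring.
  by apply: ler_norm_sub; rewrite ?normrN; apply: nd.
set X := 1 - _ - _ in Z ZB *; set Y := 1 - _ - _ in ZB *.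
have -> : k1 * k2 * X - l1 * l2 * Y = (k1 * k2 - l1 * l2) * X + l1 * l2 * (X - Y) by ring.
apply: (le_trans (ler_wpM2l w0 (ler_normD _ _))); rewrite mulrDr !(normrM _ X) (normrM _ (X - Y)) !mulrA.
have h1 := weighted_mulB w0 w10 w20 ww hl1 hk2 e1 e2.
have h2 := weighted_mul w10 w20 ww hl1 hl2.
have h3 : w * `|k1 * k2 - l1 * l2| * `|X| <= 2 * H * e * (3 * H).
  by apply: ler_pM => //; rewrite mulr_ge0.
have h4 : w * `|l1 * l2| * `|X - Y| <= H * H * (2 * e).
  by apply: ler_pM => //; rewrite mulr_ge0.
by apply: (le_trans (lerD h3 h4)); rewrite le_eqVlt; apply/orP; left; apply/eqP; ring.
Qed.

Section local_bounds.
Context {R : realType}.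

(* The four points v, u, v', u' carry the indices a, b, c, d; [g] is the
   Gaussian factor, [w] the weight. *)
Lemma collision_density_lip (delta H e : R) (ga gb gc gd wa wb wc wd : R)
    (ka kb kc kd la lb lc ld : R) :
  0 <= delta <= 1 -> 1 <= H -> 0 <= e ->
  ga * gb = gc * gd ->
  0 <= ga <= 1 -> 0 <= gb <= 1 -> 0 <= gc <= 1 -> 0 <= gd <= 1 ->
  1 <= wa -> 1 <= wb -> 1 <= wc -> 1 <= wd -> wa <= wc * wd ->
  wa * `|ka| <= H -> wb * `|kb| <= H -> wc * `|kc| <= H -> wd * `|kd| <= H ->
  wa * `|la| <= H -> wb * `|lb| <= H -> wc * `|lc| <= H -> wd * `|ld| <= H ->
  wa * `|ka - la| <= e -> wb * `|kb - lb| <= e -> wc * `|kc - lc| <= e -> wd * `|kd - ld| <= e ->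
  wa * `|collision_density delta (ga * ka) (gb * kb) (gc * kc) (gd * kd)
         - collision_density delta (ga * la) (gb * lb) (gc * lc) (gd * ld)|
    <= 16 * (ga * gb) * H ^+ 2 * e.
Proof.
move=> dP H1 e0 gE gaP gbP gcP gdP wa1 wb1 wc1 wd1 ww ha hb hc hd ia ib ic id ea eb ec ed.
have ng (g w x X : R) : 0 <= g <= 1 -> 1 <= w -> w * `|x| <= X -> `|g * x| <= X.
  move=> /andP[g0 g1] w1 /(norm_weight1 w1) hx; rewrite normrM ger0_norm//.
  by apply: le_trans hx; rewrite ler_piMl.
have ngB (g w x y X : R) : 0 <= g <= 1 -> 1 <= w -> w * `|x - y| <= X -> `|g * x - g * y| <= X.
  by move=> g1 w1 h; rewrite -mulrBr; exact: ng h.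
have wab : wa <= wa * wb by rewrite ler_peMr// (le_trans ler01).
have p0 (w : R) : 1 <= w -> 0 <= w by exact: le_trans.
have gain := half_density_lip dP (p0 _ wa1) (p0 _ wc1) (p0 _ wd1) ww H1 e0 ic hd id ec ed
  (ng _ _ _ _ gaP wa1 ha) (ng _ _ _ _ gbP wb1 hb)
  (ngB _ _ _ _ _ gaP wa1 ea) (ngB _ _ _ _ _ gbP wb1 eb).
have loss := half_density_lip dP (p0 _ wa1) (p0 _ wa1) (p0 _ wb1) wab H1 e0 ia hb ib ea eb
  (ng _ _ _ _ gcP wc1 hc) (ng _ _ _ _ gdP wd1 hd)
  (ngB _ _ _ _ _ gcP wc1 ec) (ngB _ _ _ _ _ gdP wd1 ed).
move: gain loss; set X := (X in wa * `|X| <= _); set Y := (Y in _ -> wa * `|Y| <= _ -> _).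
move=> gain loss.
(* Conservation of energy, [gE], gives the gain the same Gaussian factor ga gb as the loss. *)
have -> : collision_density delta (ga * ka) (gb * kb) (gc * kc) (gd * kd)
         - collision_density delta (ga * la) (gb * lb) (gc * lc) (gd * ld) =
    (ga * gb) * (X - Y).
  have -> : ga * gb * (X - Y) = gc * gd * X - ga * gb * Y by rewrite -gE; ring.
  by rewrite /collision_density /X /Y; ring.
have gg0 : 0 <= ga * gb by move: gaP gbP => /andP[? _] /andP[? _]; exact: mulr_ge0.
rewrite normrM (ger0_norm gg0) mulrCA.
rewrite [leRHS](_ : _ = (ga * gb) * (8 * H ^+ 2 * e + 8 * H ^+ 2 * e)); last by ring.
apply: ler_wpM2l => //; apply: (le_trans (ler_wpM2l (p0 _ wa1) (ler_normB _ _))).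
by rewrite mulrDr; exact: lerD.
Qed.

(** Three of the four terms contain [my]; in the last one gp gr <= gy takes its place. In the
    applications gy, gp, gr are squares of Gaussian factors, as mu = O(g^2). *)
Lemma bracket_bound (delta q gy gp gr my mp mr : R) : 0 <= delta <= 1 -> 1 <= q ->
  0 <= my <= gy * q -> 0 <= mp <= gp * q -> 0 <= mr <= gr * q ->
  gp * gr <= gy -> 0 <= gp <= 1 -> 0 <= gr <= 1 -> 0 <= gy ->
  `|my - delta * my * mp - delta * my * mr + delta * mp * mr| <= 4 * q ^+ 2 * gy.
Proof.
move=> /andP[d0 d1] q1 /andP[y0 y1] /andP[p0 p1] /andP[r0 r1] pr /andP[gp0 gp1] /andP[gr0 gr1] gy0.
have q0 : 0 <= q by exact: le_trans q1.
have mq (g m : R) : 0 <= g <= 1 -> m <= g * q -> m <= q.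
  by move=> /andP[? ?] h; apply: (le_trans h); rewrite ler_piMl.
have mpq : mp <= q by apply: mq p1; rewrite gp0.
have mrq : mr <= q by apply: mq r1; rewrite gr0.
have h1 : `|my| <= q ^+ 2 * gy.
  rewrite ger0_norm//; apply: (le_trans y1); rewrite mulrC ler_wpM2r//.
  by rewrite expr2 ler_peMl.
have h2 (m : R) : 0 <= m <= q -> `|delta * my * m| <= q ^+ 2 * gy.
  move=> /andP[m0 mq']; rewrite ger0_norm ?mulr_ge0//.
  rewrite [leRHS](_ : _ = (1 * (gy * q)) * q); last by ring.
  by rewrite ler_pM ?mulr_ge0// ler_pM.
have h3 : `|delta * mp * mr| <= q ^+ 2 * gy.
  rewrite ger0_norm ?mulr_ge0//.
  apply: (@le_trans _ _ (1 * (gp * q) * (gr * q))).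
    by rewrite ler_pM ?mulr_ge0// ler_pM.
  rewrite [leLHS](_ : _ = q ^+ 2 * (gp * gr)); last by ring.
  by rewrite ler_wpM2l// sqr_ge0.
rewrite [leRHS](_ : _ = q ^+ 2 * gy + q ^+ 2 * gy + q ^+ 2 * gy + q ^+ 2 * gy); last by ring.
by apply: ler_norm_add => //; apply: ler_norm_sub; [apply: ler_norm_sub|];
  rewrite ?h1 ?h2 ?p0 ?r0.
Qed.

(** The bracket offers gy^2. One factor gy turns the quotient gx / ga into gb, by gx gy = ga gb; the
    other absorbs the weight wy. The weight wx is left for f. *)
Lemma linear_term_bound (delta q W N : R) (ga gb gx gy gp gr ta tx my mp mr wa wx wy f : R) :
  0 <= delta <= 1 -> 1 <= q -> 0 <= W ->
  0 < ga <= 1 -> 0 <= gb <= 1 -> 0 <= gx <= 1 -> 0 <= gy <= 1 -> 0 <= gp <= 1 -> 0 <= gr <= 1 ->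
  gx * gy = ga * gb -> gp * gr = ga * gb ->
  0 < ta -> ta^-1 <= q -> 0 <= tx <= q ->
  0 <= my <= gy ^+ 2 * q -> 0 <= mp <= gp ^+ 2 * q -> 0 <= mr <= gr ^+ 2 * q ->
  0 <= wx -> 0 <= wy -> wa <= wx * wy -> wy * gy <= W -> wx * `|f| <= N ->
  wa * `|(gx * tx) / (ga * ta) *
     (my - delta * my * mp - delta * my * mr + delta * mp * mr) * f| <= 4 * q ^+ 4 * W * N * gb.
Proof.
move=> dP q1 W0 /andP[ga0 ga1] /andP[gb0 gb1] /andP[gx0 gx1] /andP[gy0 gy1]
  /andP[gp0 gp1] /andP[gr0 gr1] xy pr ta0 taq /andP[tx0 txq] myP mpP mrP wx0 wy0 ww hW hN.
have q0 : 0 <= q by exact: le_trans q1.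
have sq01 (g : R) : 0 <= g -> g <= 1 -> 0 <= g ^+ 2 <= 1.
  by move=> g0 g1; rewrite sqr_ge0 expr_le1.
have gpr : gp ^+ 2 * gr ^+ 2 <= gy ^+ 2.
  rewrite -exprMn pr -xy exprMn ler_piMl ?sqr_ge0//.
  by have /andP[] := sq01 _ gx0 gx1.
have B := bracket_bound dP q1 myP mpP mrP gpr (sq01 _ gp0 gp1) (sq01 _ gr0 gr1) (sqr_ge0 gy).
set Z := _ - _ - _ + _ in B *.
have c1 : 0 <= gx * tx / (ga * ta) by rewrite divr_ge0 ?mulr_ge0// ltW.
have h1 : `|gx * tx / (ga * ta) * Z| <= 4 * q ^+ 4 * gb * gy.
  rewrite normrM (ger0_norm c1).
  apply: (@le_trans _ _ (gx * q * (ga^-1 * q) * (4 * q ^+ 2 * gy ^+ 2))).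
    have ga'0 : 0 <= ga^-1 by rewrite invr_ge0 ltW.
    have ta'0 : 0 <= ta^-1 by rewrite invr_ge0 ltW.
    rewrite invfM; apply: ler_pM => //; first by rewrite !mulr_ge0.
    by apply: ler_pM; rewrite ?mulr_ge0// ler_wpM2l.
  rewrite [leLHS](_ : _ = 4 * q ^+ 4 * (gx * gy) * ga^-1 * gy); last by ring.
  rewrite xy [leLHS](_ : _ = 4 * q ^+ 4 * gb * gy * (ga * ga^-1)); last by ring.
  by rewrite divff ?mulr1// gt_eqF.
have ww' : wa <= wy * wx by rewrite mulrC.
have h2 : wy * `|gx * tx / (ga * ta) * Z| <= 4 * q ^+ 4 * W * gb.
  apply: (le_trans (ler_wpM2l wy0 h1)).
  rewrite [leLHS](_ : _ = (4 * q ^+ 4 * gb) * (wy * gy)); last by ring.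
  rewrite [leRHS](_ : _ = (4 * q ^+ 4 * gb) * W); last by ring.
  by rewrite ler_wpM2l// !mulr_ge0// exprn_ge0.
have := weighted_mul wy0 wx0 ww' h2 hN.
by rewrite [4 * q ^+ 4 * W * N * gb](_ : _ = 4 * q ^+ 4 * W * gb * N); last by ring.
Qed.

Lemma collision_densityE (delta a b c d : R) : collision_density delta a b c d =
  c * d * ((1 - delta * a) * (1 - delta * b)) - a * b * ((1 - delta * c) * (1 - delta * d)).
Proof. by rewrite /collision_density; ring. Qed.

Lemma collision_density_lower (delta a b c d : R) :
  0 <= a -> 0 <= b -> 0 <= c -> 0 <= d -> 0 <= delta ->
  delta * a <= 1 -> delta * b <= 1 -> delta * c <= 1 -> delta * d <= 1 ->
  - (a * b) <= collision_density delta a b c d.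
Proof.
move=> a0 b0 c0 d0 de a1 b1 c1 d1; rewrite collision_densityE.
have g : 0 <= c * d * ((1 - delta * a) * (1 - delta * b)) by rewrite !mulr_ge0// subr_ge0.
have l : a * b * ((1 - delta * c) * (1 - delta * d)) <= a * b.
  apply: ler_piMr; first exact: mulr_ge0.
  by apply: mulr_ile1; rewrite ?subr_ge0// gerBl mulr_ge0.
lra.
Qed.

(** The factor 1 - delta a is the distance to the upper obstacle up to scaling; the gain carries it,
    and the loss only helps. *)
Lemma collision_density_upper (delta a b c d : R) :
  0 <= a -> 0 <= b -> 0 <= c -> 0 <= d -> 0 <= delta <= 1 ->
  delta * a <= 1 -> delta * b <= 1 -> delta * c <= 1 -> delta * d <= 1 ->
  delta * collision_density delta a b c d <= (1 - delta * a) * (c * d).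
Proof.
move=> a0 b0 c0 d0 /andP[de de1] a1 b1 c1 d1; rewrite collision_densityE.
have l : 0 <= delta * (a * b * ((1 - delta * c) * (1 - delta * d))).
  by rewrite !mulr_ge0// subr_ge0.
have g : delta * (c * d * ((1 - delta * a) * (1 - delta * b))) <= (1 - delta * a) * (c * d).
  rewrite [leLHS](_ : _ = ((1 - delta * a) * (c * d)) * (delta * (1 - delta * b))); last by ring.
  apply: ler_piMr; first by rewrite !mulr_ge0// subr_ge0.
  by apply: mulr_ile1; rewrite ?subr_ge0// gerBl mulr_ge0.
rewrite mulrBr; lra.
Qed.
End local_bounds.

(** * Conservation of energy and the velocity weight *)

(** With k = (v - u).o, the cross terms 2 k (u.o - v.o) = -2 k^2 cancel the two squares k^2. *)
Lemma dot_post (R : realType) (v u o : R3 R) : dot o o = 1 ->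
  dot (u_post v u o) (u_post v u o) + dot (v_post v u o) (v_post v u o) = dot u u + dot v v.
Proof.
move=> o1; set k := dot (v - u) o.
have -> : dot (u_post v u o) (u_post v u o) = dot u u + 2 * k * dot u o + k ^+ 2 * dot o o.
  by rewrite /u_post -/k /dot /= /GRing.scale/=; ring.
have -> : dot (v_post v u o) (v_post v u o) = dot v v - 2 * k * dot v o + k ^+ 2 * dot o o.
  by rewrite /v_post -/k /dot /= /GRing.scale/=; ring.
have kE : dot v o = k + dot u o by rewrite /k /dot /=; ring.
by rewrite o1 kE; ring.
Qed.

Lemma gauss_post (R : realType) (v u o : R3 R) : dot o o = 1 ->
  gauss v * gauss u = gauss (v_post v u o) * gauss (u_post v u o).
Proof.
move=> /(@dot_post R v u) h; rewrite /gauss -!expRD; congr expR.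
by move: h; lra.
Qed.

(** Conservation of energy gives |v| <= |v'| + |u'|, and 1 + p + q <= (1 + p)(1 + q). This is why no
    weight is lost in the gain term. *)
Lemma weight_post (R : realType) (beta : R) (v u o : R3 R) : 0 <= beta -> dot o o = 1 ->
  weight beta v <= weight beta (v_post v u o) * weight beta (u_post v u o).
Proof.
move=> b0 /(@dot_post R v u); rewrite -!enorm_sqr => h.
set p := v_post v u o in h *; set q := u_post v u o in h *.
have np := enorm_ge0 p; have nq := enorm_ge0 q; have nv := enorm_ge0 v; have nu := enorm_ge0 u.
rewrite /weight -powRM ?addr_ge0//; apply: ge0_ler_powR; rewrite ?nnegrE ?mulr_ge0 ?addr_ge0//.
have : enorm v <= enorm p + enorm q.
  rewrite -(@ler_pXn2r _ 2) ?nnegrE ?addr_ge0// sqrrD.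
  have := sqr_ge0 (enorm u); have : 0 <= enorm p * enorm q by rewrite mulr_ge0.
  by rewrite -mulr_natl; move: h; lra.
have : 0 <= enorm p * enorm q by rewrite mulr_ge0.
rewrite mulrDl !mulrDr !mul1r mulr1; lra.
Qed.

Lemma weight_ge1 (R : realType) (beta : R) (v : R3 R) : 0 <= beta -> 1 <= weight beta v.
Proof.
move=> b0; rewrite /weight -[leLHS](powRr0 (1 + enorm v)) ler_powR// lerDl; exact: enorm_ge0.
Qed.

(* [(1 + r)^beta e^(-r^2/4) <= e^(beta r - r^2/4) <= e^(beta^2)] *)
Lemma weight_gauss (R : realType) (beta : R) (v : R3 R) : 0 <= beta ->
  weight beta v * gauss v <= expR (beta ^+ 2).
Proof.
move=> b0; rewrite /weight /gauss -enorm_sqr; have := enorm_ge0 v; move: (enorm v) => r r0.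
have r1 : 0 < 1 + r by rewrite ltr_pwDl.
rewrite /powR gt_eqF// -expRD ler_expR.
have : beta * ln (1 + r) <= beta * r.
  by rewrite ler_wpM2l// -[leRHS]expRK ler_ln ?posrE ?expR_gt0// expR_ge1Dx.
have : 0 <= (r / 2 - beta) ^+ 2 by exact: sqr_ge0.
by rewrite !expr2; lra.
Qed.

(** * The operators nu, K and Gamma in the weighted sup norm *)

Section measurable_polynomials.
Context d (T : measurableType d) (R : realType).

Local Ltac meas := first [ assumption | exact: measurable_cst
  | apply: measurable_funD; meas | apply: measurable_funN; meas | apply: measurable_funM; meas ].

Lemma measurable_nu_density (delta : R) (mb mc md : T -> R) :
  measurable_fun setT mb -> measurable_fun setT mc -> measurable_fun setT md ->
  measurable_fun setT (fun y => mb y - delta * mb y * md y - delta * mb y * mc y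
    + delta * md y * mc y).
Proof. by move=> *; meas. Qed.

Lemma measurable_K_term (delta : R) (sx sa my mp mr f : T -> R) :
  measurable_fun setT sx -> measurable_fun setT sa -> measurable_fun setT my ->
  measurable_fun setT mp -> measurable_fun setT mr -> measurable_fun setT f ->
  measurable_fun setT (fun y => sx y / sa y *
    (my y - delta * my y * mp y - delta * my y * mr y + delta * mp y * mr y) * f y).
Proof.
move=> hx ha hy hp hr hf; have hV := measurable_funV ha.
apply: measurable_funM => //; apply: measurable_funM; first exact: (measurable_funM hx hV).
by meas.
Qed.

Lemma measurable_Gamma_density (delta : R) (ma mb mc md ha hb hc hd : T -> R) :
  measurable_fun setT ma -> measurable_fun setT mb -> measurable_fun setT mc ->
  measurable_fun setT md -> measurable_fun setT ha -> measurable_fun setT hb ->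
  measurable_fun setT hc -> measurable_fun setT hd ->
  measurable_fun setT (fun y =>
      hd y * hc y * (1 - delta * ma y - delta * mb y)
    - hb y * ha y * (1 - delta * mc y - delta * md y)
    + delta * hc y * hb y * (ma y - md y)
    + delta * hd y * hb y * (ma y - mc y)
    + delta * hc y * ha y * (mb y - md y)
    + delta * hd y * ha y * (mb y - mc y)
    + delta * hb y * ha y * hd y
    + delta * hb y * ha y * hc y
    - delta * hd y * hc y * hb y
    - delta * hd y * hc y * ha y).
Proof. by move=> *; meas. Qed.
End measurable_polynomials.

(** This is C_delta(F) / sqrt(mubar) for F = mu + sqrt(mubar) f; [Rop_cint] identifies it with a
    single collision integral. *)
Definition Rop {R : realType} (gamma : R) (b : R -> R) (delta rho : R)
    (f : R3 R -> R) (v : R3 R) : R :=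
  Kop gamma b delta rho f v + Gamma gamma b delta rho f v - nu gamma b delta rho v * f v.

Definition weight_bounded {R : realType} (beta N : R) (f : R3 R -> R) : Prop :=
  measurable_fun setT f /\ forall v, weight beta v * `|f v| <= N.

Lemma dominatedZ (R : realType) (P k : R) (G : R3 R * R2 R -> R) :
  dominated P G -> dominated (`|k| * P) (fun z => k * G z).
Proof.
move=> [mG hG]; split; first by apply: measurable_funM.
by move=> z; rewrite normrM -mulrA ler_wpM2l.
Qed.

Lemma dominatedB (R : realType) (P Q : R) (F G : R3 R * R2 R -> R) :
  dominated P F -> dominated Q G -> dominated (P + Q) (fun z => F z - G z).
Proof.
move=> [mF hF] [mG hG]; split; first exact: measurable_funB.
by move=> z; rewrite mulrDl; exact: ler_norm_sub.
Qed.

Lemma measurable_u_post d (T : measurableType d) (R : realType) (V U O : T -> R3 R) :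
  measurable_fun setT V -> measurable_fun setT U -> measurable_fun setT O ->
  measurable_fun setT (fun t => u_post (V t) (U t) (O t)).
Proof.
move=> mV mU mO; apply: measurable_R3D => //; apply: measurable_R3Z => //.
by apply: measurable_dot => //; exact: measurable_R3B.
Qed.

Lemma measurable_v_post d (T : measurableType d) (R : realType) (V U O : T -> R3 R) :
  measurable_fun setT V -> measurable_fun setT U -> measurable_fun setT O ->
  measurable_fun setT (fun t => v_post (V t) (U t) (O t)).
Proof.
move=> mV mU mO; apply: measurable_R3B => //; apply: measurable_R3Z => //.
by apply: measurable_dot => //; exact: measurable_R3B.
Qed.

Lemma measurable_mu d (T : measurableType d) (R : realType) (delta rho : R) (P : T -> R3 R) :
  measurable_fun setT P -> measurable_fun setT (fun t => mu delta rho (P t)).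
Proof.
move=> mP; apply: measurable_funV; apply: measurable_funD => //; apply: measurable_funM => //.
apply: measurableT_comp => //; apply: measurable_funM => //; apply: measurable_funX.
exact: measurable_enorm.
Qed.

Lemma measurable_sqrt_mubar d (T : measurableType d) (R : realType) (delta rho : R)
    (P : T -> R3 R) :
  measurable_fun setT P -> measurable_fun setT (fun t => sqrt_mubar delta rho (P t)).
Proof.
move=> mP; have mm := measurable_mu delta rho mP.
apply: (measurableT_comp (continuous_measurable_fun (@sqrt_continuous R))).
apply: measurable_funM => //; apply: (measurable_funB (f := cst 1)) => //.
exact: measurable_funM.
Qed.

Section operators.
Context {R : realType} (gamma : R) (b : R -> R) (beta delta rho : R).
Context (gammaP : -3 < gamma < 0) (bP : angular_kernel b) (beta0 : 0 <= beta).
Context (deltaP : 0 <= delta <= 1) (rho0 : 0 < rho).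

Let m := mu delta rho.
Let s := sqrt_mubar delta rho.
Let w := weight beta.
Let W := expR (beta ^+ 2).
(** With mu = g^2 [tau] and sqrt(mubar) = g [sig], this one constant dominates [tau] <= 1/rho, [sig]
    <= 1/sqrt rho and 1/[sig] <= 1/sqrt rho + sqrt rho, uniformly for delta in [0, 1]. *)
Let q := 2 + rho + rho^-1.
Let tau (v : R3 R) := (delta * gauss v ^+ 2 + rho)^-1.
Let sig (v : R3 R) := Num.sqrt rho * tau v.

Let denE v : 0 < delta * gauss v ^+ 2 + rho.
Proof. by move: deltaP => /andP[d0 _]; rewrite ltr_wpDl// mulr_ge0// sqr_ge0. Qed.

Let gauss0 (v : R3 R) : gauss v != 0. Proof. by rewrite gt_eqF// gauss_gt0. Qed.

Let muE v : m v = gauss v ^+ 2 * tau v.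
Proof.
rewrite /m /mu /tau enorm_sqr.
have -> : expR (dot v v / 2) = (gauss v ^+ 2)^-1.
  by rewrite /gauss expr2 -expRD -expRN; congr expR; field.
have := denE v; have := gauss0 v; move: (gauss v) => g g0 d0.
have h : delta + rho / g ^+ 2 = (delta * g ^+ 2 + rho) / g ^+ 2 by field.
by rewrite h invfM invrK mulrC.
Qed.

Let s_E v : s v = gauss v * sig v.
Proof.
rewrite /s /sqrt_mubar -/m muE /sig /tau.
have := denE v; have := gauss_gt0 v; move: (gauss v) => g g0 d0.
have -> : g ^+ 2 * (delta * g ^+ 2 + rho)^-1 * (1 - delta * (g ^+ 2 * (delta * g ^+ 2 + rho)^-1))
  = rho * (g * (delta * g ^+ 2 + rho)^-1) ^+ 2.
  by field; rewrite gt_eqF.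
rewrite sqrtrM ?ltW// sqrtr_sqr ger0_norm; first by ring.
by rewrite mulr_ge0 ?invr_ge0// ltW.
Qed.

Let q1 : 1 <= q.
Proof. have h : 0 < rho^-1 by rewrite invr_gt0. by rewrite /q; move: rho0 h; lra. Qed.

Let r0 : 0 < Num.sqrt rho. Proof. by rewrite sqrtr_gt0. Qed.

Let rq : (Num.sqrt rho)^-1 <= 1 + rho^-1.
Proof.
have e : rho^-1 = (Num.sqrt rho)^-1 ^+ 2 by rewrite exprVn sqr_sqrtr// ltW.
by have := sqr_ge0 ((Num.sqrt rho)^-1 - 2^-1); move: e; rewrite !expr2; lra.
Qed.

Let rq' : Num.sqrt rho <= 1 + rho.
Proof.
have e : rho = (Num.sqrt rho) ^+ 2 by rewrite sqr_sqrtr// ltW.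
by have := sqr_ge0 (Num.sqrt rho - 2^-1); move: e; rewrite !expr2; lra.
Qed.

Let tauP v : 0 < tau v <= rho^-1.
Proof.
rewrite invr_gt0 denE lef_pV2 ?posrE// lerDr mulr_ge0 ?sqr_ge0//.
by case/andP: deltaP.
Qed.

Let tauq v : 0 <= tau v <= q.
Proof.
have /andP[h1 h2] := tauP v; rewrite ltW//=; apply: (le_trans h2); rewrite /q.
by rewrite lerDr; move: rho0; lra.
Qed.

Let sig_gt0 v : 0 < sig v.
Proof. by have /andP[h1 _] := tauP v; rewrite mulr_gt0. Qed.

Let sigq v : sig v <= q.
Proof.
have /andP[h1 h2] := tauP v.
apply: (le_trans (ler_wpM2l (ltW r0) h2)).
have -> : Num.sqrt rho / rho = (Num.sqrt rho)^-1.
  rewrite -{2}[rho]sqr_sqrtr ?ltW// expr2 invfM mulrA divff ?mul1r// gt_eqF//.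
by apply: (le_trans rq); rewrite /q; move: rho0; lra.
Qed.

Let sigVq v : (sig v)^-1 <= q.
Proof.
rewrite /sig invfM /tau invrK mulrDr.
have -> : (Num.sqrt rho)^-1 * rho = Num.sqrt rho.
  rewrite -{2}[rho]sqr_sqrtr ?ltW// expr2 mulrA mulVf ?mul1r// gt_eqF//.
have h : (Num.sqrt rho)^-1 * (delta * gauss v ^+ 2) <= (Num.sqrt rho)^-1.
  rewrite ler_piMr ?invr_ge0 ?(ltW r0)//; case/andP: deltaP => d0 d1.
  by rewrite mulr_ile1 ?sqr_ge0// expr_le1// ?gauss_le1// ltW// gauss_gt0.
apply: (le_trans (lerD h (lexx _))); apply: (le_trans (lerD rq rq')).
by rewrite /q; lra.
Qed.

Let s_gt0 v : 0 < s v. Proof. by rewrite s_E mulr_gt0// gauss_gt0. Qed.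

Let mq v : 0 <= m v <= gauss v ^+ 2 * q.
Proof.
have /andP[t0 t1] := tauq v; rewrite muE mulr_ge0 ?sqr_ge0//=.
by rewrite ler_wpM2l ?sqr_ge0.
Qed.

Let V' (v : R3 R) (z : R3 R * R2 R) := v_post v z.1 (sphere_point z.2).
Let U' (v : R3 R) (z : R3 R * R2 R) := u_post v z.1 (sphere_point z.2).

Let Fp (f : R3 R -> R) v := m v + s v * f v.

Let QF (f : R3 R -> R) v z :=
  collision_density delta (Fp f v) (Fp f z.1) (Fp f (V' v z)) (Fp f (U' v z)).

Let nuint v z := m z.1 - delta * m z.1 * m (U' v z) - delta * m z.1 * m (V' v z)
  + delta * m (U' v z) * m (V' v z).

Let Kint (f : R3 R -> R) v (z : R3 R * R2 R) :=
  let u := z.1 in let u' := U' v z in let v' := V' v z in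
      s u' / s v *
        (m v' - delta * m v' * m u - delta * m v' * m v + delta * m u * m v) * f u'
    + s v' / s v *
        (m u' - delta * m u' * m u - delta * m u' * m v + delta * m u * m v) * f v'
    - s u / s v *
        (m v - delta * m v * m u' - delta * m v * m v' + delta * m u' * m v') * f u.

Let Gint (f : R3 R -> R) v (z : R3 R * R2 R) :=
  let h := fun x => s x * f x in
  let u := z.1 in let u' := U' v z in let v' := V' v z in
      h u' * h v' * (1 - delta * m v - delta * m u)
    - h u * h v * (1 - delta * m v' - delta * m u')
    + delta * h v' * h u * (m v - m u')
    + delta * h u' * h u * (m v - m v')
    + delta * h v' * h v * (m u - m u')
    + delta * h u' * h v * (m u - m v')
    + delta * h u * h v * h u'
    + delta * h u * h v * h v'
    - delta * h u' * h v' * h u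
    - delta * h u' * h v' * h v.

Let nu_cint v : nu gamma b delta rho v = cint gamma b v (nuint v). Proof. by []. Qed.
Let Kop_cint f v : Kop gamma b delta rho f v = cint gamma b v (Kint f v). Proof. by []. Qed.
Let Gamma_cint f v : Gamma gamma b delta rho f v = (s v)^-1 * cint gamma b v (Gint f v).
Proof. by []. Qed.

(** mu is an equilibrium: over the common denominator both halves equal G (rho^2 - delta^2 G) with G
    = g(v)^2 g(u)^2, a function of the conserved energy alone. *)
Let detailed_balance v z : collision_density delta (m v) (m z.1) (m (V' v z)) (m (U' v z)) = 0.
Proof.
have h := gauss_post v z.1 (dot_sphere_point z.2).
rewrite -/(V' v z) -/(U' v z) in h; rewrite /collision_density !muE /tau.
move: (denE v) (denE z.1) (denE (V' v z)) (denE (U' v z)) h; move: (gauss v) (gauss z.1) (gauss (V' v z)) (gauss (U' v z)) => A B C D.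
move=> a0 b0 c0 d0 h.
have n (x : R) : 0 < x -> x != 0 by move=> ?; rewrite gt_eqF.
have h2 : A ^+ 2 * B ^+ 2 = C ^+ 2 * D ^+ 2 by rewrite -!exprMn h.
set a := _ + rho in a0 *; set bb := _ + rho in b0 *; set c := _ + rho in c0 *; set d := _ + rho in d0 *.
have -> : C ^+ 2 * c^-1 * (D ^+ 2 * d^-1) * (1 - delta * (A ^+ 2 * a^-1) - delta * (B ^+ 2 * bb^-1))
  = C ^+ 2 * D ^+ 2 * (a * bb - delta * A ^+ 2 * bb - delta * B ^+ 2 * a) / (a * bb * c * d).
  by field; rewrite !n.
have -> : A ^+ 2 * a^-1 * (B ^+ 2 * bb^-1) * (1 - delta * (C ^+ 2 * c^-1) - delta * (D ^+ 2 * d^-1))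
  = A ^+ 2 * B ^+ 2 * (c * d - delta * C ^+ 2 * d - delta * D ^+ 2 * c) / (a * bb * c * d).
  by field; rewrite !n.
have E1 : a * bb - delta * A ^+ 2 * bb - delta * B ^+ 2 * a = rho ^+ 2 - delta ^+ 2 * (A ^+ 2 * B ^+ 2).
  by rewrite /a /bb; ring.
have E2 : c * d - delta * C ^+ 2 * d - delta * D ^+ 2 * c = rho ^+ 2 - delta ^+ 2 * (C ^+ 2 * D ^+ 2).
  by rewrite /c /d; ring.
by rewrite E1 E2 h2 subrr.
Qed.

(** The expansion of C_delta around mu, at the level of integrands. The term of order zero in f is
    subtracted by [detailed_balance]; what remains is an algebraic identity in the values of m, s
    and f. *)
Let QF_split f v z : QF f v z = s v * Kint f v z - nuint v z * (s v * f v) + Gint f v z.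
Proof.
have := detailed_balance v z; rewrite /QF /Kint /nuint /Gint /Fp /collision_density.
have sv : s v != 0 by rewrite gt_eqF.
move: (f v) (f z.1) (f (V' v z)) (f (U' v z)) => fa fb fc fd.
move: (s z.1) (s (V' v z)) (s (U' v z)) sv; move: (s v) => sa sb sc sd sv.
move: (m v) (m z.1) (m (V' v z)) (m (U' v z)) => ma mb mc md h.
rewrite -[LHS]subr0 -[X in _ - X = _]h.
by field.
Qed.
Section measurability.
Context d (S : measurableType d) (V : S -> R3 R) (f : S -> R3 R -> R).
Context (mV : measurable_fun setT V) (mf : measurable_fun setT (fun y : S * R3 R => f y.1 y.2)).

Let T : measurableType _ := (S * (R3 R * R2 R))%type.
Let pa (y : T) : R3 R := V y.1.
Let pb (y : T) : R3 R := y.2.1.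
Let po (y : T) : R3 R := sphere_point y.2.2.
Let pc (y : T) : R3 R := V' (V y.1) y.2.
Let pd (y : T) : R3 R := U' (V y.1) y.2.

Let mpa : measurable_fun setT pa. Proof. exact: (measurableT_comp mV). Qed.
Let mpb : measurable_fun setT pb.
Proof. exact: (measurableT_comp measurable_fst measurable_snd). Qed.
Let mpo : measurable_fun setT po.
Proof.
apply: measurable_sphere_point; exact: (measurableT_comp measurable_snd measurable_snd).
Qed.
Let mpc : measurable_fun setT pc. Proof. exact: (measurable_v_post mpa mpb mpo). Qed.
Let mpd : measurable_fun setT pd. Proof. exact: (measurable_u_post mpa mpb mpo). Qed.

Let mfp (p : T -> R3 R) : measurable_fun setT p -> measurable_fun setT (fun y => f y.1 (p y)).
Proof.
by move=> mp; apply: (measurableT_comp mf (g := fun y : T => (y.1, p y))); exact: measurable_fun_pair.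
Qed.

Let mm p : measurable_fun setT p -> measurable_fun setT (fun y : T => m (p y)).
Proof. exact: measurable_mu. Qed.
Let msq p : measurable_fun setT p -> measurable_fun setT (fun y : T => s (p y)).
Proof. exact: measurable_sqrt_mubar. Qed.

Let mh p : measurable_fun setT p -> measurable_fun setT (fun y : T => s (p y) * f y.1 (p y)).
Proof. by move=> mp; apply: measurable_funM; [exact: msq|exact: mfp]. Qed.

Let measurable_nuint : measurable_fun setT (fun y : T => nuint (V y.1) y.2).
Proof. exact: (measurable_nu_density delta (mm mpb) (mm mpc) (mm mpd)). Qed.

Let measurable_Kint : measurable_fun setT (fun y : T => Kint (f y.1) (V y.1) y.2).
Proof.
have t1 := measurable_K_term delta (msq mpd) (msq mpa) (mm mpc) (mm mpb) (mm mpa) (mfp mpd).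
have t2 := measurable_K_term delta (msq mpc) (msq mpa) (mm mpd) (mm mpb) (mm mpa) (mfp mpc).
have t3 := measurable_K_term delta (msq mpb) (msq mpa) (mm mpa) (mm mpd) (mm mpc) (mfp mpb).
exact: (measurable_funB (measurable_funD t1 t2) t3).
Qed.

Let measurable_Gint : measurable_fun setT (fun y : T => Gint (f y.1) (V y.1) y.2).
Proof.
exact: (measurable_Gamma_density delta (mm mpa) (mm mpb) (mm mpc) (mm mpd)
  (mh mpa) (mh mpb) (mh mpc) (mh mpd)).
Qed.

Lemma measurable_nu_comp : measurable_fun setT (fun y => nu gamma b delta rho (V y)).
Proof. exact: (measurable_cint gamma bP (G := fun y => nuint (V y)) mV measurable_nuint). Qed.

Lemma measurable_Kop_comp : measurable_fun setT (fun y => Kop gamma b delta rho (f y) (V y)).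
Proof. exact: (measurable_cint gamma bP (G := fun y => Kint (f y) (V y)) mV measurable_Kint). Qed.

Lemma measurable_Gamma_comp :
  measurable_fun setT (fun y => Gamma gamma b delta rho (f y) (V y)).
Proof.
apply: measurable_funM; first by apply: measurable_funV; exact: measurable_sqrt_mubar.
exact: (measurable_cint gamma bP (G := fun y => Gint (f y) (V y)) mV measurable_Gint).
Qed.

(** The parameter space S is arbitrary because it will be an interval of times along a
    characteristic as well as the whole phase space with an integration time added. *)
Lemma measurable_Rop_comp : measurable_fun setT (fun y => Rop gamma b delta rho (f y) (V y)).
Proof.
apply: measurable_funB; first apply: measurable_funD.
- exact: measurable_Kop_comp.
- exact: measurable_Gamma_comp.
- apply: measurable_funM; first exact: measurable_nu_comp.
  by apply: (measurableT_comp mf (g := fun y => (y, V y))); exact: measurable_fun_pair.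
Qed.

Lemma measurable_densities : [/\ measurable_fun setT (fun y : T => nuint (V y.1) y.2),
  measurable_fun setT (fun y : T => Kint (f y.1) (V y.1) y.2) &
  measurable_fun setT (fun y : T => Gint (f y.1) (V y.1) y.2)].
Proof. by []. Qed.
End measurability.

Let kfac (f : R3 R -> R) v := gauss v * tau v + sig v * f v.

Let FpE f v : Fp f v = gauss v * kfac f v.
Proof. by rewrite /Fp muE s_E /kfac; ring. Qed.

Let W1 : 1 <= W.
Proof. by rewrite -[leLHS]expR0 ler_expR sqr_ge0. Qed.

Let q0 : 0 <= q. Proof. exact: le_trans q1. Qed.

Let w1 v : 1 <= w v. Proof. exact: weight_ge1. Qed.
Let w0 v : 0 <= w v. Proof. exact: le_trans (w1 v). Qed.

Let gaussP (v : R3 R) : 0 <= gauss v <= 1.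
Proof. by rewrite gauss_le1 ltW ?gauss_gt0. Qed.

(** The bound on w_beta k, for F = g k, when w_beta |f| <= N: the equilibrium part contributes q W
    and the perturbation q N. *)
Let H N := q * W * (1 + N).

Let kfac_bound N f v : 0 <= N -> w v * `|f v| <= N -> w v * `|kfac f v| <= H N.
Proof.
move=> N0 hf; have /andP[t0 tq] := tauq v.
apply: (le_trans (ler_wpM2l (w0 v) (ler_normD _ _))); rewrite mulrDr /H mulrDr mulr1.
apply: lerD.
  rewrite ger0_norm; last by case/andP: (gaussP v) => g0 _; rewrite mulr_ge0.
  rewrite mulrA [leRHS]mulrC; apply: ler_pM => //; last exact: weight_gauss.
  by case/andP: (gaussP v) => g0 _; rewrite mulr_ge0.
rewrite normrM (ger0_norm (ltW (sig_gt0 v))) mulrCA -mulrA.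
apply: ler_pM; [exact: ltW|by rewrite mulr_ge0|exact: sigq|].
by apply: (le_trans hf); rewrite ler_peMl.
Qed.

Let kfacB e f g v : w v * `|f v - g v| <= e -> w v * `|kfac f v - kfac g v| <= q * e.
Proof.
move=> h; have -> : kfac f v - kfac g v = sig v * (f v - g v) by rewrite /kfac; ring.
rewrite normrM (ger0_norm (ltW (sig_gt0 v))) mulrCA.
by apply: ler_pM; [exact: ltW|rewrite mulr_ge0|exact: sigq|].
Qed.

Let HN1 N : 0 <= N -> 1 <= H N.
Proof.
move=> N0; rewrite /H -[leLHS]mulr1; apply: ler_pM => //; last by rewrite lerDl.
by rewrite -[leLHS]mulr1; apply: ler_pM.
Qed.

Let unit_sp (z : R3 R * R2 R) := dot_sphere_point z.2.

Let gauss_cd v z : gauss v * gauss z.1 = gauss (V' v z) * gauss (U' v z).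
Proof. by rewrite /V' /U' -gauss_post// unit_sp. Qed.

Let weight_cd v z : w v <= w (V' v z) * w (U' v z).
Proof. by apply: weight_post => //; rewrite unit_sp. Qed.

Let measurable_slice (G : R3 R -> R3 R * R2 R -> R) v :
  measurable_fun setT (fun y : R3 R * (R3 R * R2 R) => G y.1 y.2) ->
  measurable_fun setT (G v).
Proof. by move=> mG; exact: (measurableT_comp mG (pair1_measurable v)). Qed.

Let mconst (f : R3 R -> R) : measurable_fun setT f ->
  measurable_fun setT (fun y : R3 R * R3 R => f y.2).
Proof. by move=> mf; exact: (measurableT_comp mf measurable_snd). Qed.

Let measurable_id3 : measurable_fun setT (fun x : R3 R => x). Proof. by []. Qed.

Let gauss_sq_le v z : gauss (U' v z) ^+ 2 * gauss (V' v z) ^+ 2 <= gauss z.1 ^+ 2.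
Proof.
rewrite -exprMn mulrC -gauss_cd exprMn ler_piMl ?sqr_ge0//.
by rewrite expr_le1// ?gauss_le1// ltW// gauss_gt0.
Qed.

Let gauss_sqP (v : R3 R) : 0 <= gauss v ^+ 2 <= 1.
Proof. by case/andP: (gaussP v) => g0 g1; rewrite sqr_ge0 expr_le1. Qed.

Let dominated_nu v : dominated (4 * q ^+ 2) (nuint v).
Proof.
split.
  by have [mn _ _] := measurable_densities (f := fun _ _ => 0) measurable_id3 (measurable_cst _);
    exact: (measurable_slice v mn).
move=> z; have B := bracket_bound deltaP q1 (mq z.1) (mq (U' v z)) (mq (V' v z))
  (gauss_sq_le v z) (gauss_sqP _) (gauss_sqP _) (sqr_ge0 _).
apply: (le_trans B); rewrite ler_wpM2l ?mulr_ge0 ?sqr_ge0//.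
by case/andP: (gaussP z.1) => g0 g1; rewrite expr2 ler_piMl.
Qed.

(** Adding and subtracting delta^2 times the product of the three values of m regroups the density
    into two products of nonnegative factors, since delta m <= 1. *)
Let nuint_ge0 v z : 0 <= nuint v z.
Proof.
have mle x : 0 <= 1 - delta * m x.
  rewrite muE /tau subr_ge0 mulrA ler_pdivrMr ?denE// mul1r lerDl; exact: ltW.
have [mb _] := andP (mq z.1); have [mc _] := andP (mq (V' v z)); have [md _] := andP (mq (U' v z)).
rewrite /nuint [leRHS](_ : _ = m z.1 * ((1 - delta * m (U' v z)) * (1 - delta * m (V' v z)))
  + delta * m (U' v z) * m (V' v z) * (1 - delta * m z.1)); last by ring.
by case/andP: deltaP => d0 _; rewrite addr_ge0// !mulr_ge0.
Qed.

(** The three terms of K all have this form: (x, y) is (u', v'), (v', u') or (u, v), and (p, r) is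
    the other pair of the collision. *)
Let term_bound N (f : R3 R -> R) v (z : R3 R * R2 R) x y p r :
  gauss x * gauss y = gauss v * gauss z.1 -> gauss p * gauss r = gauss v * gauss z.1 ->
  w v <= w x * w y -> w x * `|f x| <= N ->
  w v * `|s x / s v * (m y - delta * m y * m p - delta * m y * m r + delta * m p * m r) * f x|
    <= 4 * q ^+ 4 * W * N * gauss z.1.
Proof.
move=> xy pr ww hf; rewrite !s_E.
apply: (@linear_term_bound _ delta q W N (gauss v) (gauss z.1) (gauss x) (gauss y) (gauss p)
  (gauss r) (sig v) (sig x) (m y) (m p) (m r) (w v) (w x) (w y) (f x)) => //.
- exact: le_trans W1.
- by rewrite gauss_gt0 gauss_le1.
- by rewrite sigq ltW.
- exact: weight_gauss.
Qed.

Let dominated_K N f v : 0 <= N -> weight_bounded beta N f ->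
  dominated (12 * q ^+ 4 * W * N / w v) (Kint f v).
Proof.
move=> N0 [mf hf]; split.
  by have [_ mK _] := measurable_densities (f := fun _ => f) measurable_id3 (mconst mf);
    exact: (measurable_slice v mK).
move=> z; have wp : 0 < w v by exact: lt_le_trans (w1 v).
rewrite mulrAC ler_pdivlMr// [leLHS]mulrC.
have gcd := gauss_cd v z; have wcd := weight_cd v z.
have wb : w v <= w z.1 * w v by rewrite ler_peMl.
have b1 := @term_bound N f v z (U' v z) (V' v z) z.1 v (etrans (mulrC _ _) (esym gcd))
  (mulrC _ _) (eq_ind _ (fun t => w v <= t) wcd _ (mulrC _ _)) (hf _).
have b2 := @term_bound N f v z (V' v z) (U' v z) z.1 v (esym gcd) (mulrC _ _) wcd (hf _).
have b3 := @term_bound N f v z z.1 v (U' v z) (V' v z) (mulrC _ _)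
  (etrans (mulrC _ _) (esym gcd)) wb (hf _).
apply: (le_trans (ler_wpM2l (w0 v) (ler_normB _ _))); rewrite mulrDr.
apply: (le_trans (lerD (ler_wpM2l (w0 v) (ler_normD _ _)) b3)).
rewrite mulrDr; apply: (le_trans (lerD (lerD b1 b2) (lexx _))).
by rewrite le_eqVlt; apply/orP; left; apply/eqP; ring.
Qed.

Let measurable_QF f v : measurable_fun setT f -> measurable_fun setT (QF f v).
Proof.
move=> mf.
have [mn mK mG] := measurable_densities (f := fun _ => f) measurable_id3 (mconst mf).
have -> : QF f v = (fun z => s v * Kint f v z - nuint v z * (s v * f v) + Gint f v z).
  by apply/funext => z; exact: QF_split.
apply: measurable_funD; last exact: (measurable_slice v mG).
apply: (measurable_funB (f := fun z => s v * Kint f v z)).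
  by apply: measurable_funM => //; exact: (measurable_slice v mK).
by apply: measurable_funM => //; exact: (measurable_slice v mn).
Qed.

(** The factor g(v) is kept in the bound, to compensate the later division by sqrt(mubar)(v). *)
Let dominated_QFB N e f g v : 0 <= N -> 0 <= e -> weight_bounded beta N f ->
  weight_bounded beta N g -> (forall x, w x * `|f x - g x| <= e) ->
  dominated (16 * gauss v * H N ^+ 2 * (q * e) / w v) (fun z => QF f v z - QF g v z).
Proof.
move=> N0 e0 [mf hf] [mg hg] fg; split.
  by apply: measurable_funB; exact: measurable_QF.
move=> z; have wp : 0 < w v by exact: lt_le_trans (w1 v).
rewrite mulrAC ler_pdivlMr// [leLHS]mulrC /QF !FpE.
have h := @collision_density_lip _ delta (H N) (q * e) (gauss v) (gauss z.1) (gauss (V' v z))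
  (gauss (U' v z)) (w v) (w z.1) (w (V' v z)) (w (U' v z)) (kfac f v) (kfac f z.1)
  (kfac f (V' v z)) (kfac f (U' v z)) (kfac g v) (kfac g z.1) (kfac g (V' v z))
  (kfac g (U' v z)) deltaP (HN1 N0) (mulr_ge0 q0 e0) (gauss_cd v z) (gaussP _) (gaussP _)
  (gaussP _) (gaussP _) (w1 _) (w1 _) (w1 _) (w1 _) (weight_cd v z).
apply: (le_trans (h _ _ _ _ _ _ _ _ _ _ _ _)); try exact: kfac_bound; try exact: kfacB.
by rewrite le_eqVlt; apply/orP; left; apply/eqP; ring.
Qed.

Let weight_bounded0 N : 0 <= N -> weight_bounded beta N (fun _ => 0).
Proof. by move=> N0; split=> // v; rewrite normr0 mulr0. Qed.

Let QF0 v z : QF (fun _ => 0) v z = 0.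
Proof. by rewrite /QF /Fp !mulr0 !addr0 detailed_balance. Qed.

Let dominated_QF N f v : 0 <= N -> weight_bounded beta N f ->
  dominated (16 * gauss v * H N ^+ 2 * (q * N) / w v) (QF f v).
Proof.
move=> N0 hf; have h0 := weight_bounded0 N0.
have := @dominated_QFB N N f (fun _ => 0) v N0 N0 hf h0 _.
have -> : (fun z => QF f v z - QF (fun _ => 0) v z) = QF f v.
  by apply/funext => z; rewrite QF0 subr0.
by apply=> x; rewrite subr0; case: hf.
Qed.

(** The density of Gamma is written as the full density minus that of K plus that of nu. All three
    are dominated, so linearity of the integral applies without estimating the terms of Gamma. *)
Lemma Rop_cint N f v : 0 <= N -> weight_bounded beta N f ->
  Rop gamma b delta rho f v = (s v)^-1 * cint gamma b v (QF f v).
Proof.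
move=> N0 hf.
have dQ := dominated_QF v N0 hf; have dK := dominated_K v N0 hf; have dn := dominated_nu v.
have dsK := dominatedZ (s v) dK; have dfn := dominatedZ (s v * f v) dn.
have GE : Gint f v = (fun z => (QF f v z - s v * Kint f v z) + (s v * f v) * nuint v z).
  by apply/funext => z; rewrite QF_split; ring.
rewrite /Rop Gamma_cint Kop_cint nu_cint GE.
rewrite (cintD gammaP bP _ (dominatedB dQ dsK) dfn) (cintB gammaP bP _ dQ dsK).
rewrite (cintZ gammaP bP _ _ dK) (cintZ gammaP bP _ _ dn).
by field; rewrite gt_eqF.
Qed.

Section with_cint_bound.
Context (J : R) (J0 : 0 <= J)
  (JP : forall v P G, dominated P G -> `|cint gamma b v G| <= J * P).

(** The Lipschitz constant: 16 from the density, W^2 q^2 from [H N] squared, one q from the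
    variation of k and one from 1/[sig]. Using J + 1 instead of J makes it positive. *)
Let A := 16 * (J + 1) * W ^+ 2 * q ^+ 4.

Let JA : J <= J + 1. Proof. by rewrite lerDl. Qed.

Lemma Rop_lip N e f g v : 0 <= N -> 0 <= e -> weight_bounded beta N f ->
  weight_bounded beta N g -> (forall x, w x * `|f x - g x| <= e) ->
  w v * `|Rop gamma b delta rho f v - Rop gamma b delta rho g v| <= A * (1 + N) ^+ 2 * e.
Proof.
move=> N0 e0 hf hg fg; rewrite (Rop_cint v N0 hf) (Rop_cint v N0 hg) -mulrBr.
have wp : 0 < w v by exact: lt_le_trans (w1 v).
rewrite -(cintB gammaP bP _ (dominated_QF v N0 hf) (dominated_QF v N0 hg)).
have := JP v (dominated_QFB v N0 e0 hf hg fg).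
have sV0 : 0 <= (s v)^-1 by rewrite invr_ge0 ltW.
rewrite normrM (ger0_norm sV0) => h.
apply: (@le_trans _ _ (w v * ((s v)^-1 * (J * (16 * gauss v * H N ^+ 2 * (q * e) / w v))))).
  by rewrite ler_wpM2l// ler_wpM2l.
rewrite s_E invfM.
rewrite [leLHS](_ : _ = (sig v)^-1 * (J * (16 * H N ^+ 2 * q * e))); last first.
  by field; rewrite !gt_eqF// gauss_gt0.
apply: (@le_trans _ _ (q * ((J + 1) * (16 * H N ^+ 2 * q * e)))).
  have c0 : 0 <= 16 * H N ^+ 2 * q * e by rewrite mulr_ge0// mulr_ge0// mulr_ge0// sqr_ge0.
  apply: ler_pM => //; first by rewrite invr_ge0 ltW.
    by rewrite mulr_ge0.
  by rewrite ler_wpM2r.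
by rewrite /H /A le_eqVlt; apply/orP; left; apply/eqP; ring.
Qed.

Lemma Rop_bound N f v : 0 <= N -> weight_bounded beta N f ->
  w v * `|Rop gamma b delta rho f v| <= A * (1 + N) ^+ 2 * N.
Proof.
move=> N0 hf; have h0 := weight_bounded0 N0.
have R0 : Rop gamma b delta rho (fun _ => 0) v = 0.
  rewrite (Rop_cint v N0 h0) (_ : QF _ v = fun z => 0 * QF (fun _ => 0) v z).
    by rewrite (cintZ gammaP bP _ _ (dominated_QF v N0 h0)) mul0r mulr0.
  by apply/funext => z; rewrite QF0 mulr0.
have := @Rop_lip N N f (fun _ => 0) v N0 N0 hf h0.
by rewrite R0 subr0; apply=> x; rewrite subr0; case: hf.
Qed.

(** Since W and q are at least 1, the constants of the other estimates are absorbed in A. *)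
Let A_ge k i j : 0 <= k <= 16 -> (i <= 2)%N -> (j <= 4)%N -> k * J * W ^+ i * q ^+ j <= A.
Proof.
move=> /andP[k0 k1] i2 j4; have W0 : 0 <= W by exact: le_trans W1.
apply: ler_pM; rewrite ?mulr_ge0 ?exprn_ge0//; last exact: ler_weXn2l.
apply: ler_pM; rewrite ?mulr_ge0 ?exprn_ge0//; last exact: ler_weXn2l.
exact: ler_pM.
Qed.

Lemma nu_bounds v : 0 <= nu gamma b delta rho v <= A.
Proof.
have dn := dominated_nu v; apply/andP; split.
  have d0 := dominatedZ 0 dn; rewrite nu_cint.
  have := le_cint gammaP bP v d0 dn; rewrite (cintZ gammaP bP _ _ dn) mul0r.
  by apply=> z; rewrite mul0r nuint_ge0.
rewrite nu_cint; apply: (le_trans (ler_norm _)); apply: (le_trans (JP v dn)).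
rewrite [leLHS](_ : _ = 4 * J * W ^+ 0 * q ^+ 2); last by ring.
by apply: A_ge => //; apply/andP; split; lra.
Qed.

Lemma Kop_bound N f v : 0 <= N -> weight_bounded beta N f ->
  w v * `|Kop gamma b delta rho f v| <= A * N.
Proof.
move=> N0 hf; have wp : 0 < w v by exact: lt_le_trans (w1 v).
rewrite Kop_cint; apply: (le_trans (ler_wpM2l (w0 v) (JP v (dominated_K v N0 hf)))).
rewrite [leLHS](_ : _ = 12 * J * W ^+ 1 * q ^+ 4 * N); last by field; rewrite gt_eqF.
by rewrite ler_wpM2r//; apply: A_ge => //; apply/andP; split; lra.
Qed.

(* With F = mu + s f: the loss term is at most F(v) times the integral of F(u),
   and [delta] times the gain term at most [1 - delta F(v)] times an integral. *)
Lemma Rop_positivity N f v : 0 <= N -> weight_bounded beta N f ->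
  (forall x, 0 <= m x + s x * f x) -> (forall x, delta * (m x + s x * f x) <= 1) ->
  - (A * (1 + N) ^+ 2 * (m v + s v * f v)) <= s v * Rop gamma b delta rho f v /\
  delta * (s v * Rop gamma b delta rho f v) <= A * (1 + N) ^+ 2 * (1 - delta * (m v + s v * f v)).
Proof.
move=> N0 hf F0 F1; have [mf hfv] := hf; have dQ := dominated_QF v N0 hf.
have d0 : 0 <= delta by case/andP: deltaP.
have -> : s v * Rop gamma b delta rho f v = cint gamma b v (QF f v).
  by rewrite (Rop_cint v N0 hf) mulrA divff ?mul1r// gt_eqF.
have kb x := kfac_bound N0 (hfv x); have H1 := HN1 N0.
have kb' x : `|kfac f x| <= H N by exact: norm_weight1 (w1 x) (kb x).
pose G (z : R3 R * R2 R) := gauss z.1.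
have dG : dominated 1 G.
  by split=> [|z]; [apply: measurable_gauss|rewrite mul1r ger0_norm// ltW// gauss_gt0].
have dGk k := dominatedZ k dG.
have Fu x : Fp f x <= H N ^+ 2 * gauss x.
  rewrite FpE mulrC ler_wpM2r//; first by rewrite ltW// gauss_gt0.
  apply: (le_trans (ler_norm _)); apply: (le_trans (kb' x)).
  by rewrite expr2 ler_peMr// (le_trans _ H1).
(* Conservation of energy gives decay in u: g(v') g(u') = g(v) g(u) <= g(u). *)
have Fcd z : Fp f (V' v z) * Fp f (U' v z) <= H N ^+ 2 * gauss z.1.
  rewrite !FpE mulrACA -gauss_cd mulrC.
  have e1 : kfac f (V' v z) * kfac f (U' v z) <= H N ^+ 2.
    by apply: (le_trans (ler_norm _)); rewrite normrM expr2 ler_pM.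
  have [g0 g1] := andP (gaussP v); have [h0 h1] := andP (gaussP z.1).
  apply: (le_trans (ler_wpM2r (mulr_ge0 g0 h0) e1)).
  by rewrite ler_wpM2l ?sqr_ge0// ler_piMl.
have cG : H N ^+ 2 * cint gamma b v G <= A * (1 + N) ^+ 2.
  apply: (@le_trans _ _ (H N ^+ 2 * J)).
    rewrite ler_wpM2l ?sqr_ge0//; apply: (le_trans (ler_norm _)).
    by have := JP v dG; rewrite mulr1.
  rewrite [leLHS](_ : _ = (1 * J * W ^+ 2 * q ^+ 2) * (1 + N) ^+ 2); last by rewrite /H; ring.
  by rewrite ler_wpM2r ?sqr_ge0//; apply: A_ge => //; apply/andP; split; lra.
split.
- have := le_cint gammaP bP v (dGk (- (Fp f v * H N ^+ 2))) dQ.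
  rewrite (cintZ gammaP bP _ _ dG) => h.
  apply: le_trans (h _) => [|z].
    rewrite mulNr lerN2 -(mulrA (Fp f v)) [leRHS]mulrC.
    by apply: ler_wpM2l cG; exact: F0.
  apply: le_trans (collision_density_lower (F0 _) (F0 _) (F0 _) (F0 _) d0 (F1 _) (F1 _) (F1 _) (F1 _)).
  by rewrite mulNr lerN2 -(mulrA (Fp f v)); apply: ler_wpM2l; [exact: F0|exact: Fu].
- have := le_cint gammaP bP v (dominatedZ delta dQ) (dGk ((1 - delta * Fp f v) * H N ^+ 2)).
  rewrite !(cintZ gammaP bP _ _ dG) (cintZ gammaP bP _ _ dQ) => h.
  apply: (le_trans (h _)) => [z|].
    apply: (le_trans (collision_density_upper (F0 _) (F0 _) (F0 _) (F0 _) deltaP (F1 _) (F1 _) (F1 _) (F1 _))).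
    rewrite -(mulrA (1 - _)); apply: ler_wpM2l; last exact: Fcd.
    by rewrite subr_ge0; exact: F1.
  rewrite -(mulrA (1 - _)) [leRHS]mulrC; apply: ler_wpM2l cG.
  by rewrite subr_ge0; exact: F1.
Qed.
End with_cint_bound.
End operators.

(** * Damped time integrals and the change of damping rate *)

Section time_integrals.
Context {R : realType}.
Implicit Types (p : R -> R) (t B : R).

Local Notation leb := (@lebesgue_measure R).

Lemma lebesgue_itv_lty (a t : R) : (leb `[a, t] < +oo)%E.
Proof. by rewrite lebesgue_measure_itv/=; case: ifP => _; rewrite ?ltry// -EFinD ltry. Qed.

Lemma integrable_bounded_itv p B a t : measurable_fun setT p ->
  (forall s, a <= s <= t -> `|p s| <= B) -> leb.-integrable `[a, t] (EFin \o p).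
Proof.
move=> mp pB; apply: measurable_bounded_integrable => //.
- exact: lebesgue_itv_lty.
- exact: measurable_funTS.
- exists B; split; first exact: num_real.
  by move=> x Bx s /=; rewrite in_itv/= => /pB h; apply: (le_trans h); exact: ltW.
Qed.

Lemma integrable_indic_lty d (T : measurableType d) (m : {measure set T -> \bar R}) (A : set T) :
  measurable A -> (m A < +oo)%E -> m.-integrable setT (fun x => (\1_A x)%:E).
Proof.
move=> mA Aoo; apply/integrableP; split; first by apply/measurable_EFinP; exact: measurable_indic.
under eq_integral do rewrite abse_EFin ger0_norm//.
by rewrite integral_indic// setIT.
Qed.

Lemma Rintegral_exp (c d a t : R) : a <= t ->
  \int[leb]_(s in `[a, t]) (c * expR (c * s + d)) = expR (c * t + d) - expR (c * a + d).
Proof.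
move=> at_.
pose F (x : R) := expR (c * x + d).
have dF (x : R) : is_derive x 1 F (c * expR (c * x + d)).
  have d1 : is_derive x 1 (fun u : R => c * u + d) c.
    by apply: is_derive_eq; rewrite /GRing.scale/= ?addr0 ?mulr1 ?mul0r ?addr0.
  have d2 := is_derive1_comp (f := @expR R) (g := fun u : R => c * u + d) (is_derive_expR _) d1.
  by apply: is_derive_eq; rewrite mulrC.
rewrite /Rintegral (integral_FTC2 (F := F))// => x _.
apply: continuousM; first exact: cvg_cst.
apply: (@continuous_comp _ _ _ (fun u : R => c * u + d) (@expR R)); last exact: continuous_expR.
apply: continuousD; last exact: cvg_cst.
by apply: continuousM; [exact: cvg_cst|exact: cvg_id].
Qed.

Lemma measurable_expR_affine (c d : R) : measurable_fun setT (fun s : R => expR (c * s + d)).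
Proof.
by apply: measurableT_comp => //; apply: measurable_funD => //; apply: measurable_funM.
Qed.

Lemma Rintegral_Fubini_box (k : R * R -> R) (B t : R) : 0 <= B ->
  measurable_fun setT (k : measurableTypeR R * measurableTypeR R -> R) ->
  (forall s r, `|k (s, r)| <= B) -> (forall s r, ~~ ((0 <= s <= t) && (0 <= r <= t)) -> k (s, r) = 0) ->
  \int[leb]_s (\int[leb]_r k (s, r)) = \int[leb]_r (\int[leb]_s k (s, r)).
Proof.
move=> B0 mk kB k0.
pose I : set (measurableTypeR R) := `[0, t]%classic; pose X := I `*` I.
have mI : measurable I by exact: measurable_itv.
have mX : measurable X by exact: measurableX.
have leb_I : (leb I < +oo)%E.
  exact: lebesgue_itv_lty.
have lebX : ((leb \x leb)%E X < +oo)%E.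
  have -> : ((leb \x leb)%E X = leb I * leb I)%E by exact: product_measure1E.
  by rewrite lte_mul_pinfty// ge0_fin_numE.
have ik : (leb \x leb)%E.-integrable setT (EFin \o k).
  apply: (le_integrable measurableT (g := fun z => (B%:E * (\1_X z)%:E)%E)) => //.
  - by apply/measurable_EFinP.
  - move=> [s r] _ /=; rewrite lee_fin indicE.
    have [h|h] := boolP ((0 <= s <= t) && (0 <= r <= t)); last by rewrite k0// normr0.
    have Xsr : X (s, r) by move: h => /andP[? ?]; split; rewrite /I/= in_itv.
    by rewrite (mem_set Xsr)/= mulr1 (ger0_norm B0).
  - by apply: integrableZl => //; exact: integrable_indic_lty.
have i1 s : leb.-integrable setT (fun r => (k (s, r))%:E).
  apply: (le_integrable measurableT (g := fun r => (B%:E * (\1_I r)%:E)%E)) => //.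
  - apply/measurable_EFinP; exact: (measurableT_comp mk (pair1_measurable s)).
  - move=> r _ /=; rewrite lee_fin indicE.
    have [h|h] := boolP ((0 <= s <= t) && (0 <= r <= t)); last by rewrite k0// normr0.
    have Ix : I r by move: h => /andP[? ?]; rewrite /I/= in_itv.
    by rewrite (mem_set Ix)/= mulr1 (ger0_norm B0).
  - by apply: integrableZl => //; exact: integrable_indic_lty.
have i2 r : leb.-integrable setT (fun s => (k (s, r))%:E).
  apply: (le_integrable measurableT (g := fun s => (B%:E * (\1_I s)%:E)%E)) => //.
  - apply/measurable_EFinP; exact: (measurableT_comp mk (pair2_measurable r)).
  - move=> s _ /=; rewrite lee_fin indicE.
    have [h|h] := boolP ((0 <= s <= t) && (0 <= r <= t)); last by rewrite k0// normr0.
    have Ix : I s by move: h => /andP[? ?]; rewrite /I/= in_itv.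
    by rewrite (mem_set Ix)/= mulr1 (ger0_norm B0).
  - by apply: integrableZl => //; exact: integrable_indic_lty.
rewrite /Rintegral; congr fine.
transitivity (\int[leb]_s fubini_F leb (EFin \o k) s)%E.
  by apply: eq_integral => s _; rewrite /fubini_F/= fineK//; apply: integrable_fin_num.
rewrite integral12_prod_meas1// -integral21_prod_meas1//.
by apply: eq_integral => r _; rewrite /fubini_G/= fineK//; apply: integrable_fin_num.
Qed.

Lemma Rintegral_if p a t :
  \int[leb]_(s in `[a, t]) p s = \int[leb]_s (if a <= s <= t then p s else 0).
Proof.
rewrite Rintegral_mkcond; apply: eq_Rintegral => s _.
by rewrite patchE mem_setE in_itv.
Qed.

(* Variation of constants: exchanging the order of integration over the
   triangle 0 <= r <= s <= t changes the damping rate from L to a. *)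
Lemma duhamel_change_rate (L a y0 B t : R) (p y : R -> R) : 0 <= L -> 0 <= a -> 0 <= t ->
  measurable_fun setT p -> (forall s, `|p s| <= B) ->
  (forall s, 0 <= s <= t ->
    y s = expR (- L * s) * y0 + \int[leb]_(r in `[0, s]) (expR (- L * (s - r)) * p r)) ->
  measurable_fun setT y -> (forall s, `|y s| <= B) ->
  y t = expR (- a * t) * y0
    + \int[leb]_(s in `[0, t]) (expR (- a * (t - s)) * (p s - (L - a) * y s)).
Proof.
move=> L0 a0 t0 mp pB yE my yB.
have B0 : 0 <= B := le_trans (normr_ge0 _) (pB 0).
have mexp (c d : R) : measurable_fun setT (fun s : R => expR (c * (d - s))).
  have -> : (fun s : R => expR (c * (d - s))) = (fun s => expR (- c * s + c * d)).
    by apply/funext => s; congr expR; ring.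
  exact: measurable_expR_affine.
have e1 (c x : R) : 0 <= c -> 0 <= x -> 0 <= expR (- c * x) <= 1.
  by move=> c0 x0; rewrite expR_ge0 -[X in _ <= X]expR0 ler_expR mulNr oppr_le0 mulr_ge0.
(* The kernel is extended by 0 off the triangle, so that both iterated integrals run over the whole
   line. *)
pose k (z : R * R) : R := if (0 <= z.2 <= z.1) && (z.1 <= t) then
  expR (- a * (t - z.1)) * (expR (- L * (z.1 - z.2)) * p z.2) else 0.
have mk : measurable_fun setT (k : measurableTypeR R * measurableTypeR R -> R).
  have m1 : measurable_fun setT (fst : measurableTypeR R * measurableTypeR R -> R).
    exact: measurable_fst.
  have m2 : measurable_fun setT (snd : measurableTypeR R * measurableTypeR R -> R).
    exact: measurable_snd.
  apply: measurable_fun_ifT => //.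
    apply: measurable_and; last exact: measurable_fun_ler.
    by apply: measurable_and; exact: measurable_fun_ler.
  apply: measurable_funM; first exact: (measurableT_comp (mexp (- a) t) m1).
  apply: measurable_funM; last exact: (measurableT_comp mp m2).
  apply: measurableT_comp => //; apply: measurable_funM => //; exact: measurable_funB.
have kB s r : `|k (s, r)| <= B.
  rewrite /k/=; case: ifP => [/andP[/andP[r0 rs] st]|_]; last by rewrite normr0.
  have /andP[x0 x1] := e1 a (t - s) a0 (etrans (subr_ge0 _ _) st).
  have /andP[z0 z1] := e1 L (s - r) L0 (etrans (subr_ge0 _ _) rs).
  rewrite !normrM (ger0_norm x0) (ger0_norm z0) -[leRHS]mul1r ler_pM ?mulr_ge0//.
  by rewrite -[leRHS]mul1r ler_pM.
have k0 s r : ~~ ((0 <= s <= t) && (0 <= r <= t)) -> k (s, r) = 0.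
  move=> h; rewrite /k/=; case: ifP => // /andP[/andP[r0 rs] st]; move: h.
  by rewrite (le_trans r0 rs) st r0 (le_trans rs st).
have FB := Rintegral_Fubini_box B0 mk kB k0.
have aE (c x : R) : 0 <= c -> x <= t -> 0 <= expR (- c * (t - x)) <= 1.
  by move=> c0 xt; apply: e1; rewrite ?subr_ge0.
have inner1 s : \int[leb]_r k (s, r) = if 0 <= s <= t then
    expR (- a * (t - s)) * (y s - expR (- L * s) * y0) else 0.
  case: ifPn => [/andP[s0 st]|h]; last first.
    rewrite -[RHS](mul0r (fine (leb setT))) -Rintegral_cst//; apply: eq_Rintegral => r _.
    by rewrite k0//; apply: contra h => /andP[].
  rewrite yE ?s0// (addrC (_ * y0)) addrK -RintegralZl//; last first.
    apply: (@integrable_bounded_itv _ (1 * B)).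
      by apply: measurable_funM => //; exact: mexp.
    move=> r /andP[r0 rs]; apply: ler_normM2 => //.
    by have /andP[? ?] := e1 L (s - r) L0 (etrans (subr_ge0 _ _) rs); rewrite ger0_norm.
  by rewrite Rintegral_if; apply: eq_Rintegral => r _; rewrite /k/= st andbT; case: ifP.
(* The factor L - a is kept on the left: this form also makes sense when the two rates agree. *)
have inner2 r : (L - a) * \int[leb]_s k (s, r) = if 0 <= r <= t then
    (expR (- a * (t - r)) - expR (- L * (t - r))) * p r else 0.
  case: ifPn => [/andP[r0 rt]|h]; last first.
    rewrite -[RHS](mulr0 (L - a)); congr (_ * _).
    rewrite -[RHS](mul0r (fine (leb setT))) -Rintegral_cst//; apply: eq_Rintegral => s _.
    by rewrite k0//; apply: contra h => /andP[].
  have := Rintegral_exp (a - L) (L * r - a * t) rt.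
  have -> : (a - L) * t + (L * r - a * t) = - L * (t - r) by ring.
  have -> : (a - L) * r + (L * r - a * t) = - a * (t - r) by ring.
  move=> E; rewrite -(opprB (expR (- L * (t - r)))) -E mulNr -mulrN.
  rewrite -RintegralZr//; last first.
    apply: (@integrable_bounded_itv _ (`|a - L| * 1)).
      by apply: (measurable_funM (f := cst (a - L))) => //; exact: measurable_expR_affine.
    move=> s /andP[rs st]; apply: ler_normM2 => //.
    have -> : (a - L) * s + (L * r - a * t) = - a * (t - s) + - L * (s - r) by ring.
    have /andP[? ?] := aE a s a0 st.
    have /andP[? ?] := e1 L (s - r) L0 (etrans (subr_ge0 _ _) rs).
    by rewrite expRD ger0_norm ?mulr_ge0// mulr_ile1.
  rewrite (_ : \int[leb]_s k (s, r) = \int[leb]_(s in `[r, t])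
    (expR (- a * (t - s)) * (expR (- L * (s - r)) * p r))); last first.
    by rewrite Rintegral_if; apply: eq_Rintegral => s _; rewrite /k/= r0.
  rewrite -RintegralZl//; last first.
    apply: (@integrable_bounded_itv _ (1 * (1 * B))).
      apply: measurable_funM; first exact: mexp.
      apply: measurable_funM => //.
      have -> : (fun s : R => expR (- L * (s - r))) = (fun s => expR (- L * s + L * r)).
        by apply/funext => s; congr expR; ring.
      exact: measurable_expR_affine.
    move=> s /andP[rs st]; apply: ler_normM2.
      by have /andP[? ?] := aE a s a0 st; rewrite ger0_norm.
    apply: ler_normM2 => //.
    by have /andP[? ?] := e1 L (s - r) L0 (etrans (subr_ge0 _ _) rs); rewrite ger0_norm.
  apply: eq_Rintegral => s _.
  have -> : (a - L) * s + (L * r - a * t) = - a * (t - s) + - L * (s - r) by ring.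
  by rewrite expRD; ring.
pose ea s := expR (- a * (t - s)); pose eL s := expR (- L * (t - s)).
have mea : measurable_fun setT ea by exact: mexp.
have meL : measurable_fun setT eL by exact: mexp.
have ieP (g : R -> R) (c : R) : 0 <= c -> measurable_fun setT g -> (forall s, 0 <= s <= t -> `|g s| <= B) ->
    leb.-integrable `[0, t] (EFin \o (fun s => expR (- c * (t - s)) * g s)).
  move=> c0 mg gB; apply: (@integrable_bounded_itv _ (1 * B)).
    by apply: measurable_funM => //; exact: mexp.
  move=> s st; apply: ler_normM2; last exact: gB.
  by case/andP: st => _ st; have /andP[? ?] := aE c s c0 st; rewrite ger0_norm.
have iap := ieP p a a0 mp (fun s _ => pB s); have iLp := ieP p L L0 mp (fun s _ => pB s).
have iay := ieP y a a0 my (fun s _ => yB s).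
pose I1 := \int[leb]_(s in `[0, t]) (ea s * p s).
pose P := \int[leb]_(s in `[0, t]) (eL s * p s).
pose Y := \int[leb]_(s in `[0, t]) (ea s * y s).
pose E := \int[leb]_(s in `[0, t]) (ea s * expR (- L * s)).
have iE : leb.-integrable `[0, t] (EFin \o (fun s => ea s * expR (- L * s))).
  apply: (@integrable_bounded_itv _ (1 * 1)).
    apply: measurable_funM => //.
    have -> : (fun s : R => expR (- L * s)) = (fun s => expR (- L * s + 0)).
      by apply/funext => s; rewrite addr0.
    exact: measurable_expR_affine.
  move=> s /andP[s0 st]; apply: ler_normM2.
    by have /andP[? ?] := aE a s a0 st; rewrite ger0_norm.
  by have /andP[? ?] := e1 L s L0 s0; rewrite ger0_norm.
have LE : (L - a) * E = expR (- a * t) - expR (- L * t).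
  have := Rintegral_exp (a - L) (- a * t) t0.
  have -> : (a - L) * t + - a * t = - L * t by ring.
  rewrite mulr0 add0r => EE; rewrite -(opprB (expR (- L * t))) -EE /E.
  rewrite -RintegralZl// -[RHS]mulN1r -RintegralZl//; last first.
    apply: (@integrable_bounded_itv _ (`|a - L| * 1)).
      by apply: (measurable_funM (f := cst (a - L))) => //; exact: measurable_expR_affine.
    move=> s /andP[s0 st]; apply: ler_normM2 => //.
    have -> : (a - L) * s + - a * t = - a * (t - s) + - L * s by ring.
    have /andP[? ?] := aE a s a0 st; have /andP[? ?] := e1 L s L0 s0.
    by rewrite expRD ger0_norm ?mulr_ge0// mulr_ile1.
  apply: eq_Rintegral => s _; rewrite /ea.
  have -> : (a - L) * s + - a * t = - a * (t - s) + - L * s by ring.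
  by rewrite expRD; ring.
have mI : measurable (`[0, t]%classic : set (measurableTypeR R)) by exact: measurable_itv.
have iEy : leb.-integrable `[0, t] (EFin \o (fun s => ea s * expR (- L * s) * y0)).
  exact: (integrableZr mI y0 iE).
have iLy : leb.-integrable `[0, t] (EFin \o (fun s => (L - a) * (ea s * y s))).
  exact: (integrableZl mI (L - a) iay).
have FL : \int[leb]_s (\int[leb]_r k (s, r)) = Y - E * y0.
  rewrite /Y /E -(RintegralZr _ mI iE) -(RintegralB mI iay iEy).
  rewrite Rintegral_if; apply: eq_Rintegral => s _; rewrite inner1; case: ifP => // _.
  by rewrite /ea; ring.
have FR : (L - a) * \int[leb]_r (\int[leb]_s k (s, r)) = I1 - P.
  (* For equal rates both sides vanish, and only otherwise is a division by L - a performed. *)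
  have [La|La] := eqVneq (L - a) 0.
    have {}La : L = a by apply/eqP; rewrite -subr_eq0 La.
    by rewrite La subrr mul0r /I1 /P /ea /eL La subrr.
  have -> : \int[leb]_r (\int[leb]_s k (s, r)) =
      \int[leb]_(r in `[0, t]) ((L - a)^-1 * (ea r * p r - eL r * p r)).
    rewrite Rintegral_if; apply: eq_Rintegral => r _; apply: (mulfI La); rewrite inner2.
    by case: ifP => _; rewrite ?mulr0// mulrA divff// mul1r mulrBl.
  rewrite (RintegralZl _ mI (integrableB mI iap iLp)).
  by rewrite mulrA divff// mul1r (RintegralB mI iap iLp).
have RY : \int[leb]_(s in `[0, t]) (ea s * (p s - (L - a) * y s)) = I1 - (L - a) * Y.
  rewrite /I1 /Y -(RintegralZl _ mI iay) -(RintegralB mI iap iLy).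
  by apply: eq_Rintegral => s _; rewrite /ea; ring.
have -> : y t = expR (- L * t) * y0 + P by rewrite yE ?t0 ?lexx.
transitivity (expR (- a * t) * y0 + (I1 - (L - a) * Y)); last by rewrite -RY.
have : (L - a) * (Y - E * y0) = I1 - P by rewrite -FL FB FR.
rewrite mulrBr (mulrA _ E) LE => h.
have -> : (L - a) * Y = I1 - P + (expR (- a * t) - expR (- L * t)) * y0 by rewrite -h; ring.
by ring.
Qed.
End time_integrals.

Section damped_integrals.
Context {R : realType}.
Implicit Types (p : R -> R) (t B c k : R).
Local Notation leb := (@lebesgue_measure R).

Let mI t : measurable (`[0, t]%classic : set (measurableTypeR R)).
Proof. exact: measurable_itv. Qed.

Lemma measurable_damping c t : measurable_fun setT (fun s : R => expR (- c * (t - s))).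
Proof.
have -> : (fun s : R => expR (- c * (t - s))) = (fun s => expR (c * s + - c * t)).
  by apply/funext => s; congr expR; ring.
exact: measurable_expR_affine.
Qed.

Lemma damping_itv c t s : 0 <= c -> s <= t -> 0 <= expR (- c * (t - s)) <= 1.
Proof.
by move=> c0 st; rewrite expR_ge0 -[X in _ <= X]expR0 ler_expR mulNr oppr_le0 mulr_ge0// subr_ge0.
Qed.

Lemma integrable_damped p B c t : 0 <= c -> measurable_fun setT p ->
  (forall s, 0 <= s <= t -> `|p s| <= B) ->
  leb.-integrable `[0, t] (EFin \o (fun s => expR (- c * (t - s)) * p s)).
Proof.
move=> c0 mp pB; apply: (@integrable_bounded_itv _ _ (1 * B)).
  by apply: measurable_funM => //; exact: measurable_damping.
move=> s st; apply: ler_normM2; last exact: pB.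
by case/andP: st => _ st; have /andP[? ?] := damping_itv c0 st; rewrite ger0_norm.
Qed.

(** Writing the constant source as k c avoids dividing by the rate, and c = 0 is included. *)
Lemma Rintegral_damping k c t : 0 <= t ->
  \int[leb]_(s in `[0, t]) (expR (- c * (t - s)) * (k * c)) = k * (1 - expR (- c * t)).
Proof.
move=> t0; have E := Rintegral_exp c (- c * t) t0.
have e1 : c * t + - c * t = 0 by ring.
rewrite e1 mulr0 add0r expR0 in E; rewrite -E -RintegralZl//; last first.
  apply: (@integrable_bounded_itv _ _ (`|c| * expR (`|c| * t))).
    by apply: (measurable_funM (f := cst c)) => //; exact: measurable_expR_affine.
  move=> s /andP[s0 st]; apply: ler_normM2 => //.
  rewrite ger0_norm ?expR_ge0// ler_expR.
  have -> : c * s + - c * t = - c * (t - s) by ring.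
  apply: (@le_trans _ _ (`|c| * (t - s))); last by rewrite ler_wpM2l// gerBl.
  by apply: (le_trans (ler_norm _)); rewrite normrM normrN ler_wpM2l// ger0_norm// subr_ge0.
apply: eq_Rintegral => s _.
have -> : c * s + - c * t = - c * (t - s) by ring.
by ring.
Qed.

Lemma damped_le p B k c t : 0 <= c -> 0 <= t -> measurable_fun setT p ->
  (forall s, 0 <= s <= t -> `|p s| <= B) -> (forall s, 0 <= s <= t -> p s <= k * c) ->
  \int[leb]_(s in `[0, t]) (expR (- c * (t - s)) * p s) <= k * (1 - expR (- c * t)).
Proof.
move=> c0 t0 mp pB pk; rewrite -Rintegral_damping//; apply: le_Rintegral (mI t) _ _ _.
- exact: integrable_damped pB.
- by apply: (@integrable_damped _ `|k * c|).
- move=> s; rewrite /= in_itv/= => st; apply: ler_wpM2l; last exact: pk.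
  exact: expR_ge0.
Qed.

Lemma damped_ge p B k c t : 0 <= c -> 0 <= t -> measurable_fun setT p ->
  (forall s, 0 <= s <= t -> `|p s| <= B) -> (forall s, 0 <= s <= t -> k * c <= p s) ->
  k * (1 - expR (- c * t)) <= \int[leb]_(s in `[0, t]) (expR (- c * (t - s)) * p s).
Proof.
move=> c0 t0 mp pB pk; rewrite -Rintegral_damping//; apply: le_Rintegral (mI t) _ _ _.
- by apply: (@integrable_damped _ `|k * c|).
- exact: integrable_damped pB.
- move=> s; rewrite /= in_itv/= => st; apply: ler_wpM2l; last exact: pk.
  exact: expR_ge0.
Qed.

Lemma damped_norm_le p (q : R -> R) B c t : 0 <= c -> 0 <= t -> measurable_fun setT p ->
  measurable_fun setT q -> (forall s, 0 <= s <= t -> `|q s| <= B) ->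
  (forall s, 0 <= s <= t -> `|p s| <= q s) ->
  `|\int[leb]_(s in `[0, t]) (expR (- c * (t - s)) * p s)| <= \int[leb]_(s in `[0, t]) q s.
Proof.
move=> c0 t0 mp mq qB pq.
have pB s : 0 <= s <= t -> `|p s| <= B.
  by move=> st; apply: (le_trans (pq s st)); apply: (le_trans (ler_norm _)); exact: qB.
have ip := integrable_damped c0 mp pB.
apply: (le_trans (le_normr_Rintegral (mI t) ip)); apply: le_Rintegral (mI t) _ _ _.
- exact: (integrable_norm ip).
- exact: integrable_bounded_itv qB.
- move=> s; rewrite /= in_itv/= => st; rewrite normrM.
  have /andP[e0 e1] : 0 <= expR (- c * (t - s)) <= 1.
    by apply: damping_itv => //; case/andP: st.
  by rewrite (ger0_norm e0) -[leRHS]mul1r ler_pM// pq.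
Qed.

Lemma Rintegral_itv_cst k t : 0 <= t -> \int[leb]_(s in `[0, t]) k = k * t.
Proof.
move=> t0; have E : leb `[0, t] = t%:E.
  rewrite lebesgue_measure_itv/= lte_fin; move: t0; rewrite le_eqVlt.
  by move=> /predU1P[<-|t0]; rewrite ?ltxx// t0 -EFinD subr0.
by rewrite (Rintegral_cst _ (mI t)); congr (_ * _); exact: (congr1 fine E).
Qed.

Lemma damped_norm_le_cst p B c t : 0 <= c -> 0 <= t -> measurable_fun setT p ->
  (forall s, 0 <= s <= t -> `|p s| <= B) ->
  `|\int[leb]_(s in `[0, t]) (expR (- c * (t - s)) * p s)| <= B * t.
Proof.
move=> c0 t0 mp pB; rewrite -Rintegral_itv_cst//.
by apply: (damped_norm_le (q := cst B) (B := `|B|)).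
Qed.
End damped_integrals.

(** * Limits, functions on phase space and characteristics *)

(** With e_n = 2 C 2^-n, the sequence u - e is nondecreasing and u + e nonincreasing. Monotone
    convergence gives the limit, and the two sequences enclose it, which is the tail estimate. *)
Lemma geometric_cauchy_cvg (R : realType) (u : nat -> R) (C : R) :
  (forall n, `|u n.+1 - u n| <= C * 2^-1 ^+ n) ->
  cvgn u /\ forall n, `|limn u - u n| <= 2 * C * 2^-1 ^+ n.
Proof.
move=> uC; pose e n : R := 2 * C * 2^-1 ^+ n.
have eS n : e n.+1 = e n - C * 2^-1 ^+ n by rewrite /e exprS; field.
have e0 : e n @[n --> \oo] --> 0.
  by apply: (@cvg_geometric R (2 * C) 2^-1); rewrite ger0_norm; lra.
have nd : nondecreasing_seq (fun n => u n - e n).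
  apply/nondecreasing_seqP => n; rewrite eS.
  by have := uC n; rewrite ler_norml => /andP[? ?]; lra.
have ni : nonincreasing_seq (fun n => u n + e n).
  apply/nonincreasing_seqP => n; rewrite eS.
  by have := uC n; rewrite ler_norml => /andP[? ?]; lra.
have en n : 0 <= e n.
  have C0 : 0 <= C by have := le_trans (normr_ge0 _) (uC 0%N); rewrite expr0 mulr1.
  by rewrite /e mulr_ge0 ?mulr_ge0// exprn_ge0.
have cd : cvgn (fun n => u n - e n).
  apply: nondecreasing_is_cvgn => //; exists (u 0%N + e 0%N) => _ [n _ <-].
  apply: le_trans (ni 0%N n (leq0n _)); have := en n; lra.
have ci : cvgn (fun n => u n + e n).
  apply: nonincreasing_is_cvgn => //; exists (u 0%N - e 0%N) => _ [n _ <-].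
  apply: (le_trans (nd 0%N n (leq0n _))); have := en n; lra.
have ue : u = (fun n => (u n - e n) + e n) by apply/funext => n; rewrite subrK.
have ue' : u = (fun n => (u n + e n) - e n) by apply/funext => n; rewrite addrK.
have l1 : limn u = limn (fun n => u n - e n).
  by apply/cvg_lim => //; rewrite [X in X @ _ --> _]ue -[X in _ --> X]addr0; apply: cvgD.
have l2 : limn u = limn (fun n => u n + e n).
  by apply/cvg_lim => //; rewrite [X in X @ _ --> _]ue' -[X in _ --> X]subr0; apply: cvgB.
split; first by rewrite ue; apply: is_cvgD => //; apply/cvg_ex; exists 0.
move=> n; have := nondecreasing_cvgn_le nd cd n; have := nonincreasing_cvgn_ge ni ci n.
by rewrite -l1 -l2 -/(e n) ler_distl => ? ?; apply/andP; split; lra.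
Qed.

Notation phase_time R := (measurableTypeR R * R3 R * R3 R)%type.

(** Required for every real t, so that compositions with characteristics are measurable without
    restriction; functions known on [0, T] only are extended by the initial datum. *)
Definition space_time_bounded {R : realType} (beta K : R) (f : R -> R3 R -> R3 R -> R) : Prop :=
  measurable_fun setT (fun z : phase_time R => f z.1.1 z.1.2 z.2) /\
  forall t x v, weight beta v * `|f t x v| <= K.

Section slices.
Context {R : realType} (beta K : R) (f : R -> R3 R -> R3 R -> R).
Context (hf : space_time_bounded beta K f).

Lemma space_time_slice t x : weight_bounded beta K (f t x).
Proof.
have [mf bf] := hf; split; last by move=> v; exact: bf.
exact: (measurableT_comp mf (pair1_measurable ((t, x) : measurableTypeR R * R3 R))).
Qed.

Lemma measurable_along d (S : measurableType d) (tau : S -> R) (X V : S -> R3 R) :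
  measurable_fun setT tau -> measurable_fun setT X -> measurable_fun setT V ->
  measurable_fun setT (fun y => f (tau y) (X y) (V y)).
Proof.
move=> mt mX mV; have [mf _] := hf.
apply: (measurableT_comp mf (g := fun y => ((tau y, X y), V y) : phase_time R)).
by apply: measurable_fun_pair => //; exact: measurable_fun_pair.
Qed.

Lemma measurable_along_slice d (S : measurableType d) (tau : S -> R) (X : S -> R3 R) :
  measurable_fun setT tau -> measurable_fun setT X ->
  measurable_fun setT (fun y : S * R3 R => f (tau y.1) (X y.1) y.2).
Proof.
move=> mt mX; apply: measurable_along => //.
- exact: (measurableT_comp mt measurable_fst).
- exact: (measurableT_comp mX measurable_fst).
Qed.
End slices.

Section affine_bounds.
Context {R : realFieldType}.
Implicit Types (l m F S d X I sv h : R).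

(** These inequalities are stated for abstract reals, so that integrals and exponentials appear to
    linear arithmetic as atoms. *)
Lemma damped_gain_ge l m F S : - (l * F) <= S -> - m * l <= S + l * F - l * m.
Proof. lra. Qed.

Lemma damped_gain_le d l m F S : d * S <= l * (1 - d * F) -> d * (S + l * F - l * m) <= (1 - d * m) * l.
Proof. lra. Qed.

Lemma damped_sum_ge m X I sv h : - m * (1 - X) <= I -> 0 <= X * (m + sv * h) ->
  0 <= m + (sv * (X * h) + I).
Proof. lra. Qed.

Lemma damped_sum_le d m X I sv h : d * I <= (1 - d * m) * (1 - X) ->
  X * (d * (m + sv * h)) <= X -> d * (m + (sv * (X * h) + I)) <= 1.
Proof. lra. Qed.

End affine_bounds.

Lemma char_compose (R : realType) (x v : R3 R) (t s r : R) :
  x - (t - s) *: v - (s - r) *: v = x - (t - r) *: v.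
Proof.
by rewrite -addrA -opprD -scalerDl; congr (_ - _ *: _); ring.
Qed.

Lemma le_geometric_slack (R : realType) (a c d : R) :
  (forall k, a <= c + d * 2^-1 ^+ k) -> a <= c.
Proof.
move=> h; have dk : (fun k => c + d * 2^-1 ^+ k : R) @ \oo --> c.
  rewrite -[X in _ --> X]addr0; apply: cvgD; first exact: cvg_cst.
  by apply: (@cvg_geometric R d 2^-1); rewrite ger0_norm; lra.
by apply: (cvgr_to_ge dk); apply: nearW.
Qed.

(** * Existence by Picard iteration *)

Section evolution.
Context {R : realType} (gamma : R) (b : R -> R) (beta delta rho : R).
Context (gammaP : -3 < gamma < 0) (bP : angular_kernel b) (beta0 : 0 <= beta).
Context (deltaP : 0 <= delta <= 1) (rho0 : 0 < rho).
Context (J : R) (J0 : 0 <= J)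
  (JP : forall v P G, dominated P G -> `|cint gamma b v G| <= J * P).

Let m := mu delta rho.
Let s := sqrt_mubar delta rho.
Let w := weight beta.
Let A := 16 * (J + 1) * expR (beta ^+ 2) ^+ 2 * (2 + rho + rho^-1) ^+ 4.
Let n := nu gamma b delta rho.

Local Notation leb := (@lebesgue_measure R).

Let w1 v : 1 <= w v. Proof. exact: weight_ge1. Qed.
Let w0 v : 0 <= w v. Proof. exact: le_trans (w1 v). Qed.

Let RL := Rop_lip gammaP bP beta0 deltaP rho0 J0 JP.
Let RB := Rop_bound gammaP bP beta0 deltaP rho0 J0 JP.
Let RP := Rop_positivity gammaP bP beta0 deltaP rho0 J0 JP.
Let KB := Kop_bound beta0 deltaP rho0 J0 JP.
Let nB v : 0 <= n v <= A. Proof. exact: (nu_bounds beta gammaP bP deltaP rho0 J0 JP v). Qed.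

Let A_gt0 : 0 < A.
Proof.
have i0 : 0 < rho^-1 by rewrite invr_gt0.
rewrite /A mulr_gt0//; last by rewrite exprn_gt0//; move: rho0 i0; lra.
by rewrite mulr_gt0 ?exprn_gt0 ?expR_gt0// mulr_gt0// ltr_wpDl.
Qed.

Let s_gt0 v : 0 < s v.
Proof.
case/andP: deltaP => d0 d1; rewrite /s /sqrt_mubar sqrtr_gt0.
have E0 : 0 < expR (enorm v ^+ 2 / 2) by exact: expR_gt0.
have D0 : 0 < delta + rho * expR (enorm v ^+ 2 / 2) by rewrite ltr_wpDl// mulr_gt0.
rewrite mulr_gt0 ?invr_gt0// subr_gt0 ltr_pdivrMr// mul1r ltrDl mulr_gt0//.
Qed.

Let m_gt0 v : 0 < m v.
Proof.
case/andP: deltaP => d0 d1; rewrite invr_gt0 ltr_wpDl// mulr_gt0//; exact: expR_gt0.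
Qed.

Section along_characteristics.
Context (K : R) (f : R -> R3 R -> R3 R -> R) (K0 : 0 <= K) (hf : space_time_bounded beta K f).
Context (t : R) (x v : R3 R).

Let path (r : R) : R3 R := x - (t - r) *: v.

Let mpath : measurable_fun setT path.
Proof.
apply: measurable_R3B => //; apply: measurable_R3Z => //.
exact: (measurable_funB (f := cst t) (g := id)).
Qed.

Let mslice := measurable_along_slice hf (@measurable_id _ R setT) mpath.

Let mpv : measurable_fun setT (cst v : R -> R3 R). Proof. by []. Qed.

Lemma measurable_Kop_path : measurable_fun setT (fun r => Kop gamma b delta rho (f r (path r)) v).
Proof. exact: (measurable_Kop_comp gamma delta rho bP mpv mslice). Qed.

Lemma measurable_Gamma_path : measurable_fun setT (fun r => Gamma gamma b delta rho (f r (path r)) v).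
Proof. exact: (measurable_Gamma_comp gamma delta rho bP mpv mslice). Qed.

Lemma measurable_Rop_path : measurable_fun setT (fun r => Rop gamma b delta rho (f r (path r)) v).
Proof. exact: (measurable_Rop_comp gamma delta rho bP mpv mslice). Qed.

Lemma measurable_path : measurable_fun setT (fun r => f r (path r) v).
Proof. exact: (measurable_along hf (@measurable_id _ R setT) mpath mpv). Qed.

Let le_w (z X : R) : w v * `|z| <= X -> `|z| <= X.
Proof. exact: norm_weight1. Qed.

Lemma path_bounds r : [/\ `|f r (path r) v| <= K,
  `|Kop gamma b delta rho (f r (path r)) v| <= A * K &
  `|Rop gamma b delta rho (f r (path r)) v| <= A * (1 + K) ^+ 2 * K].
Proof.
have hs := space_time_slice hf r (path r); split.
- by apply: le_w; case: hf => _; apply.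
- by apply: le_w; exact: KB.
- by apply: le_w; exact: RB.
Qed.

(** The sum of the integrals of K f and Gamma f may be merged only if both are integrable. K f is
    bounded by its own estimate, and Gamma f as the difference of the full operator and the linear
    terms. *)
Lemma mild_integrals_merge : 0 <= t ->
  \int[leb]_(r in `[0, t]) (expR (- n v * (t - r)) * Kop gamma b delta rho (f r (path r)) v)
  + \int[leb]_(r in `[0, t]) (expR (- n v * (t - r)) * Gamma gamma b delta rho (f r (path r)) v)
  = \int[leb]_(r in `[0, t]) (expR (- n v * (t - r)) *
      (Rop gamma b delta rho (f r (path r)) v + n v * f r (path r) v)).
Proof.
move=> t0; have /andP[n0 nA] := nB v.
pose k r := Kop gamma b delta rho (f r (path r)) v.
pose G r := Gamma gamma b delta rho (f r (path r)) v.
have kB r : 0 <= r <= t -> `|k r| <= A * K by move=> _; have [_] := path_bounds r.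
have GB r : 0 <= r <= t -> `|G r| <= A * (1 + K) ^+ 2 * K + A * K + A * K.
  move=> _; have [h1 h2 h3] := path_bounds r.
  have -> : G r = Rop gamma b delta rho (f r (path r)) v
      - Kop gamma b delta rho (f r (path r)) v + n v * f r (path r) v by rewrite /G /Rop /n; ring.
  apply: ler_norm_add; first exact: ler_norm_sub.
  by apply: ler_normM2 => //; rewrite ger0_norm.
have iK := integrable_damped n0 (measurable_Kop_path : measurable_fun setT k) kB.
have iG := integrable_damped n0 (measurable_Gamma_path : measurable_fun setT G) GB.
have mI : measurable (`[0, t]%classic : set (measurableTypeR R)) by exact: measurable_itv.
rewrite -(RintegralD mI iK iG).
by apply: eq_Rintegral => r _; rewrite /k /G /Rop /n; ring.
Qed.
End along_characteristics.

Section picard.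
Context (M T : R) (f0 : R3 R -> R3 R -> R) (M0 : 0 <= M) (T0 : 0 <= T).
Context (mf0 : measurable_fun setT (fun z : R3 R * R3 R => f0 z.1 z.2)).
Context (f0M : forall x v, w v * `|f0 x v| <= M).
Context (F0_ge0 : forall x v, 0 <= m v + s v * f0 x v).
Context (F0_le1 : forall x v, delta * (m v + s v * f0 x v) <= 1).

(** The source R f + L f has Lipschitz constant 2 L on the ball of radius N, so L T <= 1/4 makes the
    iteration contract by 1/2; the same inequality bounds the integral term by N / 2 = M, and the
    sum with the initial term by 2 M. *)
Let N := 2 * M.
Let L := A * (1 + N) ^+ 2.
Context (LT : L * T <= 4^-1).

Let N0 : 0 <= N. Proof. by rewrite /N mulr_ge0. Qed.
Let L0 : 0 < L.
Proof. by rewrite /L mulr_gt0// exprn_gt0// ltr_pwDl. Qed.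

Let P (f : R3 R -> R) (v : R3 R) := Rop gamma b delta rho f v + L * f v.

(* The damping rate [L] dominates the loss rate of every F = mu + s f with f in
   the ball of radius [N], which makes this map preserve 0 <= F <= 1/delta. *)
Let Phi (f : R -> R3 R -> R3 R -> R) (t : R) (x v : R3 R) : R :=
  if 0 <= t <= T then
    expR (- L * t) * f0 (x - t *: v) v
    + \int[leb]_(r in `[0, t]) (expR (- L * (t - r)) * P (f r (x - (t - r) *: v)) v)
  else f0 x v.

(** An invariant set of the iteration. It concerns all real times, and the value f0 of [Phi] outside
    [0, T] keeps it true there. *)
Let good (f : R -> R3 R -> R3 R -> R) := space_time_bounded beta N f /\
  forall t x v, 0 <= m v + s v * f t x v /\ delta * (m v + s v * f t x v) <= 1.

Let measurable_P_path K f t x v : space_time_bounded beta K f ->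
  measurable_fun setT (fun r => P (f r (x - (t - r) *: v)) v).
Proof.
move=> hf; apply: measurable_funD; first exact: measurable_Rop_path hf _ _ _.
by apply: measurable_funM => //; exact: measurable_path hf _ _ _.
Qed.

Let P_bound f v : weight_bounded beta N f -> w v * `|P f v| <= 2 * L * N.
Proof.
move=> hf; apply: (le_trans (ler_wpM2l (w0 v) (ler_normD _ _))); rewrite mulrDr.
have h1 := RB v N0 hf.
have h2 : w v * `|L * f v| <= L * N.
  by rewrite normrM (ger0_norm (ltW L0)) mulrCA ler_wpM2l ?(ltW L0)//; case: hf.
by apply: (le_trans (lerD h1 h2)); rewrite -/L le_eqVlt; apply/orP; left; apply/eqP; ring.
Qed.

Let P_lip f g e v : 0 <= e -> weight_bounded beta N f -> weight_bounded beta N g ->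
  (forall x, w x * `|f x - g x| <= e) -> w v * `|P f v - P g v| <= 2 * L * e.
Proof.
move=> e0 hf hg fg; have h1 := RL v N0 e0 hf hg fg.
have -> : P f v - P g v = (Rop gamma b delta rho f v - Rop gamma b delta rho g v)
  + L * (f v - g v) by rewrite /P; ring.
apply: (le_trans (ler_wpM2l (w0 v) (ler_normD _ _))); rewrite mulrDr.
have h2 : w v * `|L * (f v - g v)| <= L * e.
  by rewrite normrM (ger0_norm (ltW L0)) mulrCA ler_wpM2l ?(ltW L0).
by apply: (le_trans (lerD h1 h2)); rewrite -/L le_eqVlt; apply/orP; left; apply/eqP; ring.
Qed.

Let wt_le (v : R3 R) (z X : R) : w v * `|z| <= X -> `|z| <= X / w v.
Proof. by move=> h; rewrite ler_pdivlMr ?(lt_le_trans _ (w1 v))// mulrC. Qed.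

Let wt_ge (v : R3 R) (z X : R) : `|z| <= X / w v -> w v * `|z| <= X.
Proof. by rewrite ler_pdivlMr ?(lt_le_trans _ (w1 v))// mulrC. Qed.

Let LTt t : 0 <= t <= T -> 2 * L * t <= 2^-1.
Proof.
move=> /andP[t0 tT]; have := LT; have : L * t <= L * T by rewrite ler_wpM2l// ltW.
by rewrite -mulrA; lra.
Qed.

Let measurable_Phi f : good f -> measurable_fun setT (fun z : phase_time R => Phi f z.1.1 z.1.2 z.2).
Proof.
move=> [hf _].
have mt : measurable_fun setT (fun z : phase_time R => z.1.1 : R).
  exact: (measurableT_comp measurable_fst measurable_fst).
have mx : measurable_fun setT (fun z : phase_time R => z.1.2).
  exact: (measurableT_comp measurable_snd measurable_fst).
have mv : measurable_fun setT (fun z : phase_time R => z.2) by exact: measurable_snd.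
have mf0c (X : phase_time R -> R3 R) : measurable_fun setT X -> measurable_fun setT (fun z => f0 (X z) z.2).
  move=> mX; apply: (measurableT_comp mf0 (g := fun z : phase_time R => (X z, z.2))).
  exact: measurable_fun_pair.
apply: measurable_fun_ifT.
- by apply: measurable_and; apply: measurable_fun_ler.
- apply: measurable_funD.
    apply: measurable_funM; last by apply: mf0c; apply: measurable_R3B => //; exact: measurable_R3Z.
    by apply: measurableT_comp => //; apply: measurable_funM.
  pose S : measurableType _ := (phase_time R * measurableTypeR R)%type.
  (* The upper limit of integration varies with the point, so the integrand is cut off by a
     condition and integrated over the whole line. *)
  pose h (y : S) : R := if (0 <= y.2) && (y.2 <= y.1.1.1) then
    expR (- L * (y.1.1.1 - y.2)) * P (f y.2 (y.1.1.2 - (y.1.1.1 - y.2) *: y.1.2)) y.1.2 else 0.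
  have m2 : measurable_fun setT (fun y : S => y.2 : R) by exact: measurable_snd.
  have m1t : measurable_fun setT (fun y : S => y.1.1.1 : R) by exact: (measurableT_comp mt measurable_fst).
  have m1x : measurable_fun setT (fun y : S => y.1.1.2) by exact: (measurableT_comp mx measurable_fst).
  have m1v : measurable_fun setT (fun y : S => y.1.2) by exact: (measurableT_comp mv measurable_fst).
  have mB : measurable_fun setT (fun y : S => y.1.1.1 - y.2 : R) by exact: measurable_funB.
  have mX : measurable_fun setT (fun y : S => y.1.1.2 - (y.1.1.1 - y.2) *: y.1.2).
    by apply: measurable_R3B => //; exact: measurable_R3Z.
  have mh : measurable_fun setT h.
    apply: measurable_fun_ifT => //.
      by apply: measurable_and; apply: measurable_fun_ler.
    apply: measurable_funM.
      by apply: measurableT_comp => //; apply: measurable_funM.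
    apply: measurable_funD.
      exact: (measurable_Rop_comp gamma delta rho bP m1v (measurable_along_slice hf m2 mX)).
    apply: measurable_funM => //; exact: (measurable_along hf m2 mX m1v).
  have := @measurable_Rintegral_param _ _ (phase_time R) (measurableTypeR R) R leb setT h measurableT mh.
  congr (measurable_fun setT _); apply/funext => z; rewrite Rintegral_if.
  by apply: eq_Rintegral.
- exact: mf0c.
Qed.

Let Phi_bound f t x v : good f -> w v * `|Phi f t x v| <= N.
Proof.
move=> [hf _]; rewrite /Phi; case: ifP => [tI|_]; last first.
  by apply: (le_trans (f0M x v)); rewrite /N; move: M0; lra.
have /andP[t0 tT] := tI.
apply: (le_trans (ler_wpM2l (w0 v) (ler_normD _ _))); rewrite mulrDr.
have h1 : w v * `|expR (- L * t) * f0 (x - t *: v) v| <= M.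
  apply: le_trans (f0M (x - t *: v) v); rewrite ler_wpM2l// normrM ler_piMl//.
  have := damping_itv (ltW L0) t0; rewrite subr0 => /andP[? ?]; by rewrite ger0_norm.
have mP := measurable_P_path t x v hf.
have h2 : `|\int[leb]_(r in `[0, t]) (expR (- L * (t - r)) * P (f r (x - (t - r) *: v)) v)|
    <= (2 * L * N / w v) * t.
  apply: damped_norm_le_cst => //; first exact: ltW.
  by move=> r _; apply: wt_le; apply: P_bound; exact: space_time_slice hf _ _.
have h3 : w v * (2 * L * N / w v * t) <= M.
  rewrite [leLHS](_ : _ = (2 * L * t) * N); last by field; rewrite gt_eqF// (lt_le_trans _ (w1 v)).
  by apply: (le_trans (ler_wpM2r N0 (LTt tI))); rewrite /N; lra.
apply: (le_trans (lerD h1 (le_trans (ler_wpM2l (w0 v) h2) h3))).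
by rewrite /N; lra.
Qed.

Let Phi_physical f t x v : good f ->
  0 <= m v + s v * Phi f t x v /\ delta * (m v + s v * Phi f t x v) <= 1.
Proof.
move=> [hf ff]; rewrite /Phi; case: ifP => [tI|_]; last by split.
have /andP[t0 tT] := tI; have d0 : 0 <= delta by case/andP: deltaP.
have mP := measurable_P_path t x v hf.
pose g r := s v * P (f r (x - (t - r) *: v)) v.
have mg : measurable_fun setT g by apply: measurable_funM.
have hs r := space_time_slice hf r (x - (t - r) *: v).
have Pb r : `|P (f r (x - (t - r) *: v)) v| <= 2 * L * N.
  by apply: norm_weight1 (w1 v) _; exact: P_bound.
have gB r : 0 <= r <= t -> `|g r| <= s v * (2 * L * N).
  by move=> _; rewrite normrM (ger0_norm (ltW (s_gt0 v))) ler_wpM2l// ltW.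
pose fr r := f r (x - (t - r) *: v).
have pos r : - (L * (m v + s v * fr r v)) <= s v * Rop gamma b delta rho (fr r) v /\
    delta * (s v * Rop gamma b delta rho (fr r) v) <= L * (1 - delta * (m v + s v * fr r v)).
  exact: (RP v N0 (hs r) (fun y => (ff r (x - (t - r) *: v) y).1)
    (fun y => (ff r (x - (t - r) *: v) y).2)).
(* With F = mu + s f, the source s P is s R + L F minus the constant L mu. By [pos] the first part
   is nonnegative and delta times it is at most L. The constant integrates to mu (1 - e^(-L t)),
   which leaves e^(-L t) F0 as the lower bound of the new F. *)
have gE r : g r = s v * Rop gamma b delta rho (fr r) v
    + L * (m v + s v * fr r v) - L * m v by rewrite /g /P /fr; ring.
have E : s v * \int[leb]_(r in `[0, t]) (expR (- L * (t - r)) * P (f r (x - (t - r) *: v)) v)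
    = \int[leb]_(r in `[0, t]) (expR (- L * (t - r)) * g r).
  have mI : measurable (`[0, t]%classic : set (measurableTypeR R)) by exact: measurable_itv.
  rewrite -(RintegralZl _ mI (integrable_damped (ltW L0) mP (fun r _ => Pb r))).
  by apply: eq_Rintegral => r _; rewrite /g; ring.
have lo := @damped_ge _ g _ (- m v) L t (ltW L0) t0 mg gB.
have /lo {}lo : forall r, 0 <= r <= t -> - m v * L <= g r.
  by move=> r _; rewrite gE; apply: damped_gain_ge; exact: (pos r).1.
have e01 := damping_itv (ltW L0) t0; rewrite subr0 in e01; case/andP: e01 => e0 e1.
rewrite mulrDr E; set I := \int[leb]_(r in _) _ in lo *; set X := expR (- L * t) in lo e0 e1 *.
have F0 := F0_ge0 (x - t *: v) v; have F1 := F0_le1 (x - t *: v) v.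
have F0X : 0 <= X * (m v + s v * f0 (x - t *: v) v) by exact: mulr_ge0.
split; first exact: damped_sum_ge lo F0X.
have F1X : X * (delta * (m v + s v * f0 (x - t *: v) v)) <= X by rewrite ler_piMr.
have mdg : measurable_fun setT (fun r => delta * g r) by apply: measurable_funM.
have up := @damped_le _ (fun r => delta * g r) (delta * (s v * (2 * L * N))) (1 - delta * m v) L t
  (ltW L0) t0 mdg.
have dI : \int[leb]_(r in `[0, t]) (expR (- L * (t - r)) * (delta * g r)) = delta * I.
  have mI : measurable (`[0, t]%classic : set (measurableTypeR R)) by exact: measurable_itv.
  rewrite /I -(RintegralZl _ mI (integrable_damped (ltW L0) mg gB)).
  by apply: eq_Rintegral => r _; ring.
have {}up : delta * I <= (1 - delta * m v) * (1 - X).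
  rewrite -dI; apply: up.
    by move=> r rt; rewrite normrM (ger0_norm d0) ler_wpM2l// gB.
  move=> r _; rewrite gE; apply: damped_gain_le; exact: (pos r).2.
exact: damped_sum_le up F1X.
Qed.

Let good_Phi f : good f -> good (Phi f).
Proof.
move=> gf; split; first split.
- exact: measurable_Phi.
- by move=> t x v; exact: Phi_bound.
- by move=> t x v; exact: Phi_physical.
Qed.

Let Phi_contraction f g e : 0 <= e -> good f -> good g ->
  (forall t x v, w v * `|f t x v - g t x v| <= e) ->
  forall t x v, w v * `|Phi f t x v - Phi g t x v| <= e / 2.
Proof.
move=> e0 [hf _] [hg _] fg t x v; rewrite /Phi; case: ifP => [tI|_]; last first.
  by rewrite subrr normr0 mulr0 divr_ge0.
have /andP[t0 tT] := tI.
have mPf := measurable_P_path t x v hf; have mPg := measurable_P_path t x v hg.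
have mI : measurable (`[0, t]%classic : set (measurableTypeR R)) by exact: measurable_itv.
have Pb h r : space_time_bounded beta N h -> `|P (h r (x - (t - r) *: v)) v| <= 2 * L * N.
  move=> hh; apply: norm_weight1 (w1 v) _; apply: P_bound; exact: space_time_slice hh _ _.
rewrite opprD addrACA subrr add0r.
rewrite -(RintegralB mI (integrable_damped (ltW L0) mPf (fun r _ => Pb f r hf))
  (integrable_damped (ltW L0) mPg (fun r _ => Pb g r hg))).
under eq_Rintegral do rewrite -mulrBr.
have h2 : `|\int[leb]_(r in `[0, t]) (expR (- L * (t - r)) *
    (P (f r (x - (t - r) *: v)) v - P (g r (x - (t - r) *: v)) v))| <= (2 * L * e / w v) * t.
  apply: damped_norm_le_cst => //; [exact: ltW|exact: measurable_funB|].
  move=> r _; apply: wt_le; apply: P_lip => //; exact: space_time_slice.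
apply: (le_trans (ler_wpM2l (w0 v) h2)).
rewrite [leLHS](_ : _ = (2 * L * t) * e); last by field; rewrite gt_eqF// (lt_le_trans _ (w1 v)).
by rewrite [leRHS]mulrC; exact: ler_wpM2r (LTt tI).
Qed.
Let iterate k := iter k Phi (fun _ => f0).

Let good_iterate k : good (iterate k).
Proof.
elim: k => [|k IH]; last exact: good_Phi.
split; first split.
- apply: (measurableT_comp mf0 (g := fun z : phase_time R => (z.1.2, z.2))).
  apply: measurable_fun_pair; last exact: measurable_snd.
  exact: (measurableT_comp measurable_snd measurable_fst).
- by move=> t x v; apply: (le_trans (f0M x v)); rewrite /N; move: M0; lra.
- by move=> t x v; split.
Qed.

Let C := 2 * N.

Let C0 : 0 <= C. Proof. by rewrite /C mulr_ge0. Qed.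

Let iterate_step k t x v :
  w v * `|iterate k.+1 t x v - iterate k t x v| <= C * 2^-1 ^+ k.
Proof.
elim: k t x v => [|k IH] t x v.
  have [[_ b1] _] := good_iterate 1; have [[_ b0] _] := good_iterate 0.
  rewrite expr0 mulr1 /C mulr_natl mulr2n.
  apply: (le_trans (ler_wpM2l (w0 v) (ler_normB _ _))); rewrite mulrDr.
  exact: lerD (b1 t x v) (b0 t x v).
have e0 : 0 <= C * 2^-1 ^+ k by rewrite mulr_ge0// exprn_ge0.
have := Phi_contraction e0 (good_iterate k.+1) (good_iterate k) IH t x v.
by rewrite exprSr mulrA.
Qed.

Let wp v : 0 < w v. Proof. exact: lt_le_trans (w1 v). Qed.

Let iterate_cvgP t x v : cvgn (fun k => iterate k t x v) /\
  forall k, w v * `|limn (fun k => iterate k t x v) - iterate k t x v| <= 2 * C * 2^-1 ^+ k.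
Proof.
have [|cv tail] := @geometric_cauchy_cvg R (fun k => iterate k t x v) (C / w v).
  by move=> k; have := wt_le (iterate_step k t x v); rewrite mulrAC.
split=> // k; apply: wt_ge; apply: (le_trans (tail k)).
by rewrite le_eqVlt; apply/orP; left; apply/eqP; field; rewrite gt_eqF.
Qed.

Let sol t x v := limn (fun k => iterate k t x v).

Let sol_tail k t x v : w v * `|sol t x v - iterate k t x v| <= 2 * C * 2^-1 ^+ k.
Proof. by have [_] := iterate_cvgP t x v; apply. Qed.

Let good_sol : good sol.
Proof.
split; first split.
- apply: (measurable_fun_cvg (h := fun k (z : phase_time R) => iterate k z.1.1 z.1.2 z.2)).
    by move=> k; have [[]] := good_iterate k.
  by move=> [[t x] v] _; have [cv _] := iterate_cvgP t x v.
- move=> t x v; apply: (@le_geometric_slack _ _ _ (2 * C)) => k.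
  have [[_ bk] _] := good_iterate k.
  rewrite -[sol t x v](subrK (iterate k t x v)) addrC.
  apply: (le_trans (ler_wpM2l (w0 v) (ler_normD _ _))); rewrite mulrDr.
  exact: lerD (bk t x v) (sol_tail k t x v).
- move=> t x v; have tl k := norm_weight1 (w1 v) (sol_tail k t x v).
  have d0 : 0 <= delta by case/andP: deltaP.
  have sv := ltW (s_gt0 v).
  split.
    rewrite -oppr_le0; apply: (@le_geometric_slack _ _ _ (s v * (2 * C))) => k.
    have [_ /(_ t x v)[p0 _]] := good_iterate k.
    have h : s v * iterate k t x v - s v * sol t x v <= s v * (2 * C) * 2^-1 ^+ k.
      rewrite -mulrBr -mulrA ler_wpM2l//; apply: le_trans (tl k).
      by rewrite distrC ler_norm.
    rewrite add0r; apply: le_trans h; rewrite opprD lerD2r lerNl -subr_ge0 opprK.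
    exact: p0.
  apply: (@le_geometric_slack _ _ _ (delta * (s v * (2 * C)))) => k.
  have [_ /(_ t x v)[_ p1]] := good_iterate k.
  have h : delta * (s v * (sol t x v - iterate k t x v)) <= delta * (s v * (2 * C)) * 2^-1 ^+ k.
    rewrite -mulrA ler_wpM2l// -mulrA ler_wpM2l//; apply: le_trans (tl k).
    exact: ler_norm.
  rewrite (_ : delta * (m v + s v * sol t x v) = delta * (m v + s v * iterate k t x v)
    + delta * (s v * (sol t x v - iterate k t x v))); last by ring.
  exact: lerD p1 h.
Qed.

(** The contraction estimate, applied to an iterate and the limit, replaces a passage to the limit
    under the integrals. *)
Let sol_fixed t x v : sol t x v = Phi sol t x v.
Proof.
apply/eqP; rewrite -subr_eq0 -normr_le0 -(pmulr_rle0 _ (wp v)).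
apply: (@le_geometric_slack _ _ _ (2 * C)) => k; rewrite add0r.
have e0 : 0 <= 2 * C * 2^-1 ^+ k by rewrite mulr_ge0 ?exprn_ge0// mulr_ge0.
have h1 := Phi_contraction e0 (good_iterate k) good_sol
  (fun t x v => eq_ind _ (fun z => w v * z <= _) (sol_tail k t x v) _ (distrC _ _)) t x v.
have h2 := sol_tail k.+1 t x v.
rewrite -(subrKA (iterate k.+1 t x v)).
apply: (le_trans (ler_wpM2l (w0 v) (ler_normD _ _))); rewrite mulrDr.
apply: (le_trans (lerD h2 h1)); rewrite exprSr.
by rewrite le_eqVlt; apply/orP; left; apply/eqP; field.
Qed.

Let periodic (y : R3 R) (h : R3 R -> R3 R -> R) := forall x v, h (x + y) v = h x v.

(** For the torus: the iteration commutes with translations in x, so every period of f0 is inherited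
    by the iterates and by their limit. *)
Let sol_periodic y : periodic y f0 -> forall t, periodic y (sol t).
Proof.
move=> pf0; have pk k t : periodic y (iterate k t).
  elim: k t => [//|k IH] t x v; rewrite /iterate /= -/(iterate k) /Phi.
  case: ifP => // _; have shift z : x + y - z = x - z + y by rewrite addrAC.
  have IHf r z : iterate k r (z + y) = iterate k r z by apply/funext => u; exact: IH.
  by rewrite shift pf0; congr (_ + _); apply: eq_Rintegral => r _; rewrite shift IHf.
by move=> t x v; rewrite /sol; congr (limn _); apply/funext => k; exact: pk.
Qed.

Lemma physical_solution_exists : exists f : R -> R3 R -> R3 R -> R,
  [/\ space_time_bounded beta N f,
      forall t x v, 0 <= m v + s v * f t x v /\ delta * (m v + s v * f t x v) <= 1,
      mild_solution gamma b delta rho T f0 f &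
      forall y, (forall x v, f0 (x + y) v = f0 x v) -> forall t x v, f t (x + y) v = f t x v].
Proof.
have [hs ps] := good_sol; exists sol; split => //.
  rewrite /mild_solution; cbv zeta; rewrite -/n => t x v tI; have /andP[t0 tT] := tI.
  have /andP[n0 nA] := nB v.
  pose y r := sol r (x - (t - r) *: v) v.
  pose p r := P (sol r (x - (t - r) *: v)) v.
  have my : measurable_fun setT y by exact: (measurable_path hs t x v).
  have mp : measurable_fun setT p by exact: (measurable_P_path t x v hs).
  (* A common bound for y and p, as the change of rate uses a single constant. *)
  have yB r : `|y r| <= 2 * L * N + N.
    have [h _ _] := path_bounds N0 hs t x v r; apply: (le_trans h).
    by rewrite lerDr mulr_ge0// mulr_ge0// ltW.
  have pB r : `|p r| <= 2 * L * N + N.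
    apply: (@le_trans _ _ (2 * L * N)); last by rewrite lerDl.
    by apply: norm_weight1 (w1 v) _; apply: P_bound; exact: (space_time_slice hs).
  (* At an earlier time r of the same characteristic the fixed-point equation has the same foot x -
     t v, so y solves a scalar equation with rate L. *)
  have yE r : 0 <= r <= t -> y r = expR (- L * r) * f0 (x - t *: v) v
      + \int[leb]_(r' in `[0, r]) (expR (- L * (r - r')) * p r').
    move=> /andP[r0 rt]; rewrite /y sol_fixed /Phi r0 (le_trans rt tT)/=.
    have := char_compose x v t r 0; rewrite !subr0 => ->.
    apply: (congr1 (fun z => expR (- L * r) * f0 (x - t *: v) v + z)).
    by apply: eq_Rintegral => r' _; rewrite /p char_compose.
  (* With a = nu(v) the new source is P - (L - nu) f = R + nu f = K f + Gamma f. *)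
  have := duhamel_change_rate (ltW L0) n0 t0 mp pB yE my yB.
  rewrite {1}/y subrr scale0r subr0 => ->; rewrite -addrA; congr (_ + _).
  rewrite (mild_integrals_merge N0 hs x v t0).
  by apply: eq_Rintegral => r _; rewrite /p /P /y; ring.
Qed.
End picard.

(** * Uniqueness in the weighted sup norm *)

Section uniqueness.
Context (K T : R) (f0 : R3 R -> R3 R -> R) (f g : R -> R3 R -> R3 R -> R).
Context (K0 : 0 <= K).
Context (hf : space_time_bounded beta K f) (hg : space_time_bounded beta K g).
Context (mildf : mild_solution gamma b delta rho T f0 f).
Context (mildg : mild_solution gamma b delta rho T f0 g).

Let Lk := A * (1 + K) ^+ 2 + A.

Let Lk_gt0 : 0 < Lk.
Proof. by rewrite ltr_pwDr// mulr_ge0 ?sqr_ge0// ltW. Qed.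

(** [Lk] is a Lipschitz constant of R f + nu f. With twice this rate, integrating [Lk] e^(lam r)
    over [0, t] costs at most e^(lam t) / 2, so the difference of two solutions is halved on an
    interval of any length. *)
Let lam := 2 * Lk.

Let D (h : R -> R3 R -> R3 R -> R) t x v r :=
  Rop gamma b delta rho (h r (x - (t - r) *: v)) v + n v * h r (x - (t - r) *: v) v.

Let mD h t x v : space_time_bounded beta K h -> measurable_fun setT (D h t x v).
Proof.
move=> hh; apply: measurable_funD; first exact: (measurable_Rop_path hh t x v).
by apply: measurable_funM => //; exact: (measurable_path hh t x v).
Qed.

Let D_bound h t x v r : space_time_bounded beta K h ->
  `|D h t x v r| <= A * (1 + K) ^+ 2 * K + A * K.
Proof.
move=> hh; have [h1 _ h2] := path_bounds K0 hh t x v r; have /andP[n0 nA] := nB v.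
by apply: ler_norm_add => //; apply: ler_normM2 => //; rewrite ger0_norm.
Qed.

Let mild_diff t x v : 0 <= t <= T ->
  f t x v - g t x v = \int[leb]_(r in `[0, t]) (expR (- n v * (t - r)) *
    (D f t x v r - D g t x v r)).
Proof.
move=> tI; have /andP[t0 _] := tI; have /andP[n0 nA] := nB v.
have mI : measurable (`[0, t]%classic : set (measurableTypeR R)) by exact: measurable_itv.
have merge h : space_time_bounded beta K h -> mild_solution gamma b delta rho T f0 h ->
    h t x v = expR (- n v * t) * f0 (x - t *: v) v
      + \int[leb]_(r in `[0, t]) (expR (- n v * (t - r)) * D h t x v r).
  move=> hh mh; rewrite (mh t x v tI) -addrA.
  exact: (congr1 (fun z => expR (- n v * t) * f0 (x - t *: v) v + z)
    (mild_integrals_merge K0 hh x v t0)).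
rewrite (merge f hf mildf) (merge g hg mildg).
rewrite opprD addrACA subrr add0r.
rewrite -(RintegralB mI (integrable_damped n0 (mD t x v hf) (fun r _ => D_bound t x v r hf))
  (integrable_damped n0 (mD t x v hg) (fun r _ => D_bound t x v r hg))).
by apply: eq_Rintegral => r _; rewrite -[LHS]mulrBr.
Qed.

Let contraction_step c : 0 <= c ->
  (forall t x v, 0 <= t <= T -> w v * `|f t x v - g t x v| <= c * expR (lam * t)) ->
  forall t x v, 0 <= t <= T -> w v * `|f t x v - g t x v| <= c / 2 * expR (lam * t).
Proof.
move=> c0 IH t x v tI; have /andP[t0 tT] := tI; have /andP[n0 nA] := nB v.
have wp : 0 < w v by exact: lt_le_trans (w1 v).
pose k := c / 2 / w v.
have k0 : 0 <= k by rewrite /k divr_ge0 ?divr_ge0.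
have lam0 : 0 <= lam by rewrite /lam mulr_ge0// ltW.
(* The bound is written as a multiple of the exact derivative lam e^(lam r); the summand 0 matches
   the affine exponent of [Rintegral_exp]. *)
pose q r := k * (lam * expR (lam * r + 0)).
have mE : measurable_fun setT (fun r : R => lam * expR (lam * r + 0)).
  by apply: (measurable_funM (f := cst lam)) => //; exact: measurable_expR_affine.
have EB r : 0 <= r <= t -> `|lam * expR (lam * r + 0)| <= lam * expR (lam * t + 0).
  move=> /andP[r0 rt]; rewrite ger0_norm; last exact: mulr_ge0 lam0 (expR_ge0 _).
  by rewrite ler_wpM2l// ler_expR lerD2r ler_wpM2l.
have mq : measurable_fun setT q by apply: measurable_funM.
have qB r : 0 <= r <= t -> `|q r| <= k * (lam * expR (lam * t + 0)).
  by move=> rt; rewrite normrM (ger0_norm k0) ler_wpM2l// EB.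
have mI : measurable (`[0, t]%classic : set (measurableTypeR R)) by exact: measurable_itv.
rewrite (mild_diff x v tI).
have h := @damped_norm_le R (fun r => D f t x v r - D g t x v r) q _ (n v) t n0 t0
  (measurable_funB (mD t x v hf) (mD t x v hg)) mq qB.
apply: (le_trans (ler_wpM2l (w0 v) (h _))).
  move=> r rI; have rT : 0 <= r <= T.
    by case/andP: rI => r0 rt; rewrite r0 (le_trans rt tT).
  pose y := x - (t - r) *: v; pose e := c * expR (lam * r).
  have e0 : 0 <= e by rewrite mulr_ge0// expR_ge0.
  have fg z : w z * `|f r y z - g r y z| <= e by exact: IH.
  have h1 : w v * `|Rop gamma b delta rho (f r y) v - Rop gamma b delta rho (g r y) v|
      <= A * (1 + K) ^+ 2 * e.
    exact: (RL v K0 e0 (space_time_slice hf r y) (space_time_slice hg r y) fg).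
  have h2 : w v * `|n v * (f r y v - g r y v)| <= A * e.
    rewrite normrM (ger0_norm n0) mulrCA; apply: ler_pM => //.
    by rewrite mulr_ge0.
  have -> : D f t x v r - D g t x v r = (Rop gamma b delta rho (f r y) v
      - Rop gamma b delta rho (g r y) v) + n v * (f r y v - g r y v).
    by rewrite /D -/y; ring.
  rewrite -(ler_pM2l wp); apply: (le_trans (ler_wpM2l (w0 v) (ler_normD _ _))).
  rewrite mulrDr; apply: (le_trans (lerD h1 h2)).
  rewrite /q /k /e addr0 /lam.
  rewrite [leRHS](_ : _ = Lk * (c * expR (2 * Lk * r))); last by field; rewrite gt_eqF.
  by rewrite -mulrDl; exact: lexx.
rewrite /q (RintegralZl _ mI (integrable_bounded_itv mE EB)) (Rintegral_exp _ _ t0).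
rewrite mulr0 !addr0 expR0 /k.
rewrite [leLHS](_ : _ = c / 2 * (expR (lam * t) - 1)); last by field; rewrite gt_eqF.
by rewrite ler_wpM2l ?divr_ge0// gerBl.
Qed.

Lemma mild_solution_unique t x v : 0 <= t <= T -> g t x v = f t x v.
Proof.
move=> tI; apply/eqP; rewrite eq_sym -subr_eq0 -normr_le0.
have iter k : forall t x v, 0 <= t <= T ->
    w v * `|f t x v - g t x v| <= 2 * K * 2^-1 ^+ k * expR (lam * t).
  elim: k => [|k IH] t' x' v' tI'; last first.
    have c0 : 0 <= 2 * K * 2^-1 ^+ k by rewrite mulr_ge0 ?exprn_ge0// mulr_ge0.
    by have := contraction_step c0 IH x' v' tI'; rewrite exprSr mulrA.
  have [_ hf'] := hf; have [_ hg'] := hg; have /andP[t0 _] := tI'.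
  rewrite expr0 mulr1; apply: (@le_trans _ _ (2 * K)).
    rewrite mulr_natl mulr2n; apply: (le_trans (ler_wpM2l (w0 v') (ler_normB _ _))).
    by rewrite mulrDr; exact: lerD.
  rewrite ler_peMr ?mulr_ge0// -[leLHS]expR0 ler_expR mulr_ge0//.
  by rewrite /lam mulr_ge0// ltW.
apply: (norm_weight1 (w1 v)).
apply: (@le_geometric_slack _ _ _ (2 * K * expR (lam * t))) => k; rewrite add0r.
by apply: (le_trans (iter k t x v tI)); rewrite mulrAC.
Qed.
End uniqueness.
End evolution.

(** * Supremum norms and assembly of the theorem *)

Section Linfty_norms.
Local Open Scope ereal_scope.

Lemma Linfty_vx_ub (R : realType) (g : R3 R -> R3 R -> R) (x v : R3 R) :
  `|g x v|%:E <= Linfty_vx g.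
Proof.
apply: (@le_trans _ _ (ereal_sup (range (fun x => `|g x v|%:E)))).
  by apply: ereal_sup_ubound; exists x.
by apply: ereal_sup_ubound; exists v.
Qed.

Lemma Linfty_vx_le (R : realType) (g : R3 R -> R3 R -> R) (M : R) :
  (forall x v, `|g x v| <= M)%R -> Linfty_vx g <= M%:E.
Proof.
move=> gM; apply: ge_ereal_sup => _ [v _ <-]; apply: ge_ereal_sup => _ [x _ <-].
by rewrite lee_fin.
Qed.

Lemma Linfty_Tvx_ub (R : realType) (T : R) (f : R -> R3 R -> R3 R -> R) (t : R) :
  (0 <= t <= T)%R -> Linfty_vx (f t) <= Linfty_Tvx T f.
Proof. by move=> tT; apply: ereal_sup_ubound; exists t => //=; rewrite in_itv. Qed.

Lemma Linfty_Tvx_le (R : realType) (T M : R) (f : R -> R3 R -> R3 R -> R) :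
  (forall t x v, 0 <= t <= T -> `|f t x v| <= M)%R -> Linfty_Tvx T f <= M%:E.
Proof.
move=> fM; apply: ge_ereal_sup => _ [t /= tT <-]; apply: Linfty_vx_le => x v.
by apply: fM; move: tT; rewrite in_itv.
Qed.

Lemma Linfty_vx_fin (R : realType) (g : R3 R -> R3 R -> R) :
  Linfty_vx g < +oo -> (fine (Linfty_vx g))%:E = Linfty_vx g.
Proof.
move=> goo; rewrite fineK// ge0_fin_numE//.
by apply: le_trans (Linfty_vx_ub g 0%R 0%R); rewrite lee_fin.
Qed.

End Linfty_norms.

Lemma norm_weighted (R : realType) (beta : R) (g : R3 R -> R3 R -> R) (x v : R3 R) :
  `|weighted beta g x v| = weight beta v * `|g x v|.
Proof. by rewrite normrM ger0_norm// powR_ge0. Qed.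

Lemma le_inv_delta (R : realType) (delta F : R) : 0 <= delta ->
  (F%:E <= inv_delta delta)%E = (delta * F <= 1).
Proof.
rewrite le_eqVlt /inv_delta => /predU1P[<-|d0]; first by rewrite eqxx mul0r ler01 leey.
by rewrite gt_eqF// lee_fin -[_^-1]div1r ler_pdivlMr// mulrC.
Qed.

Theorem theorem1p1 (R : realType) (gamma beta : R) :
  -3 < gamma < 0 -> 6 < beta ->
  exists2 C1 : R, 0 < C1 &
  forall b : R -> R, angular_kernel b ->
  exists Cstar : R -> R,
    (forall rho, 0 < rho -> 0 < Cstar rho /\ {for rho, continuous Cstar}) /\
    forall (Omega : spatial_domain R) (delta rho : R) (f0 : R3 R -> R3 R -> R),
      0 <= delta <= 1 -> 0 < rho ->
      initial_class Omega beta f0 ->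
      between_0_inv_delta delta (perturb delta rho f0) ->
      let M := fine (Linfty_vx (weighted beta f0)) in
      let T1 := C1 / (Cstar rho * (1 + M + M ^+ 2)) in
      exists f : R -> R3 R -> R3 R -> R,
        [/\ solution_class Omega beta T1 f,
            mild_solution gamma b delta rho T1 f0 f,
            forall t, 0 <= t <= T1 ->
              between_0_inv_delta delta (perturb delta rho (f t)),
            (Linfty_Tvx T1 (fun t => weighted beta (f t))
               <= 2%:E * Linfty_vx (weighted beta f0))%E &
            forall g : R -> R3 R -> R3 R -> R,
              solution_class Omega beta T1 g ->
              mild_solution gamma b delta rho T1 f0 g ->
              forall t x v, 0 <= t <= T1 -> g t x v = f t x v].
Proof.
move=> gammaP beta6; have beta0 : 0 <= beta by apply: ltW; apply: lt_trans beta6.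
(* [C1] is chosen before b is known, so J, which depends on b, is put into [Cstar]. *)
exists 1 => // b bP; have [J J0 JP] := cint_bound gammaP bP.
pose A (rho : R) := 16 * (J + 1) * expR (beta ^+ 2) ^+ 2 * (2 + rho + rho^-1) ^+ 4.
have A_gt0 (rho : R) : 0 < rho -> 0 < A rho.
  move=> rho0; have i0 : 0 < rho^-1 by rewrite invr_gt0.
  rewrite /A mulr_gt0//; last by rewrite exprn_gt0// addr_gt0// addr_gt0.
  by rewrite mulr_gt0 ?exprn_gt0 ?expR_gt0// mulr_gt0// ltr_wpDl.
exists (fun rho => 16 * A rho); split=> [rho rho0|].
  split; first by rewrite mulr_gt0// A_gt0.
  apply: continuousM; first exact: cvg_cst.
  apply: continuousM; first exact: cvg_cst.
  apply: (@continuous_comp _ _ _ (fun r : R => 2 + r + r^-1) (fun z => z ^+ 4)).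
    apply: continuousD; first by apply: continuousD; [exact: cvg_cst|exact: cvg_id].
    by apply: continuousV; [rewrite gt_eqF|exact: cvg_id].
  exact: exprn_continuous.
move=> Omega delta rho f0 deltaP rho0 [mf0 def0 fin0] btw0 M T1.
have d0 : 0 <= delta by case/andP: deltaP.
have ME : M%:E = Linfty_vx (weighted beta f0) by exact: Linfty_vx_fin.
have f0M x v : weight beta v * `|f0 x v| <= M.
  by rewrite -norm_weighted -lee_fin ME; exact: Linfty_vx_ub.
have M0 : 0 <= M.
  by apply: le_trans (f0M 0 0); rewrite mulr_ge0// powR_ge0.
have F_ge0 x v : 0 <= mu delta rho v + sqrt_mubar delta rho v * f0 x v.
  by have [] := btw0 x v.
have F_le1 x v : delta * (mu delta rho v + sqrt_mubar delta rho v * f0 x v) <= 1.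
  by have [_] := btw0 x v; rewrite le_inv_delta.
have D0 : 0 < 1 + M + M ^+ 2 by rewrite ltr_wpDr ?sqr_ge0// ltr_pwDl.
(* With [C1] = 1 and [Cstar] = 16 A this reduces to (1 + 2 M)^2 <= 4 (1 + M + M^2). *)
have LT : A rho * (1 + 2 * M) ^+ 2 * T1 <= 4^-1.
  have A0 := A_gt0 _ rho0; rewrite /T1.
  rewrite [leLHS](_ : _ = (1 + 2 * M) ^+ 2 / (16 * (1 + M + M ^+ 2))); last first.
    by field; rewrite !gt_eqF.
  rewrite ler_pdivrMr; last by rewrite mulr_gt0.
  have := sqr_ge0 M; move: M0; rewrite !expr2; lra.
have [f [hf phys mildf perf]] :=
  physical_solution_exists gammaP bP beta0 deltaP rho0 J0 JP M0 mf0 f0M F_ge0 F_le1 LT.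
have [mf bf] := hf.
have fT : (Linfty_Tvx T1 (fun t => weighted beta (f t)) <= (2 * M)%:E)%E.
  by apply: Linfty_Tvx_le => t x v _; rewrite norm_weighted.
exists f; split => //.
- split; first exact: measurable_funTS.
  + move=> t _; case: Omega def0 => //= l def0 x v i j k.
    by apply: perf => x' v'; exact: def0.
  + exact: le_lt_trans fT (ltry _).
- move=> t _ x v; have [p0 p1] := phys t x v; split; first exact: p0.
  by rewrite le_inv_delta.
- by rewrite -ME -EFinM.
move=> g [mg defg fing] mildg t x v tI.
pose G := fine (Linfty_Tvx T1 (fun t => weighted beta (g t))).
have gG s y u : 0 <= s <= T1 -> weight beta u * `|g s y u| <= G.
  move=> sI; have ub := Linfty_Tvx_ub (fun t => weighted beta (g t)) sI.
  have lb := Linfty_vx_ub (weighted beta (g s)) y u.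
  rewrite -norm_weighted -lee_fin /G fineK; first exact: le_trans lb ub.
  by rewrite ge0_fin_numE//; apply: le_trans (le_trans lb ub); rewrite lee_fin.
(* Of g only some finite norm is known, so f and g are placed in a common ball; its radius affects
   only the exponential rate in the uniqueness argument. *)
pose K := Num.max (2 * M) G.
have K0 : 0 <= K by rewrite le_max mulr_ge0.
(* Outside [0, T1] nothing is known about [g], not even measurability. *)
pose g' s y u := if 0 <= s <= T1 then g s y u else f0 y u.
have g'E s : 0 <= s <= T1 -> g' s = g s.
  by move=> sI; apply/funext => y; apply/funext => u; rewrite /g' sI.
have hg' : space_time_bounded beta K g'.
  split; last first.
    move=> s y u; rewrite /g' le_max; case: ifP => sI; first by rewrite gG// orbT.
    by apply/orP; left; apply: (le_trans (f0M y u)); rewrite ler_peMl// ler1n.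
  have mt : measurable_fun setT (fun z : phase_time R => z.1.1 : R).
    exact: (measurableT_comp measurable_fst measurable_fst).
  apply: measurable_fun_if => //.
  - by apply: measurable_and; apply: measurable_fun_ler.
  - by rewrite setTI; exact: mg.
  - apply: measurable_funTS.
    apply: (measurableT_comp mf0 (g := fun z : phase_time R => (z.1.2, z.2))).
    apply: measurable_fun_pair; last exact: measurable_snd.
    exact: (measurableT_comp measurable_snd measurable_fst).
have hfK : space_time_bounded beta K f.
  by split=> // s y u; rewrite le_max bf.
have mildg' : mild_solution gamma b delta rho T1 f0 g'.
  rewrite /mild_solution; cbv zeta => s y u sI.
  have sub r : r \in `[0, s]%classic -> 0 <= r <= T1.
    rewrite inE/= in_itv/= => /andP[r0 rs]; case/andP: sI => _ sT.
    by rewrite r0 (le_trans rs sT).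
  have e (O : (R3 R -> R) -> R3 R -> R) :
      \int[lebesgue_measure]_(r in `[0, s])
        (expR (- nu gamma b delta rho u * (s - r)) * O (g' r (y - (s - r) *: u)) u) =
      \int[lebesgue_measure]_(r in `[0, s])
        (expR (- nu gamma b delta rho u * (s - r)) * O (g r (y - (s - r) *: u)) u).
    by apply: eq_Rintegral => r /sub rI; rewrite g'E.
  rewrite (g'E s sI) (e (Kop gamma b delta rho)) (e (Gamma gamma b delta rho)).
  exact: (mildg s y u sI).
rewrite -(g'E t tI).
exact: (mild_solution_unique gammaP bP beta0 deltaP rho0 J0 JP K0 hfK hg' mildf mildg' x v tI).
Qed.
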